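(* Let $u,v\in H(\mathbb{D})$ and $\varphi,\psi\in S(\mathbb{D})$, and write $\rho(z)=\rho(\varphi(z),\psi(z))$. Assume that $$\sup_{z\in\mathbb{D}}(1-|z|^2)|u'(z)|\rho(z)<\infty\quad\text{and}\quad \sup_{z\in\mathbb{D}}(1-|z|^2)|v'(z)|\rho(z)<\infty,$$ and that $$(1-|z|^2)|u'(z)|\rho(z)\to0\quad\text{and}\quad(1-|z|^2)|v'(z)|\rho(z)\to0\quad\text{as }\rho(z)\to0.$$ Suppose that $uC_{\varphi}-vC_{\psi}$ is bounded from $H^\infty$ to $\mathcal{B}$. Then the following statements are equivalent. (i) $uC_{\varphi}-vC_{\psi}:H^\infty\to\mathcal{B}$ is compact. (ii) For each $(n,m)\in\{(0,0),(0,1),(0,2),(1,2)\}$, $$\lim_{|a|\to1}\ \sup_{b\in\mathbb{D}}\left\|(uC_{\varphi}-vC_{\psi})\left((\sigma_a^{n+1}-a\sigma_a^{n})\sigma_b^m\right)\right\|_{\mathcal{B}}=0.$$ (iii) $\displaystyle\lim_{k\to\infty}\|u\varphi^k-v\psi^k\|_{\mathcal{B}}=0.$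
   Context: $\mathbb{D}$ is the open unit disk in $\mathbb{C}$, $H(\mathbb{D})$ is the set of analytic functions on $\mathbb{D}$, and $S(\mathbb{D})$ is the set of all analytic self-maps of $\mathbb{D}$. $H^\infty$ is the space of bounded analytic functions on $\mathbb{D}$ with the supremum norm. For $f\in H(\mathbb{D})$ put $\|f\|_{\mathcal{B}}=\sup_{z\in\mathbb{D}}(1-|z|^2)|f'(z)|\in[0,\infty]$ (a seminorm); the Bloch space $\mathcal{B}$ consists of all $f\in H(\mathbb{D})$ with $\|f\|_{\mathcal{B}}<\infty$ and is a Banach space under the norm $|f(0)|+\|f\|_{\mathcal{B}}$. For $a\in\mathbb{D}$, $\sigma_a(z)=\frac{a-z}{1-\overline{a}z}$. The pseudo-hyperbolic distance is $\rho(z,w)=\left|\frac{z-w}{1-\overline{w}z}\right|$ for $z,w\in\mathbb{D}$. For $u\in H(\mathbb{D})$ and $\varphi\in S(\mathbb{D})$, the weighted composition operator is $(uC_\varphi f)(z)=u(z)f(\varphi(z))$, $f\in H(\mathbb{D})$. The notations $\varphi^k$, $\psi^k$ and $\sigma_a^n$ denote pointwise powers (with zeroth power equal to the constant function $1$). The phrase ''$G(z)\to0$ as $\rho(z)\to0$'' means that $G(z_n)\to 0$ for every sequence $\{z_n\}$ in $\mathbb{D}$ with $\rho(z_n)\to0$. The limit $|a|\to1$ is taken over $a\in\mathbb{D}$. *)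

(* Defs.v *)
From Stdlib Require Import Reals List.
From Coquelicot Require Import Coquelicot.
Import ListNotations.

Open Scope R_scope.

(* Functions on the unit disk are represented by total functions C -> C.
   Every notion below depends only on their values on the disk: the disk is
   open, so the derivative at a point of the disk is determined by them. *)

Definition disk (z : C) : Prop := Cmod z < 1.

Definition sup_disk (g : C -> Rbar) : Rbar :=
  Rbar_lub (fun y => exists z, disk z /\ y = g z).

Definition analytic_disk (f : C -> C) : Prop :=
  forall z, disk z -> @ex_derive C_AbsRing C_NormedModule f z.

Definition self_map_disk (phi : C -> C) : Prop :=
  analytic_disk phi /\ forall z, disk z -> disk (phi z).

Definition Hinf_norm (f : C -> C) : Rbar :=
  sup_disk (fun z => Finite (Cmod (f z))).

Definition Hinf (f : C -> C) : Prop :=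
  analytic_disk f /\ Rbar_lt (Hinf_norm f) p_infty.

Definition bloch_seminorm (f : C -> C) : Rbar :=
  sup_disk (fun z => Finite ((1 - Cmod z ^ 2) * Cmod (C_derive f z))).

Definition bloch (f : C -> C) : Prop :=
  analytic_disk f /\ Rbar_lt (bloch_seminorm f) p_infty.

Definition bloch_norm (f : C -> C) : Rbar :=
  Rbar_plus (Finite (Cmod (f (RtoC 0)))) (bloch_seminorm f).

Definition sigma (a z : C) : C := ((a - z) / (1 - Cconj a * z))%C.

Definition rho (z w : C) : R := Cmod ((z - w) / (1 - Cconj w * z))%C.

Definition wcomp (u phi : C -> C) (f : C -> C) (z : C) : C :=
  (u z * f (phi z))%C.

Definition wcomp_diff (u phi v psi : C -> C) (f : C -> C) (z : C) : C :=
  (wcomp u phi f z - wcomp v psi f z)%C.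

Definition bounded_Hinf_bloch (T : (C -> C) -> C -> C) : Prop :=
  (forall f, Hinf f -> bloch (T f)) /\
  exists M : R, forall f, Hinf f ->
    Rbar_le (bloch_norm (T f)) (Rbar_mult (Finite M) (Hinf_norm f)).

(* The norm topology of the Bloch space.  Two representatives of the same
   function on the disk are at distance 0, so they lie in the same open sets. *)

Definition bloch_dist (f g : C -> C) : Rbar :=
  bloch_norm (fun z => (f z - g z)%C).

Definition bloch_open (U : (C -> C) -> Prop) : Prop :=
  forall f, bloch f -> U f ->
  exists r : posreal, forall g, bloch g -> Rbar_lt (bloch_dist g f) r -> U g.

Definition bloch_closure (A : (C -> C) -> Prop) (f : C -> C) : Prop :=
  bloch f /\ forall r : posreal, exists g, A g /\ Rbar_lt (bloch_dist g f) r.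

Definition bloch_compact (K : (C -> C) -> Prop) : Prop :=
  forall (I : Type) (U : I -> (C -> C) -> Prop),
    (forall i, bloch_open (U i)) ->
    (forall f, K f -> exists i, U i f) ->
    exists l : list I, forall f, K f -> exists i, In i l /\ U i f.

(* For an operator that maps Hinf into the Bloch space: the image of the
   closed unit ball has compact closure. *)
Definition compact_Hinf_bloch (T : (C -> C) -> C -> C) : Prop :=
  bloch_compact
    (bloch_closure
       (fun g => exists f, Hinf f /\ Rbar_le (Hinf_norm f) 1 /\ g = T f)).

Definition tends_to_0_as_rho_to_0 (r G : C -> R) : Prop :=
  forall z : nat -> C, (forall n, disk (z n)) ->
    is_lim_seq (fun n => r (z n)) 0 -> is_lim_seq (fun n => G (z n)) 0.

(* Convergence to 0 for functions with values in the extended reals. *)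
Definition tends_to_0 {T : Type} (F : (T -> Prop) -> Prop) (G : T -> Rbar)
  : Prop :=
  forall eps : posreal, F (fun x => Rbar_lt (Rbar_abs (G x)) eps).

(* The filter "|a| -> 1, a in the disk". *)
Definition to_circle (P : C -> Prop) : Prop :=
  exists delta : posreal, forall a, disk a -> 1 - delta < Cmod a -> P a.

Definition test_fun (n m : nat) (a b z : C) : C :=
  ((Cpow (sigma a z) (n + 1) - a * Cpow (sigma a z) n)
   * Cpow (sigma b z) m)%C.

(* Main.v *)
(* For fixed z, with a = phi z and b = psi z, the quantity (1 - |z|^2) (T f)'(z)
   is a linear functional of f,
     A f(a) - B f(b) + D (1 - |a|^2) f'(a) - E (1 - |b|^2) f'(b).
   All statements are compared with the following one: T f is uniformly small when
   f is in the unit ball and is small on a large compact set.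

   Compactness gives it through the open cover by the sets U for which T f in U
   forces T f to be small once f is small on a compact set; conversely it makes the
   image of the unit ball totally bounded by Montel's theorem.

   The test functions (sigma_a^(n+1) - a sigma_a^n) sigma_b^m at a = phi z,
   b = psi z isolate D, then A, then D - E and A - B as |a| -> 1: when rho(a, b) is
   bounded below A and D tend to 0, and when rho(a, b) is small so do A - B, D - E,
   rho D and rho E, while rho A and rho B are small by hypothesis. As f and
   (1 - |w|^2) f'(w) are Lipschitz for rho, the functional is then small on the
   whole unit ball.

   Finally sigma_a and sigma_b have absolutely summable Taylor coefficients, and
   those of sigma_a - a tend to 0 individually as |a| -> 1, so the test functions are
   controlled by the powers. The only deep input is Cauchy's estimate, obtained from
   Goursat's argument in polar coordinates. *)
From Stdlib Require Import Reals List Lra Lia Psatz Classical ClassicalEpsilon.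
From Coquelicot Require Import Coquelicot.
(* Loaded after Reals, which also defines a constant called sigma. *)
Require Import Defs.
Import ListNotations.

Open Scope R_scope.

(** * Green's identity by bisection *)

(** The coefficient estimates hold at each single z for arbitrary A, B, D, E; uniformity in z enters
    only through the bounds put in. The supremum over b in (ii) is there because b = psi z moves
    with z. Exchanging (u, phi) with (v, psi) only changes the sign of the functional, so tests
    placed at psi z give B and E what tests at phi z give A and D. For rho(a, b) small, the test
    (0,1) controls only the sum A s' + (D h' + E), with s' = sigma_b(a) of modulus rho and h' close
    to -1. The assumption on rho |u'| removes A s', and D - E remains. The case that the tests
    cannot settle alone has one of a, b near the circle, the other inside, and rho bounded below.
    The coefficients at the inner point are then merely bounded, by the boundedness of the operator
    applied to the products sigma_a^i sigma_b^j, and smallness comes from f at that point. Taylor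
    series are never summed: the identity 1/(1 - conj c w) = 1 + conj c w/(1 - conj c w) is iterated
    instead. Numerical constants are not optimised. *)

Definition circulation (P Q : R -> R -> R) (x0 x1 y0 y1 : R) : R :=
  RInt (fun x => P x y0 - P x y1) x0 x1 + RInt (fun y => Q x1 y - Q x0 y) y0 y1.

(** Closedness of the form P dx + Q dy at one point: the shared [py] is both dP/dy and dQ/dx.
    [circulation] is the integral of this form along the boundary of a rectangle,
    counterclockwise. *)
Definition closed_at (P Q : R -> R -> R) (x y : R) : Prop :=
  exists px py qy, differentiable_pt_lim P x y px py /\
    differentiable_pt_lim Q x y py qy.

Lemma differentiable_pt_lim_continuous (f : R -> R -> R) x y lx ly :
  differentiable_pt_lim f x y lx ly ->
  continuous (fun u => f u y) x /\ continuous (fun v => f x v) y.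
Proof.
  intros H. split; apply (ex_derive_continuous (K := R_AbsRing) (V := R_NormedModule)).
  - exists (lx * 1 + ly * 0). apply is_derive_Reals.
    apply (derivable_pt_lim_comp_2d f (fun u => u) (fun _ => y)).
    + exact H.
    + apply derivable_pt_lim_id.
    + apply derivable_pt_lim_const.
  - exists (lx * 0 + ly * 1). apply is_derive_Reals.
    apply (derivable_pt_lim_comp_2d f (fun _ => x) (fun v => v)).
    + exact H.
    + apply derivable_pt_lim_const.
    + apply derivable_pt_lim_id.
Qed.

Lemma closed_ex_RInt_x (P Q : R -> R -> R) x0 x1 y :
  x0 <= x1 -> (forall x, x0 <= x <= x1 -> closed_at P Q x y) ->
  ex_RInt (fun x => P x y) x0 x1.
Proof.
  intros h H. apply (ex_RInt_continuous (V := R_CompleteNormedModule)).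
  rewrite Rmin_left, Rmax_right by lra. intros x hx.
  destruct (H x hx) as (px & py & qy & hP & _).
  exact (proj1 (differentiable_pt_lim_continuous _ _ _ _ _ hP)).
Qed.

Lemma closed_ex_RInt_y (P Q : R -> R -> R) x y0 y1 :
  y0 <= y1 -> (forall y, y0 <= y <= y1 -> closed_at P Q x y) ->
  ex_RInt (fun y => Q x y) y0 y1.
Proof.
  intros h H. apply (ex_RInt_continuous (V := R_CompleteNormedModule)).
  rewrite Rmin_left, Rmax_right by lra. intros y hy.
  destruct (H y hy) as (px & py & qy & _ & hQ).
  exact (proj2 (differentiable_pt_lim_continuous _ _ _ _ _ hQ)).
Qed.

Lemma ex_RInt_diff (f g : R -> R) a b :
  ex_RInt f a b -> ex_RInt g a b -> ex_RInt (fun x => f x - g x) a b.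
Proof. intros hf hg. exact (ex_RInt_minus (V := R_NormedModule) f g a b hf hg). Qed.

Lemma RInt_diff (f g : R -> R) a b :
  ex_RInt f a b -> ex_RInt g a b ->
  RInt (fun x => f x - g x) a b = RInt f a b - RInt g a b.
Proof. intros; exact (RInt_minus (V := R_CompleteNormedModule) f g a b H H0). Qed.

Lemma RInt_near_const (f : R -> R) a b c M :
  a <= b -> ex_RInt f a b -> (forall t, a <= t <= b -> Rabs (f t - c) <= M) ->
  Rabs (RInt f a b - c * (b - a)) <= (b - a) * M.
Proof.
  intros h hf H.
  replace (RInt f a b - c * (b - a)) with (RInt (fun t => f t - c) a b).
  - apply abs_RInt_le_const; try assumption.
    apply (ex_RInt_diff f (fun _ => c)); [assumption | apply ex_RInt_const].
  - pose proof (RInt_diff f (fun _ => c) a b hf (ex_RInt_const _ _ _)) as E.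
    cbv beta in E. rewrite E.
    rewrite RInt_const. unfold scal; simpl; unfold mult; simpl. ring.
Qed.

Lemma RInt_Chasles_R (f : R -> R) a b c :
  ex_RInt f a b -> ex_RInt f b c -> RInt f a b + RInt f b c = RInt f a c.
Proof. intros; exact (RInt_Chasles (V := R_CompleteNormedModule) f a b c H H0). Qed.

(** The first-order parts of [P] and [Q] contribute [- py] and [py] times the area, which cancel.
    Each of the two integrals keeps an error of at most [eps / 2 * L] times a side of length at most
    [L]. *)
Lemma circulation_small (P Q : R -> R -> R) c d :
  closed_at P Q c d -> forall eps, 0 < eps -> exists del, 0 < del /\
  forall x0 x1 y0 y1 L,
    x0 <= c <= x1 -> y0 <= d <= y1 -> x1 - x0 <= L -> y1 - y0 <= L -> L < del ->
    (forall x y, x0 <= x <= x1 -> y0 <= y <= y1 -> closed_at P Q x y) ->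
    Rabs (circulation P Q x0 x1 y0 y1) <= eps * (L * L).
Proof.
  intros (px & py & qy & hP & hQ) eps heps.
  assert (he : 0 < eps / 4) by lra.
  destruct (hP (mkposreal _ he)) as [d1 h1].
  destruct (hQ (mkposreal _ he)) as [d2 h2].
  exists (Rmin d1 d2). split.
  { apply Rmin_glb_lt; [apply d1 | apply d2]. }
  intros x0 x1 y0 y1 L hc hd hx hy hL hcl.
  assert (hL1 : L < d1) by (eapply Rlt_le_trans; [exact hL | apply Rmin_l]).
  assert (hL2 : L < d2) by (eapply Rlt_le_trans; [exact hL | apply Rmin_r]).
  simpl in h1, h2.
  assert (k1 : forall x y, x0 <= x <= x1 -> y0 <= y <= y1 ->
    Rabs (P x y - P c d - (px * (x - c) + py * (y - d))) <= eps / 4 * L).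
  { intros x y h h'. eapply Rle_trans.
    - apply h1; apply Rabs_lt_between; lra.
    - apply Rmult_le_compat_l; [lra|]. apply Rmax_lub; apply Rabs_le_between; lra. }
  assert (k2 : forall x y, x0 <= x <= x1 -> y0 <= y <= y1 ->
    Rabs (Q x y - Q c d - (py * (x - c) + qy * (y - d))) <= eps / 4 * L).
  { intros x y h h'. eapply Rle_trans.
    - apply h2; apply Rabs_lt_between; lra.
    - apply Rmult_le_compat_l; [lra|]. apply Rmax_lub; apply Rabs_le_between; lra. }
  unfold circulation.
  assert (A1 : Rabs (RInt (fun x => P x y0 - P x y1) x0 x1 - (py * (y0 - y1)) * (x1 - x0))
     <= (x1 - x0) * (eps / 2 * L)).
  { apply RInt_near_const; [lra | |].
    - apply ex_RInt_diff; apply (closed_ex_RInt_x P Q); try lra;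
        intros; apply hcl; lra.
    - intros t ht.
      pose proof (k1 t y0 ht ltac:(lra)) as e1. pose proof (k1 t y1 ht ltac:(lra)) as e2.
      apply Rabs_le_between in e1. apply Rabs_le_between in e2.
      apply Rabs_le_between. lra. }
  assert (A2 : Rabs (RInt (fun y => Q x1 y - Q x0 y) y0 y1 - (py * (x1 - x0)) * (y1 - y0))
     <= (y1 - y0) * (eps / 2 * L)).
  { apply RInt_near_const; [lra | |].
    - apply ex_RInt_diff; apply (closed_ex_RInt_y P Q); try lra;
        intros; apply hcl; lra.
    - intros t ht.
      pose proof (k2 x1 t ltac:(lra) ht) as e1. pose proof (k2 x0 t ltac:(lra) ht) as e2.
      apply Rabs_le_between in e1. apply Rabs_le_between in e2.
      apply Rabs_le_between. lra. }
  apply Rabs_le_between in A1. apply Rabs_le_between in A2. apply Rabs_le_between.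
  assert (0 <= eps / 2 * L) by (apply Rmult_le_pos; lra).
  assert ((x1 - x0) * (eps / 2 * L) <= L * (eps / 2 * L)) by (apply Rmult_le_compat_r; lra).
  assert ((y1 - y0) * (eps / 2 * L) <= L * (eps / 2 * L)) by (apply Rmult_le_compat_r; lra).
  split; nra.
Qed.

Lemma circulation_split (P Q : R -> R -> R) x0 x1 y0 y1 xm ym :
  x0 <= xm <= x1 -> y0 <= ym <= y1 ->
  (forall x y, x0 <= x <= x1 -> y0 <= y <= y1 -> closed_at P Q x y) ->
  circulation P Q x0 x1 y0 y1 =
  circulation P Q x0 xm y0 ym + circulation P Q xm x1 y0 ym +
  circulation P Q x0 xm ym y1 + circulation P Q xm x1 ym y1.
Proof.
  intros hx hy H. assert (EP : forall a b y, x0 <= a -> a <= b -> b <= x1 -> y0 <= y <= y1 ->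
     ex_RInt (fun x => P x y) a b).
  { intros. apply (closed_ex_RInt_x P Q); try lra. intros; apply H; lra. }
  assert (EQ : forall a b x, y0 <= a -> a <= b -> b <= y1 -> x0 <= x <= x1 ->
     ex_RInt (fun y => Q x y) a b).
  { intros. apply (closed_ex_RInt_y P Q); try lra. intros; apply H; lra. }
  assert (E : forall a b c d, x0 <= a -> a <= b -> b <= x1 -> y0 <= c -> c <= d -> d <= y1 ->
    RInt (fun x => P x c - P x d) a b + RInt (fun y => Q b y - Q a y) c d =
    RInt (fun x => P x c) a b - RInt (fun x => P x d) a b +
    (RInt (fun y => Q b y) c d - RInt (fun y => Q a y) c d)).
  { intros.
    rewrite (RInt_diff (fun x => P x c) (fun x => P x d) a b) by (apply EP; lra).
    rewrite (RInt_diff (fun y => Q b y) (fun y => Q a y) c d) by (apply EQ; lra).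
    reflexivity. }
  unfold circulation. rewrite !E by lra.
  pose proof (RInt_Chasles_R (fun x => P x y0) x0 xm x1
    ltac:(apply EP; lra) ltac:(apply EP; lra)).
  pose proof (RInt_Chasles_R (fun x => P x y1) x0 xm x1
    ltac:(apply EP; lra) ltac:(apply EP; lra)).
  pose proof (RInt_Chasles_R (fun y => Q x0 y) y0 ym y1
    ltac:(apply EQ; lra) ltac:(apply EQ; lra)).
  pose proof (RInt_Chasles_R (fun y => Q x1 y) y0 ym y1
    ltac:(apply EQ; lra) ltac:(apply EQ; lra)).
  cbv beta in *. lra.
Qed.

Record box := mkbox { bx0 : R; bx1 : R; by0 : R; by1 : R }.

Definition quarter_of (P Q : R -> R -> R) (b b' : box) : Prop :=
  bx0 b <= bx0 b' /\ bx1 b' <= bx1 b /\ by0 b <= by0 b' /\ by1 b' <= by1 b /\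
  bx1 b' - bx0 b' = (bx1 b - bx0 b) / 2 /\ by1 b' - by0 b' = (by1 b - by0 b) / 2 /\
  Rabs (circulation P Q (bx0 b) (bx1 b) (by0 b) (by1 b)) <=
    4 * Rabs (circulation P Q (bx0 b') (bx1 b') (by0 b') (by1 b')).

Lemma worst_quarter (P Q : R -> R -> R) (b : box) :
  bx0 b <= bx1 b -> by0 b <= by1 b ->
  (forall x y, bx0 b <= x <= bx1 b -> by0 b <= y <= by1 b -> closed_at P Q x y) ->
  exists b', quarter_of P Q b b'.
Proof.
  destruct b as [x0 x1 y0 y1]; simpl. intros hx hy H.
  pose proof (circulation_split P Q x0 x1 y0 y1 ((x0 + x1) / 2) ((y0 + y1) / 2)
    ltac:(lra) ltac:(lra) H) as E.
  set (xm := (x0 + x1) / 2) in *. set (ym := (y0 + y1) / 2) in *.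
  set (g := circulation P Q) in *.
  assert (E' : Rabs (g x0 x1 y0 y1) <= Rabs (g x0 xm y0 ym) + Rabs (g xm x1 y0 ym) +
     Rabs (g x0 xm ym y1) + Rabs (g xm x1 ym y1)).
  { rewrite E. eapply Rle_trans; [apply Rabs_triang|]. apply Rplus_le_compat_r.
    eapply Rle_trans; [apply Rabs_triang|]. apply Rplus_le_compat_r. apply Rabs_triang. }
  assert (hxm : xm = (x0 + x1) / 2) by reflexivity.
  assert (hym : ym = (y0 + y1) / 2) by reflexivity.
  destruct (Rle_dec (Rabs (g x0 x1 y0 y1)) (4 * Rabs (g x0 xm y0 ym))) as [h1|h1].
  { exists (mkbox x0 xm y0 ym); unfold quarter_of; simpl; fold g; repeat split; lra. }
  destruct (Rle_dec (Rabs (g x0 x1 y0 y1)) (4 * Rabs (g xm x1 y0 ym))) as [h2|h2].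
  { exists (mkbox xm x1 y0 ym); unfold quarter_of; simpl; fold g; repeat split; lra. }
  destruct (Rle_dec (Rabs (g x0 x1 y0 y1)) (4 * Rabs (g x0 xm ym y1))) as [h3|h3].
  { exists (mkbox x0 xm ym y1); unfold quarter_of; simpl; fold g; repeat split; lra. }
  exists (mkbox xm x1 ym y1); unfold quarter_of; simpl; fold g; repeat split; lra.
Qed.

Lemma nested_intervals (u v : nat -> R) (w : R) :
  (forall n, u n <= u (S n)) -> (forall n, v (S n) <= v n) ->
  (forall n, v n - u n = w / 2 ^ n) -> exists c, forall n, u n <= c <= v n.
Proof.
  intros hu hv hw.
  assert (hl : is_lim_seq (fun n => v n - u n) 0).
  { apply is_lim_seq_ext with (fun n => w * (/ 2) ^ n).
    - intros n. rewrite hw, pow_inv. reflexivity.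
    - replace (Finite 0) with (Rbar_mult w 0) by (simpl; f_equal; ring).
      apply is_lim_seq_scal_l. apply is_lim_seq_geom. rewrite Rabs_pos_eq; lra. }
  destruct (ex_lim_seq_adj u v hu hv hl) as (hc & hc' & e).
  exists (real (Lim_seq u)). intros n. split.
  - apply (is_lim_seq_incr_compare u); [| exact hu].
    apply Lim_seq_correct', hc.
  - rewrite e. apply (is_lim_seq_decr_compare v); [| exact hv].
    apply Lim_seq_correct', hc'.
Qed.

(* Goursat's argument: only pointwise differentiability is available, so the
   identity is obtained by bisection rather than by integrating derivatives. *)
Theorem circulation_closed (P Q : R -> R -> R) x0 x1 y0 y1 :
  x0 <= x1 -> y0 <= y1 ->
  (forall x y, x0 <= x <= x1 -> y0 <= y <= y1 -> closed_at P Q x y) ->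
  circulation P Q x0 x1 y0 y1 = 0.
Proof.
  intros hx hy H.
  set (inside b := x0 <= bx0 b /\ bx0 b <= bx1 b /\ bx1 b <= x1 /\
                   y0 <= by0 b /\ by0 b <= by1 b /\ by1 b <= y1).
  (* The condition [inside b] sits under the existential so that choice gives a total function on
     boxes, which a fixpoint can iterate. *)
  assert (step : forall b, exists b', inside b -> inside b' /\ quarter_of P Q b b').
  { intros b. destruct (classic (inside b)) as [h|h].
    - destruct (worst_quarter P Q b) as [b' hb'].
      + apply h.
      + apply h.
      + unfold inside in h. intros; apply H; lra.
      + exists b'. intros _. split; [| exact hb'].
        unfold inside, quarter_of in *. repeat split; lra.
    - exists b. intros; contradiction. }
  set (next b := proj1_sig (constructive_indefinite_description _ (step b))).
  assert (hnext : forall b, inside b -> inside (next b) /\ quarter_of P Q b (next b)).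
  { intros b. unfold next. apply proj2_sig. }
  set (B := fix B n := match n with O => mkbox x0 x1 y0 y1 | S n => next (B n) end).
  assert (hin : forall n, inside (B n)).
  { induction n; [unfold inside; simpl; repeat split; lra | apply hnext, IHn]. }
  assert (hq : forall n, quarter_of P Q (B n) (B (S n))) by (intros n; apply hnext, hin).
  assert (wx : forall n, bx1 (B n) - bx0 (B n) = (x1 - x0) / 2 ^ n).
  { induction n; [simpl; lra|]. destruct (hq n) as (_&_&_&_&e&_). rewrite e, IHn.
    simpl; field. apply pow_nonzero; lra. }
  assert (wy : forall n, by1 (B n) - by0 (B n) = (y1 - y0) / 2 ^ n).
  { induction n; [simpl; lra|]. destruct (hq n) as (_&_&_&_&_&e&_). rewrite e, IHn.
    simpl; field. apply pow_nonzero; lra. }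
  destruct (nested_intervals (fun n => bx0 (B n)) (fun n => bx1 (B n)) (x1 - x0)) as [c hc].
  { intros n; apply hq. } { intros n; apply hq. } { exact wx. }
  destruct (nested_intervals (fun n => by0 (B n)) (fun n => by1 (B n)) (y1 - y0)) as [d hd].
  { intros n; apply hq. } { intros n; apply hq. } { exact wy. }
  set (g b := circulation P Q (bx0 b) (bx1 b) (by0 b) (by1 b)).
  assert (hg : forall n, Rabs (circulation P Q x0 x1 y0 y1) <= 4 ^ n * Rabs (g (B n))).
  { induction n; [simpl; unfold g; simpl; lra|].
    destruct (hq n) as (_&_&_&_&_&_&e). fold (g (B n)) in e. fold (g (B (S n))) in e.
    eapply Rle_trans; [apply IHn|]. change (4 ^ S n) with (4 * 4 ^ n).
    assert (0 < 4 ^ n) by (apply pow_lt; lra). nra. }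
  set (L := (x1 - x0) + (y1 - y0)).
  apply Rabs_eq_0. apply Rle_antisym; [| apply Rabs_pos].
  apply le_epsilon. intros eps heps. rewrite Rplus_0_l.
  assert (hL : 0 <= L) by (unfold L; lra).
  assert (heps' : 0 < eps / (L * L + 1)) by (apply Rdiv_lt_0_compat; nra).
  destruct (circulation_small P Q c d) with (eps := eps / (L * L + 1)) as (del & hdel & hs).
  { apply H; [apply (hc O) | apply (hd O)]. }
  { exact heps'. }
  destruct (pow_lt_1_zero (/ 2) ltac:(rewrite Rabs_pos_eq; lra) (del / (L + 1)))
    as [n hn].
  { apply Rdiv_lt_0_compat; lra. }
  specialize (hn n (le_n n)). rewrite Rabs_pos_eq in hn by (apply pow_le; lra).
  rewrite pow_inv in hn.
  assert (h2n : 0 < 2 ^ n) by (apply pow_lt; lra).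
  assert (i2n : 0 < / 2 ^ n) by (apply Rinv_0_lt_compat; lra).
  assert (hsn : Rabs (g (B n)) <= eps / (L * L + 1) * ((L / 2 ^ n) * (L / 2 ^ n))).
  { apply hs.
    - apply hc.
    - apply hd.
    - rewrite wx. apply Rmult_le_compat_r; unfold L; lra.
    - rewrite wy. apply Rmult_le_compat_r; unfold L; lra.
    - apply (Rmult_lt_compat_r (L + 1)) in hn; [| lra].
      replace (del / (L + 1) * (L + 1)) with del in hn by (field; lra).
      unfold Rdiv. nra.
    - pose proof (hin n) as hi. unfold inside in hi. intros; apply H; lra. }
  eapply Rle_trans; [apply (hg n)|].
  apply Rle_trans with (4 ^ n * (eps / (L * L + 1) * ((L / 2 ^ n) * (L / 2 ^ n)))).
  { apply Rmult_le_compat_l; [apply pow_le; lra | exact hsn]. }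
  (* The loss [4 ^ n] from the subdivisions is exactly compensated by the area factor
     [(L / 2 ^ n) ^ 2]. *)
  replace (4 ^ n) with (2 ^ n * 2 ^ n) by (rewrite <- Rpow_mult_distr; f_equal; lra).
  replace (2 ^ n * 2 ^ n * (eps / (L * L + 1) * (L / 2 ^ n * (L / 2 ^ n))))
    with (eps * (L * L) / (L * L + 1)) by (field; split; nra).
  apply (Rmult_le_reg_r (L * L + 1)); [nra|].
  replace (eps * (L * L) / (L * L + 1) * (L * L + 1)) with (eps * (L * L)) by (field; nra).
  nra.
Qed.

(** * Complex derivatives *)

Notation is_cderive := (@is_derive C_AbsRing C_NormedModule).
Notation ex_cderive := (@ex_derive C_AbsRing C_NormedModule).

Lemma is_cderive_iff (f : C -> C) (z l : C) :
  is_cderive f z l <->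
  forall eps : posreal, exists del : posreal, forall w, Cmod (w - z) < del ->
    Cmod (f w - f z - (w - z) * l) <= eps * Cmod (w - z).
Proof.
  split.
  - intros [_ H] eps. destruct (H z (fun P hP => hP) eps) as [del hd].
    exists del. exact hd.
  - intros H. split; [apply is_linear_scal_l|].
    intros x hx eps. rewrite <- (is_filter_lim_locally_unique _ _ hx).
    destruct (H eps) as [del hd]. exists del. exact hd.
Qed.

(** Needed to apply [is_derive_mult] and [is_derive_comp], which use the normed module built from
    the ring [C_AbsRing]. Both notions unfold to the same epsilon-delta condition. *)
Lemma is_cderive_ring_iff (f : C -> C) (z l : C) :
  is_cderive f z l <->
  @is_derive C_AbsRing (AbsRing_NormedModule C_AbsRing) f z l.
Proof.
  rewrite is_cderive_iff. split.
  - intros H. split; [apply is_linear_scal_l|].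
    intros x hx eps. rewrite <- (is_filter_lim_locally_unique _ _ hx).
    destruct (H eps) as [del hd]. exists del. exact hd.
  - intros [_ H] eps. destruct (H z (fun P hP => hP) eps) as [del hd].
    exists del. exact hd.
Qed.

Lemma C_derive_spec (f : C -> C) (z : C) :
  ex_cderive f z -> is_cderive f z (C_derive f z).
Proof. intros H. apply C_derive_correct; [exact (RtoC 0) | exact H]. Qed.

Lemma is_cderive_const (c z : C) : is_cderive (fun _ => c) z (RtoC 0).
Proof. apply (is_derive_const (K := C_AbsRing) (V := C_NormedModule)). Qed.

Lemma is_cderive_id (z : C) : is_cderive (fun w => w) z (RtoC 1).
Proof. apply is_cderive_ring_iff. apply (is_derive_id (K := C_AbsRing)). Qed.

Lemma is_cderive_plus (f g : C -> C) (z l k : C) :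
  is_cderive f z l -> is_cderive g z k ->
  is_cderive (fun w => f w + g w)%C z (l + k)%C.
Proof. exact (is_derive_plus (K := C_AbsRing) (V := C_NormedModule) f g z l k). Qed.

Lemma is_cderive_minus (f g : C -> C) (z l k : C) :
  is_cderive f z l -> is_cderive g z k ->
  is_cderive (fun w => f w - g w)%C z (l - k)%C.
Proof. exact (is_derive_minus (K := C_AbsRing) (V := C_NormedModule) f g z l k). Qed.

Lemma is_cderive_mult (f g : C -> C) (z l k : C) :
  is_cderive f z l -> is_cderive g z k ->
  is_cderive (fun w => f w * g w)%C z (l * g z + f z * k)%C.
Proof.
  rewrite !is_cderive_ring_iff. intros hf hg.
  exact (is_derive_mult (K := C_AbsRing) f g z l k hf hg Cmult_comm).
Qed.

Lemma is_cderive_comp (f g : C -> C) (z l k : C) :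
  is_cderive f (g z) l -> is_cderive g z k ->
  is_cderive (fun w => f (g w)) z (k * l)%C.
Proof.
  rewrite (is_cderive_ring_iff g). intros hf hg.
  exact (is_derive_comp (K := C_AbsRing) (V := C_NormedModule) f g z l k hf hg).
Qed.

Lemma is_cderive_ext_loc (f g : C -> C) (z l : C) (r : R) :
  0 < r -> (forall w, Cmod (w - z) < r -> f w = g w) ->
  is_cderive f z l -> is_cderive g z l.
Proof.
  intros hr E. rewrite !is_cderive_iff. intros H eps.
  destruct (H eps) as [del hd].
  assert (h : 0 < Rmin del r) by (apply Rmin_glb_lt; [apply del | exact hr]).
  exists (mkposreal _ h). simpl. intros w hw.
  rewrite <- !E.
  - apply hd. eapply Rlt_le_trans; [exact hw | apply Rmin_l].
  - replace (z - z)%C with (RtoC 0) by ring. rewrite Cmod_0. exact hr.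
  - eapply Rlt_le_trans; [exact hw | apply Rmin_r].
Qed.

Lemma is_cderive_eq (f : C -> C) (z l k : C) :
  is_cderive f z l -> l = k -> is_cderive f z k.
Proof. intros H <-. exact H. Qed.

Lemma Cmod_sub_sym (z w : C) : Cmod (z - w) = Cmod (w - z).
Proof. rewrite <- Cmod_opp. f_equal. ring. Qed.

Lemma Cmod_triangle_sub (z w : C) : Cmod (z - w) <= Cmod z + Cmod w.
Proof. unfold Cminus. rewrite <- (Cmod_opp w). apply Cmod_triangle. Qed.

Lemma Cmod_triangle_rev (z w : C) : Cmod z - Cmod w <= Cmod (z - w).
Proof.
  pose proof (Cmod_triangle (z - w) w) as H.
  replace (z - w + w)%C with z in H by ring. lra.
Qed.

Lemma is_cderive_inv (z : C) : z <> RtoC 0 ->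
  is_cderive Cinv z (- / (z * z))%C.
Proof.
  intros hz. rewrite is_cderive_iff. intros eps.
  pose proof (proj1 (Cmod_gt_0 z) hz) as hm.
  (* The remainder is [(w - z)^2 / (w z^2)]. The first bound gives |w| > |z|/2, the second then
     makes the remainder at most eps |w - z|. *)
  assert (hd : 0 < Rmin (Cmod z / 2) (eps * (Cmod z ^ 3 / 2))).
  { apply Rmin_glb_lt; [lra|]. apply Rmult_lt_0_compat; [apply eps|].
    assert (0 < Cmod z ^ 3) by (apply pow_lt; lra). lra. }
  exists (mkposreal _ hd). simpl. intros w hw.
  assert (h1 : Cmod (w - z) < Cmod z / 2)
    by (eapply Rlt_le_trans; [exact hw | apply Rmin_l]).
  assert (h2 : Cmod (w - z) < eps * (Cmod z ^ 3 / 2))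
    by (eapply Rlt_le_trans; [exact hw | apply Rmin_r]).
  assert (hw2 : Cmod z / 2 < Cmod w).
  { pose proof (Cmod_triangle_rev z w). rewrite Cmod_sub_sym in H. lra. }
  assert (hw0 : w <> RtoC 0) by (apply Cmod_gt_0; lra).
  replace (/ w - / z - (w - z) * - / (z * z))%C with
    ((w - z) * ((w - z) / (w * (z * z))))%C by (field; split; assumption).
  rewrite Cmod_mult, Rmult_comm.
  apply Rmult_le_compat_r; [apply Cmod_ge_0|].
  rewrite Cmod_div by (repeat apply Cmult_neq_0; assumption).
  rewrite !Cmod_mult.
  assert (0 < Cmod z * Cmod z) by nra.
  apply (Rmult_le_reg_r (Cmod w * (Cmod z * Cmod z))); [nra|].
  unfold Rdiv. rewrite Rmult_assoc, Rinv_l by nra.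
  pose proof (cond_pos eps). simpl in h2.
  assert (Cmod z / 2 * (Cmod z * Cmod z) <= Cmod w * (Cmod z * Cmod z))
    by (apply Rmult_le_compat_r; lra).
  nra.
Qed.

Lemma C_derive_ext_loc (f g : C -> C) (z : C) (r : R) :
  0 < r -> (forall w, Cmod (w - z) < r -> f w = g w) ->
  ex_cderive f z -> C_derive g z = C_derive f z.
Proof.
  intros hr E H. apply is_C_derive_unique.
  apply is_cderive_ext_loc with f r; auto. apply C_derive_spec, H.
Qed.

(* The real mean value theorem applied to the component of [f] along
   [f b - f a]. *)
Lemma Cmod_mean_value (f : C -> C) (a b : C) (K : R) :
  (forall t, 0 <= t <= 1 -> exists l, is_cderive f (a + RtoC t * (b - a))%C l /\
     Cmod l <= K) ->
  Cmod (f b - f a) <= K * Cmod (b - a).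
Proof.
  intros H.
  destruct (Req_dec (Cmod (f b - f a)) 0) as [e|e].
  { rewrite e. destruct (H 0 ltac:(lra)) as (l & _ & hl).
    apply Rmult_le_pos; [eapply Rle_trans; [apply Cmod_ge_0 | exact hl] | apply Cmod_ge_0]. }
  set (m := Cmod (f b - f a)) in *.
  assert (hm : 0 < m) by (pose proof (Cmod_ge_0 (f b - f a)); fold m in H0; lra).
  set (c := Cconj (f b - f a)).
  assert (hc : Cmod c = m) by apply Cmod_conj.
  set (g t := Re (c * f (a + RtoC t * (b - a)))%C).
  assert (hg : forall t, 0 <= t <= 1 -> exists d, is_derive g t d /\ Rabs d <= m * K * Cmod (b - a)).
  { intros t ht. destruct (H t ht) as (l & hl & hk).
    exists (Re (c * ((b - a) * l))%C). split.
    - apply is_derive_Reals. intros eps heps.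
      rewrite is_cderive_iff in hl.
      assert (hB : 0 < m * (Cmod (b - a) + 1)).
      { pose proof (Cmod_ge_0 (b - a)). nra. }
      assert (heps' : 0 < eps / 2 / (m * (Cmod (b - a) + 1))) by (apply Rdiv_lt_0_compat; lra).
      destruct (hl (mkposreal _ heps')) as [d hd]. simpl in hd.
      assert (hd' : 0 < d / (Cmod (b - a) + 1)).
      { apply Rdiv_lt_0_compat; [apply d | pose proof (Cmod_ge_0 (b - a)); lra]. }
      exists (mkposreal _ hd'). cbn [pos]. intros h hh0 hh.
      specialize (hd (a + RtoC (t + h) * (b - a))%C).
      replace (a + RtoC (t + h) * (b - a) - (a + RtoC t * (b - a)))%C with (RtoC h * (b - a))%C
        in hd by (rewrite RtoC_plus; ring).
      rewrite Cmod_mult, Cmod_R in hd.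
      assert (hb : 0 < Cmod (b - a) + 1) by (pose proof (Cmod_ge_0 (b - a)); lra).
      assert (hlt : Rabs h * Cmod (b - a) < d).
      { apply (Rmult_lt_compat_r (Cmod (b - a) + 1)) in hh; [|lra].
        replace (d / (Cmod (b - a) + 1) * (Cmod (b - a) + 1)) with (pos d) in hh by (field; lra).
        pose proof (Rabs_pos h). nra. }
      specialize (hd hlt).
      set (X := (f (a + RtoC (t + h) * (b - a)) - f (a + RtoC t * (b - a)) -
        RtoC h * (b - a) * l)%C) in *.
      assert (E : (g (t + h) - g t) / h - Re (c * ((b - a) * l))%C = Re (c * X)%C / h).
      { unfold g, X. unfold RtoC. destruct c, (b - a)%C, l.
        destruct (f _), (f _). simpl. field. exact hh0. }
      rewrite E. unfold Rdiv at 1. rewrite Rabs_mult, Rabs_inv.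
      assert (ha : 0 < Rabs h) by (apply Rabs_pos_lt; exact hh0).
      apply (Rmult_lt_reg_r (Rabs h)); [exact ha|].
      rewrite Rmult_assoc, Rinv_l, Rmult_1_r by lra.
      eapply Rle_lt_trans; [apply re_le_Cmod|]. rewrite Cmod_mult, hc.
      apply Rle_lt_trans with (m * (eps / 2 / (m * (Cmod (b - a) + 1)) * (Rabs h * Cmod (b - a)))).
      { apply Rmult_le_compat_l; lra. }
      replace (m * (eps / 2 / (m * (Cmod (b - a) + 1)) * (Rabs h * Cmod (b - a)))) with
        (eps / 2 * Rabs h * (Cmod (b - a) / (Cmod (b - a) + 1))) by (field; lra).
      assert (Cmod (b - a) / (Cmod (b - a) + 1) <= 1).
      { apply (Rmult_le_reg_r (Cmod (b - a) + 1)); [lra|].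
        unfold Rdiv. rewrite Rmult_assoc, Rinv_l; lra. }
      assert (0 < eps * Rabs h) by (apply Rmult_lt_0_compat; lra).
      assert (eps / 2 * Rabs h * (Cmod (b - a) / (Cmod (b - a) + 1)) <= eps / 2 * Rabs h * 1).
      { apply Rmult_le_compat_l; lra. }
      lra.
    - eapply Rle_trans; [apply re_le_Cmod|]. rewrite !Cmod_mult, hc.
      pose proof (Cmod_ge_0 (b - a)). pose proof (Cmod_ge_0 l).
      replace (m * K * Cmod (b - a)) with (m * (Cmod (b - a) * K)) by ring.
      apply Rmult_le_compat_l; [lra|]. apply Rmult_le_compat_l; lra. }
  destruct (MVT_gen g 0 1 (Derive g)) as (x & hx & E).
  { rewrite Rmin_left, Rmax_right by lra. intros x hx. apply Derive_correct.
    destruct (hg x ltac:(lra)) as (d & hd & _). exists d; exact hd. }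
  { rewrite Rmin_left, Rmax_right by lra. intros x hx.
    destruct (hg x ltac:(lra)) as (d & hd & _). apply derivable_continuous_pt.
    exists d. apply is_derive_Reals, hd. }
  rewrite Rmin_left, Rmax_right in hx by lra.
  destruct (hg x hx) as (d & hd & hdb).
  rewrite (is_derive_unique _ _ _ hd) in E.
  assert (E2 : g 1 - g 0 = m * m).
  { unfold g.
    replace (a + RtoC 1 * (b - a))%C with b by ring.
    replace (a + RtoC 0 * (b - a))%C with a by ring.
    transitivity (Re (c * (f b - f a))%C).
    - unfold Re, Cmult, Cminus, Cplus, Copp; simpl. ring.
    - unfold c. rewrite Cmult_comm, <- Cmod2_conj. fold m.
      simpl. ring. }
  rewrite E2, Rminus_0_r, Rmult_1_r in E.
  apply (Rmult_le_reg_l m); [exact hm|]. rewrite E.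
  pose proof (Rle_abs d). lra.
Qed.

(** * Cauchy's estimate *)

Lemma differentiable_pt_lim_snd (x y : R) : differentiable_pt_lim (fun _ v => v) x y 0 1.
Proof.
  intros eps. exists eps. intros u v hu hv.
  replace (v - y - (0 * (u - x) + 1 * (v - y))) with 0 by ring. rewrite Rabs_R0.
  apply Rmult_le_pos; [apply Rlt_le, eps|].
  eapply Rle_trans; [apply Rabs_pos | apply Rmax_l].
Qed.

Lemma differentiable_pt_lim_prod (x y : R) : differentiable_pt_lim Rmult x y y x.
Proof.
  intros eps. exists eps. intros u v hu hv.
  replace (u * v - x * y - (y * (u - x) + x * (v - y))) with ((u - x) * (v - y)) by ring.
  rewrite Rabs_mult. apply Rmult_le_compat; try apply Rabs_pos; [lra | apply Rmax_r].
Qed.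

Lemma differentiable_pt_lim_tensor (f g : R -> R) (x y l k : R) :
  derivable_pt_lim f x l -> derivable_pt_lim g y k ->
  differentiable_pt_lim (fun u v => f u * g v) x y (l * g y) (f x * k).
Proof.
  intros hf hg.
  assert (D1 : differentiable_pt_lim (fun u _ => f u) x y l 0)
    by (apply differentiable_pt_lim_proj1_0, hf).
  assert (D2 : differentiable_pt_lim (fun _ v => g v) x y 0 k).
  { pose proof (differentiable_pt_lim_comp (fun u _ => g u) (fun _ v => v) (fun _ v => v)
      x y k 0 0 1 0 1 (differentiable_pt_lim_proj1_0 g y y k hg)
      (differentiable_pt_lim_snd x y) (differentiable_pt_lim_snd x y)) as H.
    replace 0 with (k * 0 + 0 * 0) by ring. replace k with (k * 1 + 0 * 1) at 2 by ring.
    exact H. }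
  pose proof (differentiable_pt_lim_comp Rmult _ _ x y _ _ _ _ _ _
    (differentiable_pt_lim_prod (f x) (g y)) D1 D2) as H.
  replace (l * g y) with (g y * l + f x * 0) by ring.
  replace (f x * k) with (g y * 0 + f x * k) by ring. exact H.
Qed.

Lemma Cmod_le_sqrt2_Rmax (z : C) :
  Cmod z <= 2 * Rmax (Rabs (fst z)) (Rabs (snd z)).
Proof.
  eapply Rle_trans; [apply Cmod_2Rmax|]. apply Rmult_le_compat_r.
  - eapply Rle_trans; [apply Rabs_pos | apply Rmax_l].
  - rewrite <- (sqrt_square 2 ltac:(lra)) at 2. apply sqrt_le_1; lra.
Qed.

(** The Cauchy-Riemann equations: multiplication by [l] has the real matrix with rows (Re l, - Im l)
    and (Im l, Re l). *)
Lemma is_cderive_differentiable (h : C -> C) (x y : R) (l : C) :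
  is_cderive h (x, y) l ->
  differentiable_pt_lim (fun u v => Re (h (u, v))) x y (Re l) (- Im l) /\
  differentiable_pt_lim (fun u v => Im (h (u, v))) x y (Im l) (Re l).
Proof.
  rewrite is_cderive_iff. intros H.
  assert (K : forall eps : posreal, exists d : posreal, forall u v,
    Rabs (u - x) < d -> Rabs (v - y) < d ->
    Cmod (h (u, v) - h (x, y) - ((u, v) - (x, y)) * l)%C <=
      eps * Rmax (Rabs (u - x)) (Rabs (v - y))).
  { intros eps.
    assert (he : 0 < eps / 2) by (pose proof (cond_pos eps); lra).
    destruct (H (mkposreal _ he)) as [d hd]. cbn [pos] in hd.
    assert (hd' : 0 < d / 2) by (pose proof (cond_pos d); lra).
    exists (mkposreal _ hd'). cbn [pos]. intros u v hu hv.
    pose proof (Cmod_le_sqrt2_Rmax ((u, v) - (x, y))%C) as hm.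
    change (fst ((u, v) - (x, y))%C) with (u - x) in hm.
    change (snd ((u, v) - (x, y))%C) with (v - y) in hm.
    eapply Rle_trans.
    - apply hd. eapply Rle_lt_trans; [exact hm|].
      assert (Rmax (Rabs (u - x)) (Rabs (v - y)) < d / 2) by (apply Rmax_lub_lt; lra). lra.
    - assert (eps / 2 * Cmod ((u, v) - (x, y)) <=
        eps / 2 * (2 * Rmax (Rabs (u - x)) (Rabs (v - y)))) by (apply Rmult_le_compat_l; lra).
      lra. }
  split; intros eps; destruct (K eps) as [d hd]; exists d; intros u v hu hv;
    (eapply Rle_trans; [| apply (hd u v hu hv)]);
    set (X := (h (u, v) - h (x, y) - ((u, v) - (x, y)) * l)%C).
  - replace (Re (h (u, v)) - Re (h (x, y)) - (Re l * (u - x) + - Im l * (v - y)))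
      with (Re X); [apply re_le_Cmod|].
    unfold X. destruct (h (u, v)), (h (x, y)), l. simpl. ring.
  - replace (Im (h (u, v)) - Im (h (x, y)) - (Im l * (u - x) + Re l * (v - y)))
      with (Im X); [eapply Rle_trans; [apply Rmax_r | apply Rmax_Cmod]|].
    unfold X. destruct (h (u, v)), (h (x, y)), l. simpl. ring.
Qed.

(** The radius is e^s, so this is the complex exponential of s + it and the Cauchy-Riemann equations
    keep their form in (s, t). *)
Definition Cpolar (s t : R) : C := (exp s * cos t, exp s * sin t).

Lemma Cmod_Cpolar (s t : R) : Cmod (Cpolar s t) = exp s.
Proof.
  unfold Cmod, Cpolar; simpl.
  replace (exp s * cos t * (exp s * cos t * 1) + exp s * sin t * (exp s * sin t * 1))
    with (Rsqr (exp s) * (Rsqr (sin t) + Rsqr (cos t))) by (unfold Rsqr; ring).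
  rewrite sin2_cos2, Rmult_1_r. apply sqrt_Rsqr. left; apply exp_pos.
Qed.

(** With w = e^(s + it) one has dw/w = ds + i dt, so the form is the imaginary part of h(w) dw/w. It
    is closed because h(e^(s + it)) is holomorphic in s + it. *)
Lemma closed_at_polar (h : C -> C) (s t : R) :
  ex_cderive h (Cpolar s t) ->
  closed_at (fun s t => Im (h (Cpolar s t))) (fun s t => Re (h (Cpolar s t))) s t.
Proof.
  intros [l hl]. destruct (is_cderive_differentiable _ _ _ _ hl) as [dR dI].
  pose proof (differentiable_pt_lim_tensor exp cos s t _ _
    (derivable_pt_lim_exp s) (derivable_pt_lim_cos t)) as d1.
  pose proof (differentiable_pt_lim_tensor exp sin s t _ _
    (derivable_pt_lim_exp s) (derivable_pt_lim_sin t)) as d2.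
  pose proof (differentiable_pt_lim_comp _ _ _ s t _ _ _ _ _ _ dR d1 d2) as DR.
  pose proof (differentiable_pt_lim_comp _ _ _ s t _ _ _ _ _ _ dI d1 d2) as DI.
  eexists _, _, _. split; [exact DI|].
  replace (Im l * (exp s * - sin t) + Re l * (exp s * cos t)) with
    (Re l * (exp s * cos t) + - Im l * (exp s * sin t)) by ring.
  exact DR.
Qed.

Definition circle_integral (h : C -> C) (s : R) : R :=
  RInt (fun t => Re (h (Cpolar s t))) 0 (2 * PI).

(** On the rectangle [s0, s1] x [0, 2 PI] the sides t = 0 and t = 2 PI cancel by periodicity. The
    other two sides are the two circle integrals. *)
Lemma circle_integral_const (h : C -> C) (s0 s1 : R) :
  s0 <= s1 -> (forall s t, s0 <= s <= s1 -> ex_cderive h (Cpolar s t)) ->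
  circle_integral h s0 = circle_integral h s1.
Proof.
  intros hs H. pose proof PI_RGT_0.
  assert (hc : forall x y, s0 <= x <= s1 -> 0 <= y <= 2 * PI ->
    closed_at (fun s t => Im (h (Cpolar s t))) (fun s t => Re (h (Cpolar s t))) x y)
    by (intros; apply closed_at_polar, H; assumption).
  pose proof (circulation_closed _ _ s0 s1 0 (2 * PI) hs ltac:(lra) hc) as E.
  unfold circulation in E.
  rewrite (RInt_ext _ (fun _ => 0)) in E.
  2: { intros x _. change (Im (h (Cpolar x 0)) - Im (h (Cpolar x (2 * PI))) = 0).
       replace (Cpolar x (2 * PI)) with (Cpolar x 0); [ring|].
       unfold Cpolar. rewrite cos_2PI, sin_2PI, cos_0, sin_0. reflexivity. }
  rewrite RInt_const in E. unfold scal in E; simpl in E; unfold mult in E; simpl in E.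
  rewrite (RInt_diff (fun t => Re (h (Cpolar s1 t))) (fun t => Re (h (Cpolar s0 t)))) in E.
  - unfold circle_integral. lra.
  - apply (closed_ex_RInt_y (fun s t => Im (h (Cpolar s t)))
      (fun s t => Re (h (Cpolar s t)))); [lra|]. intros; apply hc; lra.
  - apply (closed_ex_RInt_y (fun s t => Im (h (Cpolar s t)))
      (fun s t => Re (h (Cpolar s t)))); [lra|]. intros; apply hc; lra.
Qed.

Lemma circle_integral_near (h : C -> C) (s c M : R) :
  (forall t, ex_cderive h (Cpolar s t)) ->
  (forall t, Rabs (Re (h (Cpolar s t)) - c) <= M) ->
  Rabs (circle_integral h s - c * (2 * PI)) <= 2 * PI * M.
Proof.
  intros H hM. pose proof PI_RGT_0.
  pose proof (RInt_near_const (fun t => Re (h (Cpolar s t))) 0 (2 * PI) c M ltac:(lra)) as K.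
  rewrite !Rminus_0_r in K. apply K.
  - apply (closed_ex_RInt_y (fun s t => Im (h (Cpolar s t)))
      (fun s t => Re (h (Cpolar s t)))); [lra|].
    intros; apply closed_at_polar, H.
  - intros; apply hM.
Qed.

(* The mean of [Re ((f w - f 0) / w)] over the circle of radius [exp s] does not
   depend on [s] and tends to [Re (f' 0)] as [s -> -oo]. *)
Lemma cauchy_estimate_re (f : C -> C) (l : C) (R0 M : R) :
  0 < R0 -> (forall w, Cmod w < R0 -> ex_cderive f w) ->
  (forall w, Cmod w < R0 -> Cmod (f w) <= M) ->
  is_cderive f (RtoC 0) l -> Rabs (Re l) <= 2 * M / R0.
Proof.
  intros hR hf hM hl.
  pose proof PI_RGT_0 as hpi.
  assert (hM0 : 0 <= M).
  { eapply Rle_trans; [apply Cmod_ge_0 | apply (hM (RtoC 0))]. rewrite Cmod_0; exact hR. }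
  set (h w := ((f w - f (RtoC 0)) / w)%C).
  assert (hh : forall w, 0 < Cmod w < R0 -> ex_cderive h w).
  { intros w [h0 h1]. destruct (hf w h1) as [k hk]. eexists. unfold h, Cdiv.
    apply is_cderive_mult.
    - apply is_cderive_minus; [exact hk | apply is_cderive_const].
    - apply is_cderive_inv. apply Cmod_gt_0; exact h0. }
  assert (hp : forall s t, s < ln R0 -> ex_cderive h (Cpolar s t)).
  { intros s t hs. apply hh. rewrite Cmod_Cpolar. split; [apply exp_pos|].
    rewrite <- (exp_ln R0) by assumption. apply exp_increasing, hs. }
  (* Analyticity and the bound hold only on the open disk, so the estimate is made on radii [r < R0]
     and the radius is enlarged at the end. *)
  assert (key : forall r eps, 0 < r < R0 -> 0 < eps -> Rabs (Re l) <= 2 * M / r + eps).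
  { intros r eps [hr hrR] heps.
    rewrite is_cderive_iff in hl. destruct (hl (mkposreal _ heps)) as [d hd].
    cbn [pos] in hd.
    set (s1 := ln r). assert (hs1 : s1 < ln R0) by (apply ln_increasing; assumption).
    (* A circle so small that the difference quotient [h] is within [eps] of [l] on it. *)
    set (s0 := ln (Rmin (d / 2) r)).
    assert (hmin : 0 < Rmin (d / 2) r)
      by (apply Rmin_glb_lt; [pose proof (cond_pos d); lra | assumption]).
    assert (hs0 : s0 <= s1).
    { unfold s0, s1. destruct (Rle_lt_or_eq_dec _ _ (Rmin_r (d / 2) r)) as [e|e].
      - left; apply ln_increasing; assumption.
      - rewrite e; lra. }
    assert (E : circle_integral h s0 = circle_integral h s1).
    { apply circle_integral_const; [exact hs0|]. intros s t hs. apply hp. lra. }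
    (* The factor 2 of the estimate arises here, from |f w - f 0| <= 2 M. *)
    assert (B1 : Rabs (circle_integral h s1 - 0 * (2 * PI)) <= 2 * PI * (2 * M / r)).
    { apply circle_integral_near; [intros; apply hp; exact hs1|].
      intros t. rewrite Rminus_0_r.
      eapply Rle_trans; [apply re_le_Cmod|]. unfold h.
      assert (hc : Cmod (Cpolar s1 t) = r)
        by (rewrite Cmod_Cpolar; unfold s1; apply exp_ln; assumption).
      rewrite Cmod_div by (apply Cmod_gt_0; lra). rewrite hc.
      apply Rmult_le_compat_r; [left; apply Rinv_0_lt_compat; assumption|].
      eapply Rle_trans; [apply Cmod_triangle_sub|].
      pose proof (hM (Cpolar s1 t) ltac:(lra)).
      pose proof (hM (RtoC 0) ltac:(rewrite Cmod_0; lra)). lra. }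
    assert (B0 : Rabs (circle_integral h s0 - Re l * (2 * PI)) <= 2 * PI * eps).
    { apply circle_integral_near; [intros; apply hp; lra|].
      intros t.
      assert (hc : Cmod (Cpolar s0 t) = Rmin (d / 2) r)
        by (rewrite Cmod_Cpolar; unfold s0; apply exp_ln; assumption).
      set (w := Cpolar s0 t) in *.
      assert (hw : w <> RtoC 0) by (apply Cmod_gt_0; lra).
      replace (Re (h w) - Re l) with (Re (h w - l)%C)
        by (unfold Re, Cminus, Cplus, Copp; simpl; ring).
      eapply Rle_trans; [apply re_le_Cmod|].
      replace (h w - l)%C with ((f w - f (RtoC 0) - (w - RtoC 0) * l) / w)%C
        by (unfold h; field; exact hw).
      rewrite Cmod_div by exact hw.
      assert (hwd : Cmod (w - RtoC 0) < d).
      { replace (w - RtoC 0)%C with w by ring. rewrite hc.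
        pose proof (Rmin_l (d / 2) r). pose proof (cond_pos d). lra. }
      specialize (hd w hwd). replace (Cmod (w - RtoC 0)) with (Cmod w) in hd by (f_equal; ring).
      assert (hw0 : 0 < Cmod w) by lra.
      apply (Rmult_le_reg_r (Cmod w)); [exact hw0|].
      unfold Rdiv. rewrite Rmult_assoc, Rinv_l by lra. lra. }
    rewrite E in B0.
    apply Rabs_le_between in B0. apply Rabs_le_between in B1. apply Rabs_le_between.
    split; apply (Rmult_le_reg_r (2 * PI)); lra. }
  apply le_epsilon. intros eps heps.
  assert (hq : 0 <= 2 * M / R0) by (apply Rdiv_le_0_compat; lra).
  destruct (Req_dec M 0) as [e|e].
  { pose proof (key (R0 / 2) eps ltac:(lra) heps). subst M.
    unfold Rdiv in *. rewrite Rmult_0_r, Rmult_0_l in *. lra. }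
  (* the radius for which [2 * M / r] equals [2 * M / R0 + eps / 2] *)
  set (r := 2 * M / (2 * M / R0 + eps / 2)).
  assert (hr : 0 < r < R0).
  { unfold r. split.
    - apply Rdiv_lt_0_compat; lra.
    - apply (Rmult_lt_reg_r (2 * M / R0 + eps / 2)); [lra|].
      unfold Rdiv at 1. rewrite Rmult_assoc, Rinv_l by lra.
      replace (R0 * (2 * M / R0 + eps / 2)) with (2 * M + R0 * eps / 2) by (field; lra).
      nra. }
  pose proof (key r (eps / 2) hr ltac:(lra)) as K.
  replace (2 * M / r) with (2 * M / R0 + eps / 2) in K.
  - lra.
  - unfold r. field. repeat split; try lra.
    assert (0 < 2 * M / R0 + eps / 2) by lra.
    apply (Rmult_lt_compat_r (2 * R0)) in H; [|lra].
    replace ((2 * M / R0 + eps / 2) * (2 * R0)) with (4 * M + eps * R0) in H by (field; lra).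
    lra.
Qed.

Theorem cauchy_estimate (f : C -> C) (c : C) (R0 M : R) :
  0 < R0 -> (forall w, Cmod (w - c) < R0 -> ex_cderive f w) ->
  (forall w, Cmod (w - c) < R0 -> Cmod (f w) <= M) ->
  Cmod (C_derive f c) <= 2 * M / R0.
Proof.
  intros hR hf hM.
  assert (hcc : Cmod (c - c) < R0) by (replace (c - c)%C with (RtoC 0) by ring; rewrite Cmod_0; exact hR).
  set (l := C_derive f c).
  assert (hl : is_cderive f c l) by (apply C_derive_spec, hf, hcc).
  assert (hM0 : 0 <= M) by (eapply Rle_trans; [apply Cmod_ge_0 | apply (hM c hcc)]).
  destruct (Req_dec (Cmod l) 0) as [e|e].
  { rewrite e. apply Rdiv_le_0_compat; lra. }
  assert (hl0 : 0 < Cmod l) by (pose proof (Cmod_ge_0 l); lra).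
  (* rotate so that the derivative becomes real and nonnegative *)
  set (g w := (Cconj l * f (w + c))%C).
  assert (hg : forall w k, is_cderive f (w + c)%C k -> is_cderive g w (Cconj l * k)%C).
  { intros w k hk. unfold g. eapply is_cderive_eq.
    - apply is_cderive_mult; [apply is_cderive_const|].
      apply (is_cderive_comp f (fun w => (w + c)%C)); [exact hk|].
      apply is_cderive_plus; [apply is_cderive_id | apply is_cderive_const].
    - cbv beta. ring. }
  pose proof (cauchy_estimate_re g (Cconj l * l)%C R0 (Cmod l * M) hR) as K.
  assert (sh : forall w, Cmod w < R0 -> Cmod (w + c - c) < R0).
  { intros w hw. replace (w + c - c)%C with w by ring. exact hw. }
  assert (K' : Rabs (Re (Cconj l * l)%C) <= 2 * (Cmod l * M) / R0).
  { apply K.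
    - intros w hw. destruct (hf (w + c)%C (sh w hw)) as [k hk]. eexists; apply hg, hk.
    - intros w hw. unfold g. rewrite Cmod_mult, Cmod_conj.
      apply Rmult_le_compat_l; [lra | apply hM, sh, hw].
    - apply hg. replace (RtoC 0 + c)%C with c by ring. exact hl. }
  rewrite Cmult_comm, <- Cmod2_conj in K'.
  change (Re (RtoC (Cmod l ^ 2))) with (Cmod l ^ 2) in K'.
  rewrite Rabs_pos_eq in K' by (apply pow_le; lra).
  apply (Rmult_le_reg_l (Cmod l)); [exact hl0|].
  replace (Cmod l * (2 * M / R0)) with (2 * (Cmod l * M) / R0) by (field; lra).
  simpl in K'. lra.
Qed.

(** * Lipschitz bounds for a function and its derivative on a smaller ball *)

Lemma segment_in_ball (a b c : C) (r t : R) :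
  Cmod (a - c) <= r -> Cmod (b - c) <= r -> 0 <= t <= 1 ->
  Cmod (a + RtoC t * (b - a) - c) <= r.
Proof.
  intros ha hb ht.
  replace (a + RtoC t * (b - a) - c)%C with (RtoC (1 - t) * (a - c) + RtoC t * (b - c))%C
    by (rewrite RtoC_minus; ring).
  eapply Rle_trans; [apply Cmod_triangle|]. rewrite !Cmod_mult, !Cmod_R.
  rewrite !Rabs_pos_eq by lra. nra.
Qed.

Section BoundedOnBall.

Variables (f : C -> C) (c : C) (s M : R).
Hypothesis hf : forall w, Cmod (w - c) < s -> ex_cderive f w.
Hypothesis hM : forall w, Cmod (w - c) < s -> Cmod (f w) <= M.

Lemma ball_derive_bound (r : R) (a : C) : r < s -> Cmod (a - c) <= r ->
  Cmod (C_derive f a) <= 2 * M / (s - r).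
Proof.
  intros hr ha. apply cauchy_estimate; [lra | |];
    intros w hw; [apply hf | apply hM];
    replace (w - c)%C with ((w - a) + (a - c))%C by ring;
    (eapply Rle_lt_trans; [apply Cmod_triangle|]); lra.
Qed.

Lemma ball_lipschitz (r : R) (a b : C) : r < s -> Cmod (a - c) <= r -> Cmod (b - c) <= r ->
  Cmod (f a - f b) <= 2 * M / (s - r) * Cmod (a - b).
Proof.
  intros hr ha hb. apply Cmod_mean_value. intros t ht.
  assert (h : Cmod (b + RtoC t * (a - b) - c) <= r) by (apply segment_in_ball; assumption).
  eexists. split.
  - apply C_derive_spec, hf. lra.
  - apply ball_derive_bound; assumption.
Qed.

(** Cauchy's estimate is applied to w -> f(w + a) - f(w + b) on the ball of radius (s - r)/2, where
    [ball_lipschitz] with radius (s + r)/2 bounds this difference by a multiple of |a - b|. This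
    bypasses second derivatives, and the two estimates multiply to the constant 16. *)
Lemma ball_derive_lipschitz (r : R) (a b : C) :
  r < s -> Cmod (a - c) <= r -> Cmod (b - c) <= r ->
  Cmod (C_derive f a - C_derive f b) <= 16 * M / (s - r) ^ 2 * Cmod (a - b).
Proof.
  intros hr ha hb.
  set (h w := (f (w + a) - f (w + b))%C).
  assert (sh : forall w e, Cmod (w - RtoC 0) < (s - r) / 2 -> Cmod (e - c) <= r ->
    Cmod (w + e - c) <= (s + r) / 2).
  { intros w e hw he. replace (w + e - c)%C with ((w - RtoC 0) + (e - c))%C by ring.
    eapply Rle_trans; [apply Cmod_triangle|]. lra. }
  assert (hd : forall w, Cmod (w - RtoC 0) < (s - r) / 2 ->
    is_cderive h w (C_derive f (w + a) - C_derive f (w + b))%C).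
  { intros w hw. unfold h.
    apply is_cderive_minus; eapply is_cderive_eq.
    - apply (is_cderive_comp f (fun w => (w + a)%C)).
      + apply C_derive_spec, hf. pose proof (sh w a hw ha). lra.
      + apply is_cderive_plus; [apply is_cderive_id | apply is_cderive_const].
    - cbv beta. ring.
    - apply (is_cderive_comp f (fun w => (w + b)%C)).
      + apply C_derive_spec, hf. pose proof (sh w b hw hb). lra.
      + apply is_cderive_plus; [apply is_cderive_id | apply is_cderive_const].
    - cbv beta. ring. }
  pose proof (cauchy_estimate h (RtoC 0) ((s - r) / 2)
    (2 * M / (s - (s + r) / 2) * Cmod (a - b)) ltac:(lra)) as K.
  replace (C_derive f a - C_derive f b)%C with (C_derive h (RtoC 0)).
  - replace (16 * M / (s - r) ^ 2 * Cmod (a - b)) with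
      (2 * (2 * M / (s - (s + r) / 2) * Cmod (a - b)) / ((s - r) / 2)) by (field; lra).
    apply K.
    + intros w hw. eexists. apply hd, hw.
    + intros w hw. unfold h.
      replace (a - b)%C with ((w + a) - (w + b))%C by ring.
      apply ball_lipschitz; [lra | |]; apply sh; assumption.
  - apply is_C_derive_unique. eapply is_cderive_eq.
    + apply hd. replace (RtoC 0 - RtoC 0)%C with (RtoC 0) by ring. rewrite Cmod_0. lra.
    + f_equal; [|f_equal]; f_equal; ring.
Qed.

End BoundedOnBall.

(** * The functional [f |-> (1 - |z|^2) (T f)'(z)] *)

Definition hder (f : C -> C) (w : C) : C := (RtoC (1 - Cmod w ^ 2) * C_derive f w)%C.

(* At a fixed [z], with [a = phi z] and [b = psi z], the quantity
   [(1 - |z|^2) (T f)'(z)] has this form, where [A], [B] carry [u'], [v'] and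
   [D], [E] carry [u phi'], [v psi']. *)
Definition jet (a b A B D E : C) (f : C -> C) : C :=
  (A * f a - B * f b + D * hder f a - E * hder f b)%C.

Lemma Cmod_lt_1_sqr (a : C) : disk a -> 0 < 1 - Cmod a ^ 2.
Proof. unfold disk. pose proof (Cmod_ge_0 a). intros. nra. Qed.

Lemma hder_eq (f : C -> C) (w l : C) :
  is_cderive f w l -> hder f w = (RtoC (1 - Cmod w ^ 2) * l)%C.
Proof. intros H. unfold hder. rewrite (is_C_derive_unique _ _ _ H). reflexivity. Qed.

Lemma hder_mult (f g : C -> C) (w : C) : ex_cderive f w -> ex_cderive g w ->
  hder (fun z => f z * g z)%C w = (hder f w * g w + f w * hder g w)%C.
Proof.
  intros hf hg. erewrite hder_eq by (apply is_cderive_mult; apply C_derive_spec; assumption).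
  unfold hder. ring.
Qed.

Lemma is_cderive_pow (f : C -> C) (n : nat) (w l : C) : is_cderive f w l ->
  is_cderive (fun z => Cpow (f z) n) w (RtoC (INR n) * Cpow (f w) (pred n) * l)%C.
Proof.
  intros H. induction n as [|n IH].
  - simpl. eapply is_cderive_eq; [apply is_cderive_const | ring].
  - eapply is_cderive_eq; [exact (is_cderive_mult _ _ _ _ _ H IH)|].
    cbv beta. rewrite S_INR, RtoC_plus. destruct n as [|n]; simpl; ring.
Qed.

Lemma hder_pow (f : C -> C) (n : nat) (w : C) : ex_cderive f w ->
  hder (fun z => Cpow (f z) n) w = (RtoC (INR n) * Cpow (f w) (pred n) * hder f w)%C.
Proof.
  intros H. erewrite hder_eq by (apply is_cderive_pow, C_derive_spec, H).
  unfold hder. ring.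
Qed.

Lemma ex_cderive_mult (f g : C -> C) (w : C) : ex_cderive f w -> ex_cderive g w ->
  ex_cderive (fun z => f z * g z)%C w.
Proof. intros [l hl] [k hk]. eexists. apply is_cderive_mult; eassumption. Qed.

Lemma ex_cderive_minus (f g : C -> C) (w : C) : ex_cderive f w -> ex_cderive g w ->
  ex_cderive (fun z => f z - g z)%C w.
Proof. intros [l hl] [k hk]. eexists. apply is_cderive_minus; eassumption. Qed.

Lemma ex_cderive_pow (f : C -> C) (n : nat) (w : C) : ex_cderive f w ->
  ex_cderive (fun z => Cpow (f z) n) w.
Proof. intros [l hl]. eexists. apply is_cderive_pow; eassumption. Qed.

Lemma jet_lin (a b A B D E c : C) (f g : C -> C) :
  ex_cderive f a -> ex_cderive f b -> ex_cderive g a -> ex_cderive g b ->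
  jet a b A B D E (fun z => f z - c * g z)%C =
  (jet a b A B D E f - c * jet a b A B D E g)%C.
Proof.
  intros fa fb ga gb. unfold jet.
  assert (H : forall w, ex_cderive f w -> ex_cderive g w ->
    hder (fun z => f z - c * g z)%C w = (hder f w - c * hder g w)%C).
  { intros w hf hg. erewrite hder_eq.
    2: { apply is_cderive_minus; [apply C_derive_spec, hf|].
         apply is_cderive_mult; [apply is_cderive_const | apply C_derive_spec, hg]. }
    unfold hder. ring. }
  rewrite !H by assumption. ring.
Qed.

(** This symmetry carries every estimate on A, D at a over to B, E at b. *)
Lemma jet_swap (a b A B D E : C) (f : C -> C) :
  jet a b A B D E f = (- jet b a B A E D f)%C.
Proof. unfold jet. ring. Qed.

(** For points close to each other: only A - B and D - E occur at full size, while B and E carry the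
    factor [r], to be taken as rho a b. For points far apart [jet_bound_crude] is used, which
    exploits no cancellation but lets f have different sizes at a and b. *)
Lemma jet_bound (a b A B D E : C) (f : C -> C) (k r : R) :
  Cmod (f a) <= k -> Cmod (hder f a) <= k ->
  Cmod (f a - f b) <= k * r -> Cmod (hder f a - hder f b) <= k * r ->
  Cmod (jet a b A B D E f) <=
    k * (Cmod (A - B) + r * Cmod B + Cmod (D - E) + r * Cmod E).
Proof.
  intros h1 h2 h3 h4.
  replace (jet a b A B D E f) with ((A - B) * f a + B * (f a - f b) +
    ((D - E) * hder f a + E * (hder f a - hder f b)))%C by (unfold jet; ring).
  eapply Rle_trans; [apply Cmod_triangle|].
  eapply Rle_trans; [apply Rplus_le_compat; apply Cmod_triangle|].
  rewrite !Cmod_mult.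
  pose proof (Cmod_ge_0 (A - B)). pose proof (Cmod_ge_0 (D - E)).
  pose proof (Cmod_ge_0 B). pose proof (Cmod_ge_0 E). nra.
Qed.

Lemma jet_bound_crude (a b A B D E : C) (f : C -> C) (k k' : R) :
  Cmod (f a) <= k -> Cmod (hder f a) <= k -> Cmod (f b) <= k' -> Cmod (hder f b) <= k' ->
  Cmod (jet a b A B D E f) <= k * (Cmod A + Cmod D) + k' * (Cmod B + Cmod E).
Proof.
  intros h1 h2 h3 h4.
  replace (jet a b A B D E f) with ((A * f a - B * f b) + (D * hder f a - E * hder f b))%C
    by (unfold jet; ring).
  eapply Rle_trans; [apply Cmod_triangle|].
  eapply Rle_trans; [apply Rplus_le_compat; apply Cmod_triangle_sub|].
  rewrite !Cmod_mult.
  pose proof (Cmod_ge_0 A). pose proof (Cmod_ge_0 D).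
  pose proof (Cmod_ge_0 B). pose proof (Cmod_ge_0 E). nra.
Qed.

(** * Pseudo-hyperbolic geometry *)

Lemma Cmod_conj_prod (b z : C) : Cmod (Cconj b * z) = Cmod b * Cmod z.
Proof. rewrite Cmod_mult, Cmod_conj. reflexivity. Qed.

Lemma mobius_denom_ge (b z : C) : 1 - Cmod b * Cmod z <= Cmod (1 - Cconj b * z).
Proof.
  rewrite <- Cmod_conj_prod. rewrite <- Cmod_1 at 1. apply Cmod_triangle_rev.
Qed.

Lemma mobius_denom_pos (b z : C) : disk b -> disk z -> 0 < Cmod (1 - Cconj b * z).
Proof.
  unfold disk. intros hb hz. pose proof (mobius_denom_ge b z).
  pose proof (Cmod_ge_0 b). pose proof (Cmod_ge_0 z). nra.
Qed.

Lemma mobius_denom_neq (b z : C) : disk b -> disk z -> (1 - Cconj b * z)%C <> RtoC 0.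
Proof. intros hb hz. apply Cmod_gt_0, mobius_denom_pos; assumption. Qed.

Lemma mobius_denom_sym (a b : C) : Cmod (1 - Cconj b * a) = Cmod (1 - Cconj a * b).
Proof.
  rewrite <- Cmod_conj. f_equal.
  rewrite Cminus_conj, Cmult_conj, Cconj_conj.
  replace (Cconj 1) with (RtoC 1); [ring|].
  unfold Cconj, RtoC; simpl. f_equal; ring.
Qed.

Lemma Cmod_sqr_expand (z : C) : RtoC (Cmod z ^ 2) = (z * Cconj z)%C.
Proof. apply Cmod2_conj. Qed.

Lemma Cconj_1 : Cconj 1 = RtoC 1.
Proof. unfold Cconj, RtoC; simpl. f_equal; ring. Qed.

Lemma mobius_denom_identity (a b : C) :
  RtoC ((1 - Cmod a ^ 2) * (1 - Cmod b ^ 2)) =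
  ((1 - Cconj b * a) * Cconj (1 - Cconj b * a) - (a - b) * Cconj (a - b))%C.
Proof.
  rewrite RtoC_mult, !RtoC_minus, !Cmod_sqr_expand.
  rewrite !Cminus_conj, Cmult_conj, Cconj_conj, Cconj_1. ring.
Qed.

Lemma rho_denom (a b : C) : disk a -> disk b ->
  Cmod (a - b) = rho a b * Cmod (1 - Cconj b * a).
Proof.
  intros ha hb. unfold rho.
  rewrite Cmod_div by (apply mobius_denom_neq; assumption).
  pose proof (mobius_denom_pos b a hb ha). field. lra.
Qed.

Lemma rho_nonneg (a b : C) : 0 <= rho a b.
Proof. apply Cmod_ge_0. Qed.

Lemma rho_identity (a b : C) : disk a -> disk b ->
  (1 - Cmod a ^ 2) * (1 - Cmod b ^ 2) = (1 - rho a b ^ 2) * Cmod (1 - Cconj b * a) ^ 2.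
Proof.
  intros ha hb. apply RtoC_inj. rewrite mobius_denom_identity, <- !Cmod2_conj.
  rewrite <- RtoC_minus. f_equal. rewrite (rho_denom a b) by assumption. ring.
Qed.

Lemma rho_lt_1 (a b : C) : disk a -> disk b -> rho a b < 1.
Proof.
  intros ha hb. pose proof (rho_identity a b ha hb) as E.
  pose proof (Cmod_lt_1_sqr a ha). pose proof (Cmod_lt_1_sqr b hb).
  pose proof (mobius_denom_pos b a hb ha). pose proof (rho_nonneg a b).
  assert (0 < (1 - Cmod a ^ 2) * (1 - Cmod b ^ 2)) by (apply Rmult_lt_0_compat; assumption).
  assert (0 < Cmod (1 - Cconj b * a) ^ 2) by (apply pow_lt; assumption).
  destruct (Rlt_or_le (rho a b) 1) as [h|h]; [exact h|].
  assert (1 - rho a b ^ 2 <= 0) by nra. nra.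
Qed.

Lemma rho_sym (a b : C) : disk a -> disk b -> rho a b = rho b a.
Proof.
  intros ha hb. unfold rho.
  rewrite !Cmod_div by (apply mobius_denom_neq; assumption).
  rewrite (mobius_denom_sym a b). f_equal. apply Cmod_sub_sym.
Qed.

Lemma dist_le_rho (a b : C) : disk a -> disk b -> Cmod (a - b) <= 2 * rho a b.
Proof.
  intros ha hb. rewrite (rho_denom a b ha hb).
  assert (Cmod (1 - Cconj b * a) <= 2).
  { eapply Rle_trans; [apply Cmod_triangle_sub|]. rewrite Cmod_1, Cmod_conj_prod.
    unfold disk in *. pose proof (Cmod_ge_0 a). pose proof (Cmod_ge_0 b). nra. }
  pose proof (rho_nonneg a b). nra.
Qed.

(** Since |a - b| = rho |1 - conj b a| is at most half of |1 - conj b a|, and |1 - conj b a| <= (1 -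
    |a|^2) + |a - b|, the denominator is at most 2 (1 - |a|^2) <= 4 (1 - |a|). *)
Lemma dist_le_rho_local (a b : C) : disk a -> disk b -> rho a b <= / 2 ->
  Cmod (a - b) <= 4 * rho a b * (1 - Cmod a).
Proof.
  intros ha hb hr.
  assert (H : Cmod (1 - Cconj b * a) <= (1 - Cmod a ^ 2) + Cmod (a - b)).
  { replace (1 - Cconj b * a)%C with (RtoC (1 - Cmod a ^ 2) + Cconj (a - b) * a)%C.
    - eapply Rle_trans; [apply Cmod_triangle|].
      rewrite Cmod_R, Cmod_conj_prod, Rabs_pos_eq by (left; apply Cmod_lt_1_sqr, ha).
      pose proof (Cmod_ge_0 (a - b)). unfold disk in ha. nra.
    - rewrite RtoC_minus, Cmod_sqr_expand, Cminus_conj. ring. }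
  rewrite (rho_denom a b ha hb) in *.
  pose proof (rho_nonneg a b). pose proof (Cmod_ge_0 a). unfold disk in ha.
  pose proof (Cmod_ge_0 (1 - Cconj b * a)).
  assert (Cmod (1 - Cconj b * a) <= 4 * (1 - Cmod a)) by nra. nra.
Qed.

(** A point within rho 1/2 of an inner point is itself away from the circle. By [rho_identity], (1 -
    |a|^2)(1 - |b|^2) >= 3/4 (1 - |b|)^2, whence 1 - |a| >= 3/16 (1 - |b|). *)
Lemma rho_half_boundary (a b : C) (r : R) : disk a -> disk b -> rho a b <= / 2 ->
  Cmod b <= r -> r < 1 -> Cmod a <= 1 - (1 - r) / 8.
Proof.
  intros ha hb hr hbr hr1.
  pose proof (rho_identity a b ha hb) as E.
  pose proof (mobius_denom_ge b a) as G.
  pose proof (Cmod_ge_0 a). pose proof (Cmod_ge_0 b). pose proof (rho_nonneg a b).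
  unfold disk in *.
  assert (G' : 1 - Cmod b <= Cmod (1 - Cconj b * a)) by nra.
  assert (G2 : (1 - Cmod b) * (1 - Cmod b) <= Cmod (1 - Cconj b * a) ^ 2) by nra.
  assert (K : 3 / 4 * ((1 - Cmod b) * (1 - Cmod b)) <= (1 - Cmod a ^ 2) * (1 - Cmod b ^ 2)).
  { rewrite E. apply Rmult_le_compat; nra. }
  assert (K2 : 3 / 4 * (1 - Cmod b) <= (1 - Cmod a ^ 2) * (1 + Cmod b)) by nra.
  assert (0 < 1 - Cmod a) by lra.
  assert ((1 - Cmod a ^ 2) * (1 + Cmod b) <= 4 * (1 - Cmod a)).
  { replace ((1 - Cmod a ^ 2) * (1 + Cmod b)) with
      ((1 - Cmod a) * ((1 + Cmod a) * (1 + Cmod b))) by ring.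
    rewrite Rmult_comm. apply Rmult_le_compat_r; nra. }
  lra.
Qed.

Lemma Cmod_sigma (a z : C) : disk a -> disk z -> Cmod (sigma a z) = rho z a.
Proof.
  intros ha hz. unfold sigma, rho.
  rewrite !Cmod_div by (apply mobius_denom_neq; assumption).
  f_equal. apply Cmod_sub_sym.
Qed.

Lemma sigma_self (a : C) : sigma a a = RtoC 0.
Proof. unfold sigma, Cdiv. ring. Qed.

Lemma is_cderive_sigma (a z : C) : disk a -> disk z ->
  is_cderive (sigma a) z (- RtoC (1 - Cmod a ^ 2) / ((1 - Cconj a * z) * (1 - Cconj a * z)))%C.
Proof.
  intros ha hz. pose proof (mobius_denom_neq a z ha hz) as h0.
  assert (hden : is_cderive (fun w => 1 - Cconj a * w)%C z (- Cconj a)%C).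
  { eapply is_cderive_eq.
    - apply is_cderive_minus; [apply is_cderive_const|].
      apply is_cderive_mult; [apply is_cderive_const | apply is_cderive_id].
    - cbv beta. ring. }
  eapply is_cderive_eq.
  - unfold sigma, Cdiv. apply is_cderive_mult.
    + apply is_cderive_minus; [apply is_cderive_const | apply is_cderive_id].
    + apply (is_cderive_comp Cinv (fun w => 1 - Cconj a * w)%C);
        [apply is_cderive_inv, h0 | exact hden].
  - cbv beta. rewrite RtoC_minus, Cmod_sqr_expand. field. exact h0.
Qed.

Lemma ex_cderive_sigma (a z : C) : disk a -> disk z -> ex_cderive (sigma a) z.
Proof. intros. eexists. apply is_cderive_sigma; assumption. Qed.

Lemma hder_sigma (a z : C) : disk a -> disk z ->
  hder (sigma a) z = (- RtoC ((1 - Cmod a ^ 2) * (1 - Cmod z ^ 2)) /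
    ((1 - Cconj a * z) * (1 - Cconj a * z)))%C.
Proof.
  intros ha hz. rewrite (hder_eq _ _ _ (is_cderive_sigma a z ha hz)).
  rewrite RtoC_mult. field. apply mobius_denom_neq; assumption.
Qed.

Lemma hder_sigma_self (a : C) : disk a -> hder (sigma a) a = Copp (RtoC 1).
Proof.
  intros ha. rewrite hder_sigma by assumption.
  assert (E : RtoC (1 - Cmod a ^ 2) = (1 - Cconj a * a)%C)
    by (rewrite RtoC_minus, Cmod_sqr_expand; ring).
  rewrite RtoC_mult, E. field. apply mobius_denom_neq; assumption.
Qed.

Lemma Cmod_hder_sigma (a z : C) : disk a -> disk z ->
  Cmod (hder (sigma a) z) = 1 - rho z a ^ 2.
Proof.
  intros ha hz. rewrite hder_sigma by assumption.
  pose proof (mobius_denom_pos a z ha hz) as hp.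
  pose proof (mobius_denom_neq a z ha hz) as hn.
  rewrite Cmod_div by (apply Cmult_neq_0; assumption).
  rewrite Cmod_opp, Cmod_R, Cmod_mult, Rmult_comm.
  rewrite (rho_identity z a hz ha).
  rewrite Rabs_pos_eq.
  - field. lra.
  - apply Rmult_le_pos; [|apply pow_le; lra].
    pose proof (rho_lt_1 z a hz ha). pose proof (rho_nonneg z a). nra.
Qed.

(** At z = a the value is -1. With w = 1 - conj a z the deviation is (w (w - conj w) + |z - a|^2) /
    w^2, where |w - conj w| <= 2 |z - a| and |z - a| = rho |w|; so it is at most 2 rho + rho^2. *)
Lemma hder_sigma_near (a z : C) : disk a -> disk z ->
  Cmod (hder (sigma a) z + 1) <= 3 * rho z a.
Proof.
  intros ha hz. rewrite hder_sigma by assumption.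
  pose proof (mobius_denom_pos a z ha hz) as hp.
  pose proof (mobius_denom_neq a z ha hz) as hn.
  rewrite (Rmult_comm (1 - Cmod a ^ 2)), mobius_denom_identity.
  pose proof (rho_denom z a hz ha) as hd.
  set (w := (1 - Cconj a * z)%C) in *.
  replace (- (w * Cconj w - (z - a) * Cconj (z - a)) / (w * w) + 1)%C with
    ((w * (w - Cconj w) + (z - a) * Cconj (z - a)) / (w * w))%C by (field; exact hn).
  rewrite Cmod_div by (apply Cmult_neq_0; assumption).
  rewrite Cmod_mult.
  apply (Rmult_le_reg_r (Cmod w * Cmod w)); [nra|].
  unfold Rdiv. rewrite Rmult_assoc, Rinv_l by nra.
  eapply Rle_trans; [rewrite Rmult_1_r; apply Cmod_triangle|].
  rewrite !Cmod_mult, Cmod_conj.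
  assert (Hw : Cmod (w - Cconj w) <= 2 * Cmod (z - a)).
  { replace (w - Cconj w)%C with (a * Cconj (z - a) - Cconj a * (z - a))%C.
    - eapply Rle_trans; [apply Cmod_triangle_sub|].
      rewrite !Cmod_mult, !Cmod_conj. pose proof (Cmod_ge_0 (z - a)). unfold disk in ha. nra.
    - unfold w. rewrite !Cminus_conj, Cmult_conj, Cconj_conj, Cconj_1. ring. }
  rewrite hd in Hw |- *.
  pose proof (rho_nonneg z a) as h0. pose proof (rho_lt_1 z a hz ha) as h1.
  assert (Cmod w * Cmod (w - Cconj w) <= Cmod w * (2 * (rho z a * Cmod w)))
    by (apply Rmult_le_compat_l; lra).
  assert (rho z a * rho z a * (Cmod w * Cmod w) <= rho z a * (Cmod w * Cmod w))
    by (apply Rmult_le_compat_r; nra).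
  lra.
Qed.

(** * Values of the functional on the test functions *)

(** The test functions are combinations of two of these. Unlike the test functions these lie in the
    unit ball, so the boundedness of the operator also applies to them directly. *)
Definition mono (i j : nat) (a b z : C) : C :=
  (Cpow (sigma a z) i * Cpow (sigma b z) j)%C.

Lemma test_fun_mono (n m : nat) (a b : C) :
  test_fun n m a b = (fun z => mono (n + 1) m a b z - a * mono n m a b z)%C.
Proof.
  apply FunctionalExtensionality.functional_extensionality. intros z.
  unfold test_fun, mono. ring.
Qed.

Lemma ex_cderive_mono (i j : nat) (a b z : C) : disk a -> disk b -> disk z ->
  ex_cderive (mono i j a b) z.
Proof.
  intros. apply ex_cderive_mult; apply ex_cderive_pow, ex_cderive_sigma; assumption.
Qed.

Lemma hder_mono (i j : nat) (a b z : C) : disk a -> disk b -> disk z ->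
  hder (mono i j a b) z =
  (RtoC (INR i) * Cpow (sigma a z) (pred i) * hder (sigma a) z * Cpow (sigma b z) j +
   Cpow (sigma a z) i * (RtoC (INR j) * Cpow (sigma b z) (pred j) * hder (sigma b) z))%C.
Proof.
  intros. unfold mono.
  rewrite (hder_mult (fun z => Cpow (sigma a z) i) (fun z => Cpow (sigma b z) j))
    by (apply ex_cderive_pow, ex_cderive_sigma; assumption).
  rewrite !hder_pow by (apply ex_cderive_sigma; assumption). reflexivity.
Qed.

Lemma jet_mono (i j : nat) (a b A B D E : C) : disk a -> disk b ->
  jet a b A B D E (mono i j a b) =
  (A * (Cpow 0 i * Cpow (sigma b a) j) - B * (Cpow (sigma a b) i * Cpow 0 j) +
   D * (RtoC (INR i) * Cpow 0 (pred i) * - (1) * Cpow (sigma b a) j +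
        Cpow 0 i * (RtoC (INR j) * Cpow (sigma b a) (pred j) * hder (sigma b) a)) -
   E * (RtoC (INR i) * Cpow (sigma a b) (pred i) * hder (sigma a) b * Cpow 0 j +
        Cpow (sigma a b) i * (RtoC (INR j) * Cpow 0 (pred j) * - (1))))%C.
Proof.
  intros ha hb. unfold jet. rewrite !hder_mono by assumption.
  rewrite !hder_sigma_self by assumption. unfold mono. rewrite !sigma_self. reflexivity.
Qed.

Lemma jet_test (n m : nat) (a b A B D E : C) : disk a -> disk b ->
  jet a b A B D E (test_fun n m a b) =
  (jet a b A B D E (mono (n + 1) m a b) - a * jet a b A B D E (mono n m a b))%C.
Proof.
  intros ha hb. rewrite test_fun_mono. apply jet_lin; apply ex_cderive_mono; assumption.
Qed.

Ltac solve_jet := rewrite ?jet_test, !jet_mono by assumption; simpl; rewrite ?RtoC_plus; ring.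

Section TestValues.

Variables a b A B D E : C.
Hypothesis ha : disk a.
Hypothesis hb : disk b.
Let s := sigma a b.
Let s' := sigma b a.
Let h := hder (sigma a) b.
Let h' := hder (sigma b) a.

Lemma jet_test00 : jet a b A B D E (test_fun 0 0 a b) =
  (- a * (A - B) - (D - E) - E * (h + 1) - B * s)%C.
Proof. unfold h, s. solve_jet. Qed.

Lemma jet_test01 : jet a b A B D E (test_fun 0 1 a b) =
  (- D * s' + E * s - a * (A * s' + (D * h' + E)))%C.
Proof. unfold h', s, s'. solve_jet. Qed.

(** The factor sigma_b^2 has a double zero at b, so B and E drop out. *)
Lemma jet_test02 : jet a b A B D E (test_fun 0 2 a b) =
  (- D * (s' * s') - a * A * (s' * s') - RtoC 2 * a * s' * h' * D)%C.
Proof. unfold h', s'. solve_jet. Qed.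

(** The part sigma_a^2 sigma_b^2 has double zeros at a and at b; the part a sigma_a sigma_b^2 has a
    simple zero at a, which leaves D alone. *)
Lemma jet_test12 : jet a b A B D E (test_fun 1 2 a b) = (a * D * (s' * s'))%C.
Proof. unfold s'. solve_jet. Qed.

Lemma jet_mono00 : jet a b A B D E (mono 0 0 a b) = (A - B)%C.
Proof. solve_jet. Qed.

Lemma jet_mono01 : jet a b A B D E (mono 0 1 a b) = (A * s' + (D * h' + E))%C.
Proof. unfold h', s'. solve_jet. Qed.

Lemma jet_mono02 : jet a b A B D E (mono 0 2 a b) =
  (A * (s' * s') + RtoC 2 * s' * h' * D)%C.
Proof. unfold h', s'. solve_jet. Qed.

Lemma jet_mono12 : jet a b A B D E (mono 1 2 a b) = (- D * (s' * s'))%C.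
Proof. unfold s'. solve_jet. Qed.

(** With [jet_mono21], the mirror image of [jet_mono02] and [jet_mono12]: the double zero is now at
    a, and only B and E remain. *)
Lemma jet_mono20 : jet a b A B D E (mono 2 0 a b) =
  (- B * (s * s) - RtoC 2 * s * h * E)%C.
Proof. unfold h, s. solve_jet. Qed.

Lemma jet_mono21 : jet a b A B D E (mono 2 1 a b) = (E * (s * s))%C.
Proof. unfold s. solve_jet. Qed.

End TestValues.

(** * Estimates on the coefficients *)

Lemma Cmod_le_plus2 (w x y z : C) : w = (x + y + z)%C ->
  Cmod w <= Cmod x + Cmod y + Cmod z.
Proof.
  intros ->. eapply Rle_trans; [apply Cmod_triangle|].
  apply Rplus_le_compat_r, Cmod_triangle.
Qed.

Lemma Cmod_le_plus3 (w x y z t : C) : w = (x + y + z + t)%C ->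
  Cmod w <= Cmod x + Cmod y + Cmod z + Cmod t.
Proof.
  intros ->. eapply Rle_trans; [apply Cmod_triangle|].
  apply Rplus_le_compat_r, Cmod_le_plus2. reflexivity.
Qed.

Lemma half_cancel (x y c : R) : / 2 <= x -> 0 <= y -> x * y <= c -> y <= 2 * c.
Proof. intros. nra. Qed.

Section Coefficients.

Variables a b A B D E : C.
Hypothesis ha : disk a.
Hypothesis hb : disk b.
Let r := rho a b.

Let r0 : 0 <= r := rho_nonneg a b.
Let r1 : r < 1 := rho_lt_1 a b ha hb.

Let Hs : Cmod (sigma a b) = r.
Proof. rewrite Cmod_sigma by assumption. apply rho_sym; assumption. Qed.

Let Hs' : Cmod (sigma b a) = r.
Proof. apply Cmod_sigma; assumption. Qed.

Let Hh : Cmod (hder (sigma a) b) = 1 - r ^ 2.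
Proof. rewrite Cmod_hder_sigma by assumption. rewrite rho_sym by assumption. reflexivity. Qed.

Let Hh' : Cmod (hder (sigma b) a) = 1 - r ^ 2.
Proof. apply Cmod_hder_sigma; assumption. Qed.

Let Kh : Cmod (hder (sigma a) b + 1) <= 3 * r.
Proof. eapply Rle_trans; [apply hder_sigma_near; assumption|]. rewrite rho_sym by assumption. apply Rle_refl. Qed.

Let Kh' : Cmod (hder (sigma b) a + 1) <= 3 * r.
Proof. apply hder_sigma_near; assumption. Qed.

(** The test (1,2) bounds r^2 D. The test (0,2) couples r^2 A with r (1 - r^2) D, and is solved once
    for each: the bound on D serves for small r, the bound on A for r bounded below. Dividing by |a|
    >= 1/2 costs the factors 2. *)
Lemma tests_imply_AD (e : R) : / 2 <= Cmod a ->
  Cmod (jet a b A B D E (test_fun 0 2 a b)) <= e ->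
  Cmod (jet a b A B D E (test_fun 1 2 a b)) <= e ->
  r ^ 2 * Cmod D <= 2 * e /\
  r * (1 - r ^ 2) * Cmod D <= 3 * e + r ^ 2 * Cmod A /\
  r ^ 2 * Cmod A <= 6 * e + 4 * (r * Cmod D).
Proof.
  intros ha2 h02 h12.
  assert (a1 : Cmod a < 1) by exact ha.
  pose proof (Cmod_ge_0 A) as pA. pose proof (Cmod_ge_0 D) as pD.
  rewrite jet_test12 in h12 by assumption.
  rewrite !Cmod_mult, Hs' in h12.
  assert (H1 : r ^ 2 * Cmod D <= 2 * e).
  { apply (half_cancel (Cmod a)); [exact ha2 | apply Rmult_le_pos; nra | lra]. }
  rewrite jet_test02 in h02 by assumption.
  assert (K1 : Cmod (RtoC 2 * a * sigma b a * hder (sigma b) a * D) <=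
     e + Cmod (D * (sigma b a * sigma b a)) + Cmod (a * A * (sigma b a * sigma b a))).
  { eapply Rle_trans.
    - apply (Cmod_le_plus2 _ (- (- D * (sigma b a * sigma b a) - a * A * (sigma b a * sigma b a) -
        RtoC 2 * a * sigma b a * hder (sigma b) a * D))%C
        (- (D * (sigma b a * sigma b a)))%C (- (a * A * (sigma b a * sigma b a)))%C). ring.
    - rewrite !Cmod_opp. lra. }
  assert (K2 : Cmod (a * A * (sigma b a * sigma b a)) <=
     e + Cmod (D * (sigma b a * sigma b a)) + Cmod (RtoC 2 * a * sigma b a * hder (sigma b) a * D)).
  { eapply Rle_trans.
    - apply (Cmod_le_plus2 _ (- (- D * (sigma b a * sigma b a) - a * A * (sigma b a * sigma b a) -
        RtoC 2 * a * sigma b a * hder (sigma b) a * D))%C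
        (- (D * (sigma b a * sigma b a)))%C (- (RtoC 2 * a * sigma b a * hder (sigma b) a * D))%C). ring.
    - rewrite !Cmod_opp. lra. }
  rewrite !Cmod_mult, Cmod_R, Hs', Hh' in K1, K2. rewrite Rabs_pos_eq in K1, K2 by lra.
  assert (q0 : 0 <= 1 - r ^ 2) by nra.
  assert (rD : 0 <= r * Cmod D) by (apply Rmult_le_pos; assumption).
  assert (rqD : 0 <= r * (1 - r ^ 2) * Cmod D)
    by (apply Rmult_le_pos; [apply Rmult_le_pos|]; assumption).
  assert (rA : 0 <= r ^ 2 * Cmod A) by (apply Rmult_le_pos; [apply pow_le|]; assumption).
  assert (L1 : Cmod a * (r * (1 - r ^ 2) * Cmod D) >= / 2 * (r * (1 - r ^ 2) * Cmod D)).
  { apply Rle_ge, Rmult_le_compat_r; assumption. }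
  assert (L2 : Cmod a * (r ^ 2 * Cmod A) <= 1 * (r ^ 2 * Cmod A)).
  { apply Rmult_le_compat_r; lra. }
  assert (L3 : Cmod a * (r ^ 2 * Cmod A) >= / 2 * (r ^ 2 * Cmod A)).
  { apply Rle_ge, Rmult_le_compat_r; assumption. }
  assert (L4 : Cmod a * (r * (1 - r ^ 2) * Cmod D) <= 1 * (r * (1 - r ^ 2) * Cmod D)).
  { apply Rmult_le_compat_r; lra. }
  assert (L5 : r * (1 - r ^ 2) * Cmod D <= r * Cmod D) by nra.
  assert (N1 : 2 * Cmod a * r * (1 - r ^ 2) * Cmod D = 2 * (Cmod a * (r * (1 - r ^ 2) * Cmod D))) by ring.
  assert (N2 : Cmod a * Cmod A * (r * r) = Cmod a * (r ^ 2 * Cmod A)) by ring.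
  assert (N3 : Cmod D * (r * r) = r ^ 2 * Cmod D) by ring.
  repeat split; lra.
Qed.

(** The test (0,1) bounds D h' + E once r A, r D and r E are known to be small, and h' is within 3 r
    of -1, so D - E is small. The test (0,0) then yields A - B. The constants are 46 = 2 * 14 + 3 *
    6 and 132 = 2 * (1 + 46 + 3 * 6 + 1). *)
Lemma tests_imply_near (e : R) : / 2 <= Cmod a -> r <= / 2 ->
  (forall n m, In (n, m) [(0, 0); (0, 1); (0, 2); (1, 2)]%nat ->
     Cmod (jet a b A B D E (test_fun n m a b)) <= e) ->
  r * Cmod A <= e -> r * Cmod B <= e -> r * Cmod E <= 6 * e ->
  Cmod (A - B) <= 132 * e /\ Cmod (D - E) <= 46 * e.
Proof.
  intros ha2 hr ht hA hB hE.
  assert (a1 : Cmod a < 1) by exact ha.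
  pose proof (ht 0 0 ltac:(simpl; tauto))%nat as h00.
  pose proof (ht 0 1 ltac:(simpl; tauto))%nat as h01.
  destruct (tests_imply_AD e ha2 (ht 0 2 ltac:(simpl; tauto))%nat (ht 1 2 ltac:(simpl; tauto))%nat)
    as (_ & h1 & _).
  pose proof (Cmod_ge_0 A) as pA. pose proof (Cmod_ge_0 D) as pD.
  assert (e0 : 0 <= e) by (eapply Rle_trans; [apply Cmod_ge_0 | exact h00]).
  assert (hD : r * Cmod D <= 6 * e).
  { assert (r ^ 2 * Cmod A <= / 2 * (r * Cmod A)).
    { assert (0 <= r * Cmod A) by (apply Rmult_le_pos; assumption). nra. }
    assert (3 / 4 * (r * Cmod D) <= r * (1 - r ^ 2) * Cmod D).
    { assert (r ^ 2 <= / 4) by nra.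
      assert (0 <= r * Cmod D * (/ 4 - r ^ 2))
        by (apply Rmult_le_pos; [apply Rmult_le_pos|]; lra).
      lra. }
    lra. }
  rewrite jet_test00 in h00 by assumption. rewrite jet_test01 in h01 by assumption.
  set (s := sigma a b) in *. set (s' := sigma b a) in *.
  set (h := hder (sigma a) b) in *. set (h' := hder (sigma b) a) in *.
  assert (K1 : Cmod (a * (D * h' + E)) <= 14 * e).
  { eapply Rle_trans.
    - apply (Cmod_le_plus3 _ (- (- D * s' + E * s - a * (A * s' + (D * h' + E))))%C
        (- (D * s'))%C (E * s)%C (- (a * A * s'))%C). ring.
    - rewrite !Cmod_opp, !Cmod_mult, Hs, Hs'.
      assert (Cmod a * (r * Cmod A) <= 1 * (r * Cmod A)).
      { apply Rmult_le_compat_r; [apply Rmult_le_pos|]; lra. }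
      lra. }
  rewrite Cmod_mult in K1. apply half_cancel in K1; [|exact ha2|apply Cmod_ge_0].
  assert (K2 : Cmod (D - E) <= 46 * e).
  { replace (D - E)%C with (D * (h' + 1) - (D * h' + E))%C by ring.
    eapply Rle_trans; [apply Cmod_triangle_sub|]. rewrite Cmod_mult.
    assert (Cmod D * Cmod (h' + 1) <= Cmod D * (3 * r)) by (apply Rmult_le_compat_l; assumption).
    lra. }
  split; [|exact K2].
  assert (K3 : Cmod (a * (A - B)) <= 66 * e).
  { eapply Rle_trans.
    - apply (Cmod_le_plus3 _ (- (- a * (A - B) - (D - E) - E * (h + 1) - B * s))%C
        (- (D - E))%C (- (E * (h + 1)))%C (- (B * s))%C). ring.
    - rewrite !Cmod_opp, !Cmod_mult, Hs.
      assert (Cmod E * Cmod (h + 1) <= Cmod E * (3 * r))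
        by (apply Rmult_le_compat_l; [apply Cmod_ge_0 | assumption]).
      lra. }
  rewrite Cmod_mult in K3. apply half_cancel in K3; [lra|exact ha2|apply Cmod_ge_0].
Qed.

(** Applied with the two points exchanged, it supplies the hypothesis on r E of
    [tests_imply_near]. *)
Lemma tests_imply_rD (e : R) : / 2 <= Cmod a -> r <= / 2 ->
  Cmod (jet a b A B D E (test_fun 0 2 a b)) <= e ->
  Cmod (jet a b A B D E (test_fun 1 2 a b)) <= e ->
  r * Cmod A <= e -> r * Cmod D <= 6 * e.
Proof.
  intros ha2 hr h02 h12 hA.
  destruct (tests_imply_AD e ha2 h02 h12) as (_ & h1 & _).
  pose proof (Cmod_ge_0 A) as pA. pose proof (Cmod_ge_0 D) as pD.
  assert (e0 : 0 <= e) by (eapply Rle_trans; [apply Cmod_ge_0 | exact h02]).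
  assert (r ^ 2 * Cmod A <= / 2 * (r * Cmod A)).
  { assert (0 <= r * Cmod A) by (apply Rmult_le_pos; assumption). nra. }
  assert (3 / 4 * (r * Cmod D) <= r * (1 - r ^ 2) * Cmod D).
  { assert (r ^ 2 <= / 4) by nra.
      assert (0 <= r * Cmod D * (/ 4 - r ^ 2))
        by (apply Rmult_le_pos; [apply Rmult_le_pos|]; lra).
      lra. }
  lra.
Qed.

(** The bound on A passes through that on D, and each costs a division by d^2; 14 = 6 + 4 * 2. *)
Lemma tests_imply_far (e d : R) : / 2 <= Cmod a -> 0 < d <= r ->
  Cmod (jet a b A B D E (test_fun 0 2 a b)) <= e ->
  Cmod (jet a b A B D E (test_fun 1 2 a b)) <= e ->
  Cmod A <= 14 * e / d ^ 4 /\ Cmod D <= 14 * e / d ^ 4.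
Proof.
  intros ha2 hd h02 h12.
  destruct (tests_imply_AD e ha2 h02 h12) as (h1 & _ & h3).
  pose proof (Cmod_ge_0 A) as pA. pose proof (Cmod_ge_0 D) as pD.
  assert (d2 : 0 < d ^ 2) by (apply pow_lt; lra).
  assert (d4 : 0 < d ^ 4) by (apply pow_lt; lra).
  assert (d21 : d ^ 2 <= 1) by nra.
  assert (dr : d ^ 2 <= r ^ 2) by nra.
  assert (E4 : d ^ 4 = d ^ 2 * d ^ 2) by ring.
  assert (e0 : 0 <= e) by (eapply Rle_trans; [apply Cmod_ge_0 | exact h02]).
  assert (HD : d ^ 2 * Cmod D <= 2 * e) by nra.
  assert (HA : d ^ 2 * Cmod A <= 6 * e + 4 * Cmod D) by nra.
  assert (HA' : d ^ 4 * Cmod A <= 14 * e).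
  { rewrite E4.
    assert (d ^ 2 * (d ^ 2 * Cmod A) <= d ^ 2 * (6 * e + 4 * Cmod D))
      by (apply Rmult_le_compat_l; lra).
    nra. }
  assert (HD' : d ^ 4 * Cmod D <= 14 * e) by (rewrite E4; nra).
  split; apply (Rmult_le_reg_r (d ^ 4)); try exact d4;
    unfold Rdiv; rewrite Rmult_assoc, Rinv_l by lra; lra.
Qed.

(** The bounded counterpart of the preceding smallness estimates, valid at every z; it covers the
    points where a or b is away from the circle. *)
Lemma bounded_coefficients (M : R) :
  (forall i j, Cmod (jet a b A B D E (mono i j a b)) <= M) ->
  r * Cmod A <= M -> r * Cmod B <= M ->
  Cmod (A - B) <= 8 * M /\ Cmod (D - E) <= 8 * M /\
  r * Cmod D <= 8 * M /\ r * Cmod E <= 8 * M.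
Proof.
  intros hM hA hB.
  pose proof (hM 0 0)%nat as h00. pose proof (hM 0 1)%nat as h01.
  pose proof (hM 0 2)%nat as h02. pose proof (hM 1 2)%nat as h12.
  pose proof (hM 2 0)%nat as h20. pose proof (hM 2 1)%nat as h21.
  rewrite jet_mono00 in h00 by assumption. rewrite jet_mono01 in h01 by assumption.
  rewrite jet_mono02 in h02 by assumption. rewrite jet_mono12 in h12 by assumption.
  rewrite jet_mono20 in h20 by assumption. rewrite jet_mono21 in h21 by assumption.
  pose proof (Cmod_ge_0 A) as pA. pose proof (Cmod_ge_0 D) as pD.
  pose proof (Cmod_ge_0 B) as pB. pose proof (Cmod_ge_0 E) as pE.
  pose proof (Cmod_ge_0 (A - B)).
  set (s := sigma a b) in *. set (s' := sigma b a) in *.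
  set (h := hder (sigma a) b) in *. set (h' := hder (sigma b) a) in *.
  rewrite !Cmod_mult, ?Cmod_opp, Hs' in h12. rewrite !Cmod_mult, Hs in h21.
  assert (M0 : 0 <= M) by lra.
  (* Write r Y = r (1 - r^2) Y + r^3 Y. The first term is read off the function with one double
     zero, the second from the bound on r^2 Y. *)
  assert (key : forall X Y t k : C, Cmod t = r -> Cmod k = 1 - r ^ 2 ->
    r * Cmod X <= M -> Cmod Y * (r * r) <= M ->
    Cmod (X * (t * t) + RtoC 2 * t * k * Y) <= M -> r * Cmod Y <= 2 * M).
  { intros X Y t k ht hk hX hY H1.
    assert (K : Cmod (RtoC 2 * t * k * Y) <= M + Cmod (X * (t * t))).
    { replace (RtoC 2 * t * k * Y)%C with ((X * (t * t) + RtoC 2 * t * k * Y) - X * (t * t))%C by ring.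
      eapply Rle_trans; [apply Cmod_triangle_sub|]. lra. }
    rewrite !Cmod_mult, Cmod_R, ht, hk, Rabs_pos_eq in K by lra.
    pose proof (Cmod_ge_0 X). pose proof (Cmod_ge_0 Y).
    assert (Cmod X * (r * r) <= r * Cmod X).
    { assert (0 <= r * Cmod X) by (apply Rmult_le_pos; assumption). nra. }
    assert (r * (Cmod Y * (r * r)) <= 1 * (Cmod Y * (r * r))).
    { apply Rmult_le_compat_r; [apply Rmult_le_pos; nra | lra]. }
    lra. }
  assert (kD : r * Cmod D <= 2 * M) by (apply (key A D s' h'); auto; lra).
  assert (kE : r * Cmod E <= 2 * M).
  { apply (key B E s h); auto; try lra. rewrite <- Cmod_opp.
    replace (- (B * (s * s) + RtoC 2 * s * h * E))%C with (- B * (s * s) - RtoC 2 * s * h * E)%C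
      by ring. exact h20. }
  repeat split; try lra.
  replace (D - E)%C with (D * (h' + 1) + (A * s' - (A * s' + (D * h' + E))))%C by ring.
  eapply Rle_trans; [apply Cmod_triangle|].
  eapply Rle_trans; [apply Rplus_le_compat_l, Cmod_triangle_sub|].
  rewrite (Cmod_mult D), (Cmod_mult A), Hs'.
  assert (Cmod D * Cmod (h' + 1) <= Cmod D * (3 * r)) by (apply Rmult_le_compat_l; assumption).
  lra.
Qed.

End Coefficients.

(** * Estimates on bounded analytic functions *)

Definition unit_fun (f : C -> C) : Prop :=
  analytic_disk f /\ forall z, disk z -> Cmod (f z) <= 1.

Lemma Cmod_sub_0 (w : C) : Cmod (w - RtoC 0) = Cmod w.
Proof. f_equal. ring. Qed.

Lemma Cmod_hder (f : C -> C) (w : C) : disk w ->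
  Cmod (hder f w) = (1 - Cmod w ^ 2) * Cmod (C_derive f w).
Proof.
  intros hw. unfold hder. rewrite Cmod_mult, Cmod_R, Rabs_pos_eq; [reflexivity|].
  left. apply Cmod_lt_1_sqr, hw.
Qed.

Lemma hder_diff_bound (f : C -> C) (a b : C) : disk a -> disk b ->
  Cmod (hder f a - hder f b) <=
    (1 - Cmod a ^ 2) * Cmod (C_derive f a - C_derive f b) +
    2 * Cmod (a - b) * Cmod (C_derive f b).
Proof.
  intros ha hb. pose proof (Cmod_lt_1_sqr a ha).
  replace (hder f a - hder f b)%C with
    (RtoC (1 - Cmod a ^ 2) * (C_derive f a - C_derive f b) +
     RtoC ((Cmod b - Cmod a) * (Cmod b + Cmod a)) * C_derive f b)%C.
  - eapply Rle_trans; [apply Cmod_triangle|]. rewrite !Cmod_mult, !Cmod_R.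
    rewrite Rabs_pos_eq by lra. apply Rplus_le_compat_l.
    apply Rmult_le_compat_r; [apply Cmod_ge_0|].
    rewrite Rabs_mult. unfold disk in *.
    pose proof (Cmod_ge_0 a). pose proof (Cmod_ge_0 b).
    rewrite (Rabs_pos_eq (Cmod b + Cmod a)) by lra.
    assert (Rabs (Cmod b - Cmod a) <= Cmod (a - b)).
    { apply Rabs_le_between. pose proof (Cmod_triangle_rev a b).
      pose proof (Cmod_triangle_rev b a). rewrite (Cmod_sub_sym b a) in *. lra. }
    pose proof (Rabs_pos (Cmod b - Cmod a)). nra.
  - replace ((Cmod b - Cmod a) * (Cmod b + Cmod a)) with
      ((1 - Cmod a ^ 2) - (1 - Cmod b ^ 2)) by ring.
    rewrite (RtoC_minus (1 - Cmod a ^ 2)). unfold hder. ring.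
Qed.

Lemma unit_fun_derive (f : C -> C) (a : C) : unit_fun f -> disk a ->
  Cmod (C_derive f a) <= 2 / (1 - Cmod a).
Proof.
  intros [hf h1] ha.
  replace (2 / (1 - Cmod a)) with (2 * 1 / (1 - Cmod a)) by (f_equal; ring).
  apply (ball_derive_bound f (RtoC 0) 1 1).
  - intros w hw. rewrite Cmod_sub_0 in hw. apply hf, hw.
  - intros w hw. rewrite Cmod_sub_0 in hw. apply h1, hw.
  - exact ha.
  - rewrite Cmod_sub_0. apply Rle_refl.
Qed.

Lemma unit_fun_hder (f : C -> C) (a : C) : unit_fun f -> disk a -> Cmod (hder f a) <= 4.
Proof.
  intros hf ha. pose proof (unit_fun_derive f a hf ha) as H.
  rewrite Cmod_hder by exact ha. unfold disk in ha. pose proof (Cmod_ge_0 a).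
  apply Rle_trans with ((1 - Cmod a ^ 2) * (2 / (1 - Cmod a))).
  - apply Rmult_le_compat_l; [nra | exact H].
  - replace ((1 - Cmod a ^ 2) * (2 / (1 - Cmod a))) with (2 * (1 + Cmod a)) by (field; lra). lra.
Qed.

(** For rho <= 1/8 the point b lies in the ball about a of half the distance [d] to the circle, and
    the ball estimates scale with d exactly as |a - b| <= 4 rho d does. They give 16 and 512 + 32.
    For larger rho the bounds 2 and 4 + 4 are enough. *)
Lemma unit_fun_rho_lipschitz (f : C -> C) (a b : C) : unit_fun f -> disk a -> disk b ->
  Cmod (f a - f b) <= 600 * rho a b /\ Cmod (hder f a - hder f b) <= 600 * rho a b.
Proof.
  intros hu ha hb. pose proof (rho_nonneg a b) as r0.
  assert (U := hu). destruct U as [hf h1].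
  destruct (Rle_or_lt (rho a b) (/ 8)) as [h|h].
  - pose proof (dist_le_rho_local a b ha hb ltac:(lra)) as hd.
    set (r := rho a b) in *. set (d := 1 - Cmod a) in *.
    assert (d0 : 0 < d <= 1) by (unfold d, disk in *; pose proof (Cmod_ge_0 a); lra).
    assert (hs : forall w, Cmod (w - a) < d -> disk w).
    { intros w hw. unfold disk. replace w with (w - a + a)%C by ring.
      eapply Rle_lt_trans; [apply Cmod_triangle|]. unfold d in hw. lra. }
    assert (ha' : Cmod (a - a) <= d / 2)
      by (replace (a - a)%C with (RtoC 0) by ring; rewrite Cmod_0; lra).
    assert (hb' : Cmod (b - a) <= d / 2).
    { rewrite Cmod_sub_sym. eapply Rle_trans; [exact hd|].
      assert (r * d <= / 8 * d) by (apply Rmult_le_compat_r; lra). lra. }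
    assert (F1 : forall w, Cmod (w - a) < d -> ex_cderive f w) by (intros; apply hf, hs; assumption).
    assert (F2 : forall w, Cmod (w - a) < d -> Cmod (f w) <= 1) by (intros; apply h1, hs; assumption).
    pose proof (ball_lipschitz f a d 1 F1 F2 (d / 2) a b ltac:(lra) ha' hb') as L1.
    pose proof (ball_derive_lipschitz f a d 1 F1 F2 (d / 2) a b ltac:(lra) ha' hb') as L2.
    pose proof (ball_derive_bound f a d 1 F1 F2 (d / 2) b ltac:(lra) hb') as L3.
    replace (2 * 1 / (d - d / 2)) with (4 / d) in L1, L3 by (field; lra).
    replace (16 * 1 / (d - d / 2) ^ 2) with (64 / (d * d)) in L2 by (field; lra).
    assert (i0 : 0 < / d) by (apply Rinv_0_lt_compat; lra).
    assert (i1 : d * / d = 1) by (apply Rinv_r; lra).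
    split.
    + eapply Rle_trans; [exact L1|].
      apply Rle_trans with (4 / d * (4 * r * d)).
      * apply Rmult_le_compat_l; [unfold Rdiv; lra | exact hd].
      * replace (4 / d * (4 * r * d)) with (16 * r) by (field; lra). lra.
    + eapply Rle_trans; [apply hder_diff_bound; assumption|].
      assert (A1 : (1 - Cmod a ^ 2) * Cmod (C_derive f a - C_derive f b) <= 512 * r).
      { apply Rle_trans with ((2 * d) * (64 / (d * d) * (4 * r * d))).
        - apply Rmult_le_compat; [left; apply Cmod_lt_1_sqr, ha | apply Cmod_ge_0 | |].
          + unfold d. pose proof (pow2_ge_0 (1 - Cmod a)). lra.
          + eapply Rle_trans; [exact L2|]. apply Rmult_le_compat_l; [|exact hd].
            apply Rdiv_le_0_compat; nra.
        - right. field. lra. }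
      assert (A2 : 2 * Cmod (a - b) * Cmod (C_derive f b) <= 32 * r).
      { apply Rle_trans with (2 * (4 * r * d) * (4 / d)).
        - apply Rmult_le_compat; [pose proof (Cmod_ge_0 (a - b)); lra | apply Cmod_ge_0 | lra | exact L3].
        - right. field. lra. }
      lra.
  - split.
    + eapply Rle_trans; [apply Cmod_triangle_sub|].
      pose proof (h1 a ha). pose proof (h1 b hb). lra.
    + eapply Rle_trans; [apply Cmod_triangle_sub|].
      pose proof (unit_fun_hder f a hu ha). pose proof (unit_fun_hder f b hu hb). lra.
Qed.

(** Inside a fixed smaller disk |a - b| <= 2 rho, so the Euclidean estimates suffice and retain the
    factor [k]. The constant is 40 = 16 * 2 + 2 * 2 * 2, from the two terms of [hder_diff_bound]. *)
Lemma small_disk_estimates (f : C -> C) (r s k : R) (a b : C) :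
  analytic_disk f -> 0 < r < s -> s < 1 -> (forall w, Cmod w <= s -> Cmod (f w) <= k) ->
  Cmod a <= r -> Cmod b <= r ->
  Cmod (f a) <= 40 / (s - r) ^ 2 * k /\ Cmod (hder f a) <= 40 / (s - r) ^ 2 * k /\
  Cmod (f a - f b) <= 40 / (s - r) ^ 2 * k * rho a b /\
  Cmod (hder f a - hder f b) <= 40 / (s - r) ^ 2 * k * rho a b.
Proof.
  intros hf hr hs hk ha hb.
  assert (da : disk a) by (unfold disk; lra). assert (db : disk b) by (unfold disk; lra).
  pose proof (rho_nonneg a b) as r0.
  pose proof (dist_le_rho a b da db) as hd.
  assert (k0 : 0 <= k) by (eapply Rle_trans; [apply Cmod_ge_0 | apply (hk a); lra]).
  assert (F1 : forall w, Cmod (w - RtoC 0) < s -> ex_cderive f w).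
  { intros w hw. rewrite Cmod_sub_0 in hw. apply hf. unfold disk. lra. }
  assert (F2 : forall w, Cmod (w - RtoC 0) < s -> Cmod (f w) <= k).
  { intros w hw. rewrite Cmod_sub_0 in hw. apply hk. lra. }
  assert (ha' : Cmod (a - RtoC 0) <= r) by (rewrite Cmod_sub_0; exact ha).
  assert (hb' : Cmod (b - RtoC 0) <= r) by (rewrite Cmod_sub_0; exact hb).
  pose proof (ball_lipschitz f _ s k F1 F2 r a b ltac:(lra) ha' hb') as L1.
  pose proof (ball_derive_lipschitz f _ s k F1 F2 r a b ltac:(lra) ha' hb') as L2.
  pose proof (ball_derive_bound f _ s k F1 F2 r a ltac:(lra) ha') as L3.
  pose proof (ball_derive_bound f _ s k F1 F2 r b ltac:(lra) hb') as L4.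
  set (q := s - r) in *. assert (hq : 0 < q < 1) by (unfold q; lra).
  set (t := / q ^ 2). assert (ht : 1 <= t).
  { unfold t. rewrite <- Rinv_1. apply Rinv_le_contravar; nra. }
  assert (hqt : / q <= t).
  { unfold t. apply Rinv_le_contravar; nra. }
  assert (hq0 : 0 < / q) by (apply Rinv_0_lt_compat; lra).
  assert (kt : k <= k * t) by nra.
  assert (L3' : Cmod (C_derive f a) <= 2 * (k * t)).
  { eapply Rle_trans; [exact L3|]. unfold Rdiv. nra. }
  assert (L4' : Cmod (C_derive f b) <= 2 * (k * t)).
  { eapply Rle_trans; [exact L4|]. unfold Rdiv. nra. }
  replace (40 / q ^ 2 * k) with (40 * (k * t)) by (unfold t; field; lra).
  pose proof (Cmod_lt_1_sqr a da). pose proof (Cmod_ge_0 a) as a0.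
  assert (sq1 : 1 - Cmod a ^ 2 <= 1) by nra.
  pose proof (Cmod_ge_0 (a - b)) as ab0.
  set (X := k * t) in *. assert (X0 : 0 <= X) by lra.
  repeat split.
  - eapply Rle_trans; [apply (hk a); lra|]. lra.
  - rewrite Cmod_hder by exact da. pose proof (Cmod_ge_0 (C_derive f a)). nra.
  - eapply Rle_trans; [exact L1|].
    apply Rle_trans with (2 * X * (2 * rho a b)).
    + apply Rmult_le_compat; try lra.
      * apply Rdiv_le_0_compat; lra.
      * unfold X, Rdiv. nra.
    + nra.
  - eapply Rle_trans; [apply hder_diff_bound; assumption|].
    assert (A1 : (1 - Cmod a ^ 2) * Cmod (C_derive f a - C_derive f b) <= 32 * X * rho a b).
    { apply Rle_trans with (1 * (16 * X * (2 * rho a b))).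
      - apply Rmult_le_compat; [lra | apply Cmod_ge_0 | lra |].
        eapply Rle_trans; [exact L2|]. apply Rmult_le_compat; try lra.
        + apply Rdiv_le_0_compat; [lra | apply pow_lt; lra].
        + right. unfold X, t. field. lra.
      - right. ring. }
    assert (A2 : 2 * Cmod (a - b) * Cmod (C_derive f b) <= 2 * (2 * rho a b) * (2 * X)).
    { apply Rmult_le_compat; [lra | apply Cmod_ge_0 | lra | exact L4']. }
    nra.
Qed.

(** * The operator *)

(** The weight times the hyperbolic derivative of [f]: the quotient turns the outer factor 1 - |z|^2
    into the factor 1 - |f z|^2 required by [hder] at f z. *)
Definition lift_coef (w f : C -> C) (z : C) : C :=
  (w z * (RtoC ((1 - Cmod z ^ 2) / (1 - Cmod (f z) ^ 2)) * C_derive f z))%C.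

Definition op_jet (u phi v psi : C -> C) (z : C) : (C -> C) -> C :=
  jet (phi z) (psi z) (hder u z) (hder v z) (lift_coef u phi z) (lift_coef v psi z).

Lemma op_jet_swap (u phi v psi : C -> C) (z : C) (f : C -> C) :
  op_jet u phi v psi z f = (- op_jet v psi u phi z f)%C.
Proof. apply jet_swap. Qed.

Lemma is_cderive_wcomp (u phi f : C -> C) (z : C) :
  analytic_disk u -> self_map_disk phi -> analytic_disk f -> disk z ->
  is_cderive (wcomp u phi f) z
    (C_derive u z * f (phi z) + u z * (C_derive phi z * C_derive f (phi z)))%C.
Proof.
  intros hu [hp hm] hf hz.
  apply (is_cderive_mult u (fun z => f (phi z))).
  - apply C_derive_spec, hu, hz.
  - apply (is_cderive_comp f phi).
    + apply C_derive_spec, hf, hm, hz.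
    + apply C_derive_spec, hp, hz.
Qed.

Lemma hder_wcomp (u phi f : C -> C) (z : C) :
  analytic_disk u -> self_map_disk phi -> analytic_disk f -> disk z ->
  hder (wcomp u phi f) z = (hder u z * f (phi z) + lift_coef u phi z * hder f (phi z))%C.
Proof.
  intros hu hp hf hz. rewrite (hder_eq _ _ _ (is_cderive_wcomp u phi f z hu hp hf hz)).
  pose proof (Cmod_lt_1_sqr _ (proj2 hp z hz)) as h.
  unfold hder, lift_coef.
  replace (RtoC (1 - Cmod z ^ 2)) with
    (RtoC ((1 - Cmod z ^ 2) / (1 - Cmod (phi z) ^ 2)) * RtoC (1 - Cmod (phi z) ^ 2))%C at 1.
  - replace (RtoC (1 - Cmod z ^ 2) * C_derive u z * f (phi z))%C with
     (RtoC ((1 - Cmod z ^ 2) / (1 - Cmod (phi z) ^ 2)) * RtoC (1 - Cmod (phi z) ^ 2) *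
       C_derive u z * f (phi z))%C; [ring|].
    rewrite <- RtoC_mult. do 3 f_equal. field. lra.
  - rewrite <- RtoC_mult. f_equal. field. lra.
Qed.

Lemma analytic_wcomp_diff (u phi v psi f : C -> C) :
  analytic_disk u -> analytic_disk v -> self_map_disk phi -> self_map_disk psi ->
  analytic_disk f -> analytic_disk (wcomp_diff u phi v psi f).
Proof.
  intros hu hv hp hq hf z hz. apply ex_cderive_minus.
  - eexists. apply (is_cderive_wcomp u phi f z); assumption.
  - eexists. apply (is_cderive_wcomp v psi f z); assumption.
Qed.

Lemma hder_wcomp_diff (u phi v psi f : C -> C) (z : C) :
  analytic_disk u -> analytic_disk v -> self_map_disk phi -> self_map_disk psi ->
  analytic_disk f -> disk z ->
  hder (wcomp_diff u phi v psi f) z = op_jet u phi v psi z f.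
Proof.
  intros hu hv hp hq hf hz. unfold wcomp_diff.
  transitivity (hder (wcomp u phi f) z - hder (wcomp v psi f) z)%C.
  - pose proof (is_cderive_wcomp u phi f z hu hp hf hz) as H1.
    pose proof (is_cderive_wcomp v psi f z hv hq hf hz) as H2.
    etransitivity; [exact (hder_eq _ _ _ (is_cderive_minus _ _ _ _ _ H1 H2))|].
    rewrite (hder_eq _ _ _ H1), (hder_eq _ _ _ H2). ring.
  - rewrite !hder_wcomp by assumption. unfold op_jet, jet. ring.
Qed.

Lemma analytic_sigma (a : C) : disk a -> analytic_disk (sigma a).
Proof. intros ha z hz. apply ex_cderive_sigma; assumption. Qed.

Lemma Cmod_sigma_le_1 (a z : C) : disk a -> disk z -> Cmod (sigma a z) <= 1.
Proof.
  intros ha hz. rewrite Cmod_sigma by assumption. left. apply rho_lt_1; assumption.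
Qed.

Lemma pow_le_1 (x : R) (n : nat) : 0 <= x <= 1 -> 0 <= x ^ n <= 1.
Proof.
  intros h. induction n as [|n IH]; simpl; [lra|]. nra.
Qed.

Lemma unit_fun_mono (i j : nat) (a b : C) : disk a -> disk b -> unit_fun (mono i j a b).
Proof.
  intros ha hb. split.
  - intros z hz. apply ex_cderive_mono; assumption.
  - intros z hz. unfold mono. rewrite Cmod_mult, !Cmod_pow.
    pose proof (pow_le_1 (Cmod (sigma a z)) i
      (conj (Cmod_ge_0 _) (Cmod_sigma_le_1 a z ha hz))).
    pose proof (pow_le_1 (Cmod (sigma b z)) j
      (conj (Cmod_ge_0 _) (Cmod_sigma_le_1 b z hb hz))). nra.
Qed.

(** Here the tests make A and D small, while B and E are only known to be at most M/d. The missing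
    smallness comes from f at b. The factor 8 is 4 + 4, as f a and hder f a are at most 4. *)
Lemma jet_mixed (a b A B D E : C) (f : C -> C) (e d M k : R) :
  disk a -> disk b -> / 2 <= Cmod a -> 0 < d <= rho a b ->
  Cmod (jet a b A B D E (test_fun 0 2 a b)) <= e ->
  Cmod (jet a b A B D E (test_fun 1 2 a b)) <= e ->
  rho a b * Cmod B <= M -> rho a b * Cmod E <= M ->
  unit_fun f -> Cmod (f b) <= k -> Cmod (hder f b) <= k ->
  Cmod (jet a b A B D E f) <= 8 * (14 * e / d ^ 4) + 2 * M / d * k.
Proof.
  intros ha hb ha2 hd h02 h12 hB hE hf kb kb'.
  destruct (tests_imply_far a b A B D E ha hb e d ha2 hd h02 h12) as [hA hD].
  assert (G : forall X : C, rho a b * Cmod X <= M -> Cmod X <= M / d).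
  { intros X hX. apply (Rmult_le_reg_r d); [lra|]. unfold Rdiv.
    rewrite Rmult_assoc, Rinv_l by lra. pose proof (Cmod_ge_0 X). nra. }
  pose proof (G B hB) as gB. pose proof (G E hE) as gE.
  assert (k0 : 0 <= k) by (eapply Rle_trans; [apply Cmod_ge_0 | exact kb]).
  pose proof (proj2 hf a ha) as fa. pose proof (unit_fun_hder f a hf ha) as ga.
  eapply Rle_trans; [apply (jet_bound_crude a b A B D E f 4 k); lra|].
  replace (2 * M / d * k) with (k * (M / d + M / d)) by (field; lra).
  assert (k * (Cmod B + Cmod E) <= k * (M / d + M / d)) by (apply Rmult_le_compat_l; lra).
  lra.
Qed.

(** * From the tests to smallness on the whole unit ball *)

Section Sufficiency.

Variables u v phi psi : C -> C.
Hypothesis hphi : self_map_disk phi.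
Hypothesis hpsi : self_map_disk psi.
Variable M : R.
Hypothesis hM : forall f z, unit_fun f -> disk z -> Cmod (op_jet u phi v psi z f) <= M.
Hypothesis hAM : forall z, disk z -> rho (phi z) (psi z) * Cmod (hder u z) <= M.
Hypothesis hBM : forall z, disk z -> rho (phi z) (psi z) * Cmod (hder v z) <= M.
Hypothesis hA0 : forall e, 0 < e -> exists d, 0 < d /\ forall z, disk z ->
  rho (phi z) (psi z) < d -> rho (phi z) (psi z) * Cmod (hder u z) <= e.
Hypothesis hB0 : forall e, 0 < e -> exists d, 0 < d /\ forall z, disk z ->
  rho (phi z) (psi z) < d -> rho (phi z) (psi z) * Cmod (hder v z) <= e.
Hypothesis tests : forall n m, In (n, m) [(0, 0); (0, 1); (0, 2); (1, 2)]%nat ->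
  forall e, 0 < e -> exists d, 0 < d /\ forall a b z, disk a -> disk b -> disk z ->
  1 - d < Cmod a -> Cmod (op_jet u phi v psi z (test_fun n m a b)) <= e.

Let uniform_tests (e : R) : 0 < e -> exists r, / 2 <= r < 1 /\
  forall n m, In (n, m) [(0, 0); (0, 1); (0, 2); (1, 2)]%nat ->
  forall a b z, disk a -> disk b -> disk z ->
  r < Cmod a -> Cmod (op_jet u phi v psi z (test_fun n m a b)) <= e.
Proof.
  intros he.
  destruct (tests 0 0 ltac:(simpl; tauto) e he)%nat as (d1 & p1 & h1).
  destruct (tests 0 1 ltac:(simpl; tauto) e he)%nat as (d2 & p2 & h2).
  destruct (tests 0 2 ltac:(simpl; tauto) e he)%nat as (d3 & p3 & h3).
  destruct (tests 1 2 ltac:(simpl; tauto) e he)%nat as (d4 & p4 & h4).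
  set (d := Rmin (/ 2) (Rmin (Rmin d1 d2) (Rmin d3 d4))).
  assert (hd : 0 < d <= / 2 /\ d <= d1 /\ d <= d2 /\ d <= d3 /\ d <= d4).
  { unfold d.
    pose proof (Rmin_l (/ 2) (Rmin (Rmin d1 d2) (Rmin d3 d4))).
    pose proof (Rmin_r (/ 2) (Rmin (Rmin d1 d2) (Rmin d3 d4))).
    pose proof (Rmin_l (Rmin d1 d2) (Rmin d3 d4)). pose proof (Rmin_r (Rmin d1 d2) (Rmin d3 d4)).
    pose proof (Rmin_l d1 d2). pose proof (Rmin_r d1 d2).
    pose proof (Rmin_l d3 d4). pose proof (Rmin_r d3 d4).
    repeat split; try lra. repeat apply Rmin_glb_lt; lra. }
  exists (1 - d). split; [lra|].
  intros n m hnm a b z ha hb hz hr. simpl in hnm.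
  destruct hnm as [E|[E|[E|[E|[]]]]]; inversion E; subst n m;
    [apply h1 | apply h2 | apply h3 | apply h4]; auto; lra.
Qed.

Theorem tests_imply_vanishing (eps : R) : 0 < eps -> exists r k, 0 < r < 1 /\ 0 < k /\
  forall f, unit_fun f -> (forall w, Cmod w <= r -> Cmod (f w) <= k) ->
  forall z, disk z -> Cmod (op_jet u phi v psi z f) <= eps.
Proof.
  intros heps.
  assert (M0 : 0 <= M).
  { assert (h0 : disk (RtoC 0)) by (unfold disk; rewrite Cmod_0; lra).
    eapply Rle_trans; [|apply (hAM _ h0)].
    apply Rmult_le_pos; [apply rho_nonneg | apply Cmod_ge_0]. }
  (* The close case below costs 600 * (132 + 1 + 46 + 6) = 111000 times [e1]. *)
  set (e1 := eps / 200000). assert (he1 : 0 < e1) by (unfold e1; lra).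
  destruct (hA0 e1 he1) as (du & pu & hdu). destruct (hB0 e1 he1) as (dv & pv & hdv).
  set (d := Rmin (/ 2) (Rmin du dv)).
  assert (hd : 0 < d /\ d <= / 2 /\ d <= du /\ d <= dv).
  { unfold d. pose proof (Rmin_l (/ 2) (Rmin du dv)). pose proof (Rmin_r (/ 2) (Rmin du dv)).
    pose proof (Rmin_l du dv). pose proof (Rmin_r du dv).
    repeat split; try lra. repeat apply Rmin_glb_lt; lra. }
  destruct hd as (d0 & dh & hddu & hddv).
  assert (d4 : 0 < d ^ 4) by (apply pow_lt; exact d0).
  (* The second entry makes the bound [14 * e2 / d ^ 4] of [tests_imply_far] at most eps/64. *)
  set (e2 := Rmin e1 (eps * d ^ 4 / 14 / 64)).
  assert (he2 : 0 < e2).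
  { apply Rmin_glb_lt; [exact he1|]. assert (0 < eps * d ^ 4) by (apply Rmult_lt_0_compat; lra). lra. }
  assert (he21 : e2 <= e1) by apply Rmin_l.
  assert (he2X : 14 * e2 / d ^ 4 <= eps / 64).
  { apply (Rmult_le_reg_r (d ^ 4)); [exact d4|]. unfold Rdiv at 1.
    rewrite Rmult_assoc, Rinv_l by lra. pose proof (Rmin_r e1 (eps * d ^ 4 / 14 / 64)).
    fold e2 in H. lra. }
  destruct (uniform_tests e2 he2) as (r1 & hr1 & T1).
  (* By [rho_half_boundary], a pair with rho <= 1/2 and one point in the disk of radius [r1] lies in
     the disk of radius [r2]. The radius [s] leaves room for Cauchy's estimate, whose constant is
     [K]. *)
  set (r2 := 1 - (1 - r1) / 8). set (s := (1 + r2) / 2).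
  set (K := 40 / (s - r2) ^ 2).
  assert (hs : r2 < s < 1) by (unfold s, r2; lra).
  assert (K0 : 0 < K) by (unfold K; apply Rdiv_lt_0_compat; [lra | apply pow_lt; lra]).
  (* Chosen so that q = K k, the size of f and its derivative on the disk of radius [r2], satisfies
     q (M + 1) = eps d/64. The factor d absorbs the 1/d of [jet_mixed]. *)
  set (k := eps * d / (64 * (M + 1)) / K).
  assert (hk : 0 < k).
  { unfold k. apply Rdiv_lt_0_compat; [|exact K0].
    apply Rdiv_lt_0_compat; [apply Rmult_lt_0_compat; lra | lra]. }
  set (q := K * k). assert (hq : q = eps * d / (64 * (M + 1))) by (unfold q, k; field; lra).
  assert (q0 : 0 < q) by (unfold q; apply Rmult_lt_0_compat; assumption).
  assert (hqM : q * (M + 1) = eps * d / 64) by (rewrite hq; field; lra).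
  exists s, k. split; [unfold s, r2 in *; lra|]. split; [exact hk|].
  intros f hf hfk z hz.
  pose proof (proj2 hphi z hz) as da. pose proof (proj2 hpsi z hz) as db.
  assert (Ta : r1 < Cmod (phi z) -> forall n m, In (n, m) [(0, 0); (0, 1); (0, 2); (1, 2)]%nat ->
    Cmod (op_jet u phi v psi z (test_fun n m (phi z) (psi z))) <= e2).
  { intros h n m hnm. apply T1; assumption. }
  assert (Tb : r1 < Cmod (psi z) -> forall n m, In (n, m) [(0, 0); (0, 1); (0, 2); (1, 2)]%nat ->
    Cmod (op_jet v psi u phi z (test_fun n m (psi z) (phi z))) <= e2).
  { intros h n m hnm. rewrite op_jet_swap, Cmod_opp. apply T1; assumption. }
  destruct (bounded_coefficients (phi z) (psi z) (hder u z) (hder v z)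
    (lift_coef u phi z) (lift_coef v psi z) da db M) as (kAB & kDE & kD & kE).
  { intros i j. apply hM; [apply unit_fun_mono; assumption | exact hz]. }
  { apply hAM, hz. } { apply hBM, hz. }
  pose proof (hAM z hz) as kA. pose proof (hBM z hz) as kB.
  pose proof (rho_sym (phi z) (psi z) da db) as rs.
  assert (cA := hdu z hz). assert (cB := hdv z hz).
  assert (Hsw : op_jet u phi v psi z f = (- op_jet v psi u phi z f)%C) by apply op_jet_swap.
  unfold op_jet in *.
  set (a := phi z) in *. set (b := psi z) in *.
  set (A := hder u z) in *. set (B := hder v z) in *.
  set (D := lift_coef u phi z) in *. set (E := lift_coef v psi z) in *.
  assert (r0 : 0 <= rho a b) by apply rho_nonneg.
  assert (r21 : r1 <= r2) by (unfold r2; lra).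
  assert (small : forall x y, Cmod x <= r2 -> Cmod y <= r2 ->
    Cmod (f x) <= q /\ Cmod (hder f x) <= q /\
    Cmod (f x - f y) <= q * rho x y /\ Cmod (hder f x - hder f y) <= q * rho x y).
  { intros x y hx hy.
    apply (small_disk_estimates f r2 s k x y); try assumption; try lra; apply hf. }
  assert (inner : Cmod a <= r2 -> Cmod b <= r2 -> Cmod (jet a b A B D E f) <= eps).
  { intros h h'. destruct (small a b h h') as (g1 & g2 & g3 & g4).
    eapply Rle_trans; [apply (jet_bound a b A B D E f q (rho a b)); assumption|].
    apply Rle_trans with (q * (32 * (M + 1))).
    - apply Rmult_le_compat_l; lra.
    - assert (eps * d <= eps * 1) by (apply Rmult_le_compat_l; lra). lra. }
  assert (mix : 8 * (14 * e2 / d ^ 4) + 2 * (8 * M) / d * q <= eps).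
  { replace (2 * (8 * M) / d * q) with (16 * (q * M / d)) by (field; lra).
    assert (q * M / d <= eps / 64).
    { apply (Rmult_le_reg_r d); [exact d0|]. unfold Rdiv at 1.
      rewrite Rmult_assoc, Rinv_l by lra. lra. }
    lra. }
  (* Both points near the circle: the tests at a and at b decide, split by rho < d. One point near:
     [inner] if rho < d, [jet_mixed] otherwise. None near: [inner]. *)
  destruct (Rlt_or_le r1 (Cmod a)) as [ha|ha]; destruct (Rlt_or_le r1 (Cmod b)) as [hb|hb].
  - specialize (Ta ha). specialize (Tb hb).
    pose proof (Ta 0 2 ltac:(simpl; tauto))%nat as a02. pose proof (Ta 1 2 ltac:(simpl; tauto))%nat as a12.
    pose proof (Tb 0 2 ltac:(simpl; tauto))%nat as b02. pose proof (Tb 1 2 ltac:(simpl; tauto))%nat as b12.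
    destruct (Rlt_or_le (rho a b) d) as [hr|hr].
    + specialize (cA ltac:(lra)). specialize (cB ltac:(lra)).
      assert (rE : rho a b * Cmod E <= 6 * e1).
      { rewrite rs. apply (tests_imply_rD b a B A E D db da e1);
          rewrite <- ?rs; lra. }
      destruct (tests_imply_near a b A B D E da db e1) as [nAB nDE]; try lra.
      { intros n m hnm. eapply Rle_trans; [apply Ta, hnm | exact he21]. }
      destruct (unit_fun_rho_lipschitz f a b hf da db) as [l1 l2].
      eapply Rle_trans.
      * apply (jet_bound a b A B D E f 600 (rho a b)); try assumption.
        -- pose proof (proj2 hf a da). lra.
        -- pose proof (unit_fun_hder f a hf da). lra.
      * unfold e1 in *. lra.
    + destruct (tests_imply_far a b A B D E da db e2 d) as [fA fD]; try assumption; try lra.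
      destruct (tests_imply_far b a B A E D db da e2 d) as [fB fE]; try assumption; try lra.
      eapply Rle_trans.
      * apply (jet_bound_crude a b A B D E f 4 4);
          try (apply unit_fun_hder; assumption);
          (eapply Rle_trans; [apply hf; assumption | lra]).
      * lra.
  - destruct (Rlt_or_le (rho a b) d) as [hr|hr].
    + apply inner; [|lra].
      apply (rho_half_boundary a b r1); try assumption; lra.
    + specialize (Ta ha). destruct (small b b ltac:(lra) ltac:(lra)) as (g1 & g2 & _).
      eapply Rle_trans; [|exact mix].
      apply (jet_mixed a b A B D E f e2 d (8 * M) q); try assumption; try lra; apply Ta; simpl; tauto.
  - destruct (Rlt_or_le (rho a b) d) as [hr|hr].
    + apply inner; [lra|].
      apply (rho_half_boundary b a r1); try assumption; lra.
    + specialize (Tb hb). destruct (small a a ltac:(lra) ltac:(lra)) as (g1 & g2 & _).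
      rewrite Hsw, Cmod_opp.
      eapply Rle_trans; [|exact mix].
      apply (jet_mixed b a B A E D f e2 d (8 * M) q); rewrite <- ?rs; try assumption; try lra; apply Tb; simpl; tauto.
  - apply inner; lra.
Qed.

End Sufficiency.

(** * From powers to the test functions *)

Lemma C_derive_ext_disk (f g : C -> C) (a : C) : disk a -> ex_cderive f a ->
  (forall w, disk w -> f w = g w) -> C_derive g a = C_derive f a.
Proof.
  unfold disk. intros ha hf E. apply (C_derive_ext_loc f g a (1 - Cmod a)); [lra | | exact hf].
  intros w hw. apply E. replace w with (w - a + a)%C by ring.
  eapply Rle_lt_trans; [apply Cmod_triangle|]. lra.
Qed.

Lemma jet_ext (a b A B D E : C) (f g : C -> C) : disk a -> disk b ->
  analytic_disk f -> (forall w, disk w -> f w = g w) ->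
  jet a b A B D E g = jet a b A B D E f.
Proof.
  intros ha hb hf Efg. unfold jet, hder.
  rewrite (C_derive_ext_disk f g a) by auto. rewrite (C_derive_ext_disk f g b) by auto.
  rewrite !Efg by assumption. reflexivity.
Qed.

Lemma analytic_mult (f g : C -> C) : analytic_disk f -> analytic_disk g ->
  analytic_disk (fun w => f w * g w)%C.
Proof. intros hf hg z hz. apply ex_cderive_mult; auto. Qed.

Lemma analytic_const (c : C) : analytic_disk (fun _ => c).
Proof. intros z hz. eexists. apply is_cderive_const. Qed.

Lemma analytic_pow (k : nat) : analytic_disk (fun w => Cpow w k).
Proof. intros z hz. apply (ex_cderive_pow (fun w => w)). eexists. apply is_cderive_id. Qed.

Lemma analytic_kernel (c : C) : disk c -> analytic_disk (fun w => / (1 - Cconj c * w))%C.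
Proof.
  intros hc z hz. eexists.
  apply (is_cderive_comp Cinv (fun w => 1 - Cconj c * w)%C).
  - apply is_cderive_inv, mobius_denom_neq; assumption.
  - apply is_cderive_minus; [apply is_cderive_const|].
    apply is_cderive_mult; [apply is_cderive_const | apply is_cderive_id].
Qed.

Lemma jet_scal (a b A B D E c : C) (f : C -> C) : disk a -> disk b -> analytic_disk f ->
  jet a b A B D E (fun z => c * f z)%C = (c * jet a b A B D E f)%C.
Proof.
  intros ha hb hf.
  assert (H : forall w, disk w -> hder (fun z => c * f z)%C w = (c * hder f w)%C).
  { intros w hw.
    pose proof (is_cderive_mult _ _ w _ _ (is_cderive_const c w)
      (C_derive_spec f w (hf w hw))) as H.
    etransitivity; [exact (hder_eq _ _ _ H)|]. unfold hder. ring. }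
  unfold jet. rewrite !H by assumption. ring.
Qed.

Lemma jet_combine (a b A B D E c d : C) (f g h : C -> C) : disk a -> disk b ->
  analytic_disk f -> analytic_disk g ->
  (forall w, disk w -> h w = (c * f w - d * g w)%C) ->
  jet a b A B D E h = (c * jet a b A B D E f - d * jet a b A B D E g)%C.
Proof.
  intros ha hb hf hg Eh.
  assert (hcf : analytic_disk (fun w => c * f w)%C)
    by (apply (analytic_mult (fun _ => c)); [apply analytic_const | exact hf]).
  rewrite (jet_ext a b A B D E (fun w => c * f w - d * g w)%C h); auto.
  - rewrite (jet_lin a b A B D E d (fun w => c * f w)%C g) by auto.
    rewrite jet_scal by assumption. reflexivity.
  - intros w hw. apply ex_cderive_minus; [apply hcf, hw|].
    apply (analytic_mult (fun _ => d)); [apply analytic_const | exact hg | exact hw].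
  - intros w hw. symmetry. apply Eh, hw.
Qed.

Lemma jet_bounded_scaled (a b A B D E : C) (M c : R) (f : C -> C) : disk a -> disk b ->
  (forall g, unit_fun g -> Cmod (jet a b A B D E g) <= M) -> 0 < c ->
  analytic_disk f -> (forall z, disk z -> Cmod (f z) <= c) ->
  Cmod (jet a b A B D E f) <= c * M.
Proof.
  intros ha hb hM hc hf hb1.
  assert (U : unit_fun (fun z => RtoC (/ c) * f z)%C).
  { split; [apply (analytic_mult (fun _ => RtoC (/ c))); [apply analytic_const | exact hf]|].
    intros z hz. rewrite Cmod_mult, Cmod_R, Rabs_pos_eq by (left; apply Rinv_0_lt_compat, hc).
    apply (Rmult_le_reg_l c); [exact hc|].
    rewrite <- Rmult_assoc, Rinv_r by lra. pose proof (hb1 z hz). lra. }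
  pose proof (hM _ U) as K. rewrite jet_scal in K by assumption.
  rewrite Cmod_mult, Cmod_R, Rabs_pos_eq in K by (left; apply Rinv_0_lt_compat, hc).
  apply (Rmult_le_compat_l c) in K; [|lra].
  rewrite <- Rmult_assoc, Rinv_r in K by lra. lra.
Qed.

(** Takes the place of summing a geometric series: after j steps the a priori bound [X] enters only
    with the factor x^j, which tends to 0. *)
Lemma geometric_majorant (H : nat -> R) (N : nat) (s x X : R) :
  0 <= x < 1 -> (forall k, (N <= k)%nat -> H k <= X) ->
  (forall k, (N <= k)%nat -> H k <= s + x * H (S k)) ->
  forall k, (N <= k)%nat -> H k <= s / (1 - x).
Proof.
  intros hx hX hstep.
  assert (I : forall j k, (N <= k)%nat -> H k <= s / (1 - x) + x ^ j * (X - s / (1 - x))).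
  { induction j as [|j IH]; intros k hk.
    - simpl. pose proof (hX k hk). lra.
    - eapply Rle_trans; [apply hstep, hk|]. specialize (IH (S k) ltac:(lia)).
      apply (Rmult_le_compat_l x) in IH; [|lra].
      replace (s / (1 - x) + x ^ S j * (X - s / (1 - x))) with
        (s + x * (s / (1 - x) + x ^ j * (X - s / (1 - x)))) by (simpl; field; lra).
      lra. }
  intros k hk.
  assert (L : is_lim_seq (fun j => s / (1 - x) + x ^ j * (X - s / (1 - x))) (s / (1 - x))).
  { replace (Finite (s / (1 - x))) with
      (Finite (s / (1 - x) + 0 * (X - s / (1 - x)))) by (f_equal; ring).
    apply is_lim_seq_plus'; [apply is_lim_seq_const|].
    apply is_lim_seq_mult'; [apply is_lim_seq_geom; rewrite Rabs_pos_eq; lra | apply is_lim_seq_const]. }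
  exact (is_lim_seq_le (fun _ => H k) _ (H k) _ (fun j => I j k hk) (is_lim_seq_const _) L).
Qed.

Section Tail.

Variables a b A B D E : C.
Hypothesis ha : disk a.
Hypothesis hb : disk b.
Variable M : R.
Hypothesis hM : forall g, unit_fun g -> Cmod (jet a b A B D E g) <= M.

(** Being small for all orders k >= N is a condition on f that survives multiplication by the kernel
    1/(1 - conj c w) and by sigma_c, with constants independent of N. This is how a bound on high
    powers reaches the test functions. *)
Let J (k : nat) (f : C -> C) : C := jet a b A B D E (fun w => Cpow w k * f w)%C.

Let kernel (c : C) (f : C -> C) (w : C) : C := (/ (1 - Cconj c * w) * f w)%C.

Let analytic_shift (k : nat) (f : C -> C) : analytic_disk f ->
  analytic_disk (fun w => Cpow w k * f w)%C.
Proof. intros hf. apply (analytic_mult (fun w => Cpow w k)); [apply analytic_pow | exact hf]. Qed.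

Let analytic_kernel_mult (c : C) (f : C -> C) : disk c -> analytic_disk f -> analytic_disk (kernel c f).
Proof. intros hc hf. apply (analytic_mult _ f (analytic_kernel c hc) hf). Qed.

Let J_kernel (k : nat) (c : C) (f : C -> C) : disk c -> analytic_disk f ->
  J k (kernel c f) = (J k f + Cconj c * J (S k) (kernel c f))%C.
Proof.
  intros hc hf.
  transitivity (RtoC 1 * J k f - (- Cconj c) * J (S k) (kernel c f))%C; [|ring].
  apply jet_combine; [exact ha | exact hb | | |].
  - apply (analytic_shift k f hf).
  - apply (analytic_shift (S k) (kernel c f)). apply analytic_kernel_mult; assumption.
  - intros w hw. unfold kernel. simpl. field. apply mobius_denom_neq; assumption.
Qed.

Let kernel_tail (c : C) (f : C -> C) (N : nat) (e : R) : disk c -> unit_fun f ->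
  (forall k, (N <= k)%nat -> Cmod (J k f) <= e) ->
  forall k, (N <= k)%nat -> Cmod (J k (kernel c f)) <= e / (1 - Cmod c).
Proof.
  intros hc [hf h1] ht.
  assert (c0 : 0 < 1 - Cmod c) by (unfold disk in hc; lra).
  apply (geometric_majorant (fun k => Cmod (J k (kernel c f))) N e (Cmod c) (/ (1 - Cmod c) * M)).
  - pose proof (Cmod_ge_0 c). lra.
  - intros k _. apply jet_bounded_scaled; [exact ha | exact hb | exact hM | | |].
    + apply Rinv_0_lt_compat, c0.
    + apply (analytic_shift k (kernel c f)). apply analytic_kernel_mult; assumption.
    + intros z hz. unfold kernel. rewrite !Cmod_mult, Cmod_pow.
      rewrite Cmod_inv by (apply mobius_denom_neq; assumption).
      pose proof (pow_le_1 (Cmod z) k) as P. unfold disk in hz.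
      pose proof (Cmod_ge_0 z) as z0. specialize (P ltac:(lra)).
      pose proof (h1 z hz) as f1. pose proof (Cmod_ge_0 (f z)) as f0.
      assert (Hi : / Cmod (1 - Cconj c * z) <= / (1 - Cmod c)).
      { apply Rinv_le_contravar; [exact c0|].
        pose proof (mobius_denom_ge c z). pose proof (Cmod_ge_0 c). nra. }
      assert (Hp : 0 < / Cmod (1 - Cconj c * z))
        by (apply Rinv_0_lt_compat, mobius_denom_pos; assumption).
      assert (0 <= Cmod z ^ k * Cmod (f z) <= 1) by nra.
      nra.
  - intros k hk. cbv beta. rewrite J_kernel by assumption.
    eapply Rle_trans; [apply Cmod_triangle|]. rewrite Cmod_mult, Cmod_conj.
    apply Rplus_le_compat_r, ht, hk.
Qed.

(** By sigma_c = c - (1 - |c|^2) w/(1 - conj c w), the factor is |c| + (1 + |c|) <= 3: the weight 1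
    - |c|^2 compensates the 1/(1 - |c|) of the kernel. *)
Let sigma_tail (c : C) (f : C -> C) (N : nat) (e : R) : disk c -> unit_fun f ->
  (forall k, (N <= k)%nat -> Cmod (J k f) <= e) ->
  forall k, (N <= k)%nat -> Cmod (J k (fun w => sigma c w * f w)%C) <= 3 * e.
Proof.
  intros hc hf ht k hk.
  assert (e0 : 0 <= e) by (eapply Rle_trans; [apply Cmod_ge_0 | apply (ht k hk)]).
  replace (J k (fun w => sigma c w * f w)%C) with
    (c * J k f - RtoC (1 - Cmod c ^ 2) * J (S k) (kernel c f))%C.
  - eapply Rle_trans; [apply Cmod_triangle_sub|]. rewrite !Cmod_mult, Cmod_R.
    pose proof (Cmod_lt_1_sqr c hc). rewrite Rabs_pos_eq by lra.
    pose proof (ht k hk) as t1.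
    pose proof (kernel_tail c f N e hc hf ht (S k) ltac:(lia)) as t2.
    unfold disk in hc. pose proof (Cmod_ge_0 c) as c0.
    assert (Cmod c * Cmod (J k f) <= 1 * e)
      by (apply Rmult_le_compat; try apply Cmod_ge_0; lra).
    assert ((1 - Cmod c ^ 2) * Cmod (J (S k) (kernel c f)) <= (1 - Cmod c ^ 2) * (e / (1 - Cmod c)))
      by (apply Rmult_le_compat_l; lra).
    replace ((1 - Cmod c ^ 2) * (e / (1 - Cmod c))) with ((1 + Cmod c) * e) in H1 by (field; lra).
    assert ((1 + Cmod c) * e <= 2 * e) by (apply Rmult_le_compat_r; lra).
    lra.
  - symmetry. apply jet_combine; [exact ha | exact hb | | |].
    + apply (analytic_shift k f), hf.
    + apply (analytic_shift (S k) (kernel c f)). apply analytic_kernel_mult; [exact hc | apply hf].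
    + intros w hw. unfold kernel, sigma. rewrite RtoC_minus, Cmod_sqr_expand. simpl.
      field. apply mobius_denom_neq; assumption.
Qed.

Let unit_fun_sigma_mult (c : C) (f : C -> C) : disk c -> unit_fun f ->
  unit_fun (fun w => sigma c w * f w)%C.
Proof.
  intros hc [hf h1]. split; [apply (analytic_mult _ f (analytic_sigma c hc) hf)|].
  intros z hz. rewrite Cmod_mult.
  pose proof (Cmod_sigma_le_1 c z hc hz). pose proof (h1 z hz).
  pose proof (Cmod_ge_0 (sigma c z)). pose proof (Cmod_ge_0 (f z)). nra.
Qed.

Let sigma_pow_tail (c : C) (m : nat) (f : C -> C) (N : nat) (e : R) : disk c -> unit_fun f ->
  (forall k, (N <= k)%nat -> Cmod (J k f) <= e) ->
  unit_fun (fun w => Cpow (sigma c w) m * f w)%C /\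
  forall k, (N <= k)%nat -> Cmod (J k (fun w => Cpow (sigma c w) m * f w)%C) <= 3 ^ m * e.
Proof.
  intros hc hf ht. induction m as [|m [IH1 IH2]].
  - simpl. replace (fun w => 1 * f w)%C with f.
    + rewrite Rmult_1_l. auto.
    + apply FunctionalExtensionality.functional_extensionality. intros; ring.
  - replace (fun w => Cpow (sigma c w) (S m) * f w)%C with
      (fun w => sigma c w * (Cpow (sigma c w) m * f w))%C.
    + split; [apply (unit_fun_sigma_mult c (fun w => Cpow (sigma c w) m * f w)%C); assumption|].
      simpl (3 ^ S m). rewrite Rmult_assoc.
      apply (sigma_tail c (fun w => Cpow (sigma c w) m * f w)%C); assumption.
    + apply FunctionalExtensionality.functional_extensionality. intros; simpl; ring.
Qed.

Let mono_tail (n m : nat) (c d : C) (N : nat) (e : R) : disk c -> disk d ->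
  (forall k, (N <= k)%nat -> Cmod (jet a b A B D E (fun w => Cpow w k)) <= e) ->
  forall k, (N <= k)%nat -> Cmod (J k (mono n m c d)) <= 3 ^ n * (3 ^ m * e).
Proof.
  intros hc hd ht.
  assert (U1 : unit_fun (fun _ => RtoC 1)).
  { split; [apply analytic_const|]. intros. rewrite Cmod_1. lra. }
  assert (T1 : forall k, (N <= k)%nat -> Cmod (J k (fun _ => RtoC 1)) <= e).
  { intros k hk. unfold J. replace (fun w => Cpow w k * RtoC 1)%C with (fun w => Cpow w k).
    - apply ht, hk.
    - apply FunctionalExtensionality.functional_extensionality. intros; ring. }
  destruct (sigma_pow_tail d m _ N e hd U1 T1) as [U2 T2].
  destruct (sigma_pow_tail c n _ N _ hc U2 T2) as [_ T3].
  replace (mono n m c d) with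
    (fun w => Cpow (sigma c w) n * (Cpow (sigma d w) m * 1))%C; [exact T3|].
  apply FunctionalExtensionality.functional_extensionality. intros; unfold mono; ring.
Qed.

(* [sigma_c - c = - (1 - |c|^2) w / (1 - conj c w)], and the Taylor coefficients
   of the right-hand side have total mass at most 2, vanishing at each fixed order
   as [|c| -> 1]. *)
Lemma jet_test_from_powers (n m : nat) (c d : C) (N : nat) (e : R) : disk c -> disk d ->
  (forall k, (N <= k)%nat -> Cmod (jet a b A B D E (fun w => Cpow w k)) <= e) ->
  Cmod (jet a b A B D E (test_fun n m c d)) <=
    2 * (1 - Cmod c) * (INR N * (3 ^ n * (3 ^ m * M))) + 2 * (3 ^ n * (3 ^ m * e)).
Proof.
  intros hc hd ht.
  assert (UP : forall k, unit_fun (fun w => Cpow w k)).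
  { intros k. split; [apply analytic_pow|]. intros z hz. rewrite Cmod_pow.
    apply pow_le_1. unfold disk in hz. pose proof (Cmod_ge_0 z). lra. }
  (* Two bounds on the same sequence: [t0] holds at every order but is only of size M, [tN] is small
     but starts at order N. *)
  pose proof (mono_tail n m c d 0 M hc hd (fun k _ => hM _ (UP k))) as t0.
  pose proof (mono_tail n m c d N e hc hd ht) as tN.
  set (g := mono n m c d) in *. set (c0 := 3 ^ n * (3 ^ m * M)) in *.
  set (e0 := 3 ^ n * (3 ^ m * e)) in *.
  assert (hg : unit_fun g) by (apply unit_fun_mono; assumption).
  assert (hc1 : 0 < 1 - Cmod c) by (unfold disk in hc; lra).
  (* The kernel recursion is unrolled j times, each step costing one crude bound [c0]. After N steps
     the small tail bound takes over. *)
  assert (I : forall j, Cmod (J 1 (kernel c g)) <= INR j * c0 + Cmod (J (S j) (kernel c g))).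
  { induction j as [|j IH]; [simpl; lra|].
    eapply Rle_trans; [exact IH|]. rewrite (J_kernel (S j)) by (assumption || apply hg).
    rewrite S_INR.
    assert (Cmod (J (S j) g + Cconj c * J (S (S j)) (kernel c g)) <=
      c0 + 1 * Cmod (J (S (S j)) (kernel c g))).
    { eapply Rle_trans; [apply Cmod_triangle|]. rewrite Cmod_mult, Cmod_conj.
      apply Rplus_le_compat; [apply t0; lia|].
      apply Rmult_le_compat_r; [apply Cmod_ge_0 | lra]. }
    lra. }
  pose proof (I N) as IN.
  pose proof (kernel_tail c g N e0 hc hg tN (S N) ltac:(lia)) as kN.
  (* The term with coefficient 0 only brings the expression into the shape of [jet_combine]. *)
  replace (jet a b A B D E (test_fun n m c d)) with
    (RtoC 0 * J 0 g - RtoC (1 - Cmod c ^ 2) * J 1 (kernel c g))%C.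
  - replace (RtoC 0 * J 0 g - RtoC (1 - Cmod c ^ 2) * J 1 (kernel c g))%C with
      (- (RtoC (1 - Cmod c ^ 2) * J 1 (kernel c g)))%C by ring.
    rewrite Cmod_opp, Cmod_mult, Cmod_R.
    pose proof (Cmod_lt_1_sqr c hc). rewrite Rabs_pos_eq by lra.
    assert (K1 : Cmod (J 1 (kernel c g)) <= INR N * c0 + e0 / (1 - Cmod c)) by lra.
    pose proof (Cmod_ge_0 c). pose proof (Cmod_ge_0 (J 1 (kernel c g))).
    assert (K2 : 1 - Cmod c ^ 2 <= 2 * (1 - Cmod c)).
    { pose proof (pow2_ge_0 (1 - Cmod c)). lra. }
    apply Rle_trans with (2 * (1 - Cmod c) * (INR N * c0 + e0 / (1 - Cmod c))).
    + apply Rmult_le_compat; lra.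
    + right. field. lra.
  - symmetry. apply jet_combine; [exact ha | exact hb | | |].
    + apply (analytic_shift 0 g), hg.
    + apply (analytic_shift 1 (kernel c g)). apply analytic_kernel_mult; [exact hc | apply hg].
    + intros w hw. unfold test_fun, g, mono, kernel.
      assert (Es : Cpow (sigma c w) (n + 1) = (Cpow (sigma c w) n * sigma c w)%C)
        by (rewrite Cpow_add_r, Cpow_1_r; reflexivity).
      rewrite Es. unfold sigma at 2. rewrite RtoC_minus, Cmod_sqr_expand. simpl.
      field. apply mobius_denom_neq; assumption.
Qed.

End Tail.

(** * Norms and suprema *)

Lemma sup_disk_le (g : C -> Rbar) (c : Rbar) :
  (forall z, disk z -> Rbar_le (g z) c) -> Rbar_le (sup_disk g) c.
Proof.
  intros H. unfold sup_disk, Rbar_lub. destruct (Rbar_ex_lub _) as [l [h1 h2]]. simpl.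
  apply h2. intros x (z & hz & ->). apply H, hz.
Qed.

Lemma sup_disk_ge (g : C -> Rbar) (z : C) : disk z -> Rbar_le (g z) (sup_disk g).
Proof.
  intros hz. unfold sup_disk, Rbar_lub. destruct (Rbar_ex_lub _) as [l [h1 h2]]. simpl.
  apply h1. exists z. auto.
Qed.

Lemma disk_0 : disk (RtoC 0).
Proof. unfold disk. rewrite Cmod_0. lra. Qed.

Lemma sup_disk_nonneg (g : C -> R) : (forall z, disk z -> 0 <= g z) ->
  Rbar_le 0 (sup_disk (fun z => Finite (g z))).
Proof.
  intros H. eapply Rbar_le_trans; [|apply (sup_disk_ge _ (RtoC 0) disk_0)].
  simpl. apply H, disk_0.
Qed.

Lemma bloch_seminorm_le (f : C -> C) (c : R) :
  Rbar_le (bloch_seminorm f) c <-> forall z, disk z -> Cmod (hder f z) <= c.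
Proof.
  split.
  - intros H z hz. rewrite Cmod_hder by exact hz.
    apply (Rbar_le_trans (Finite _) _ (Finite c)
      (sup_disk_ge (fun z => Finite ((1 - Cmod z ^ 2) * Cmod (C_derive f z))) z hz) H).
  - intros H. apply sup_disk_le. intros z hz. simpl.
    pose proof (H z hz) as K. rewrite Cmod_hder in K by exact hz. exact K.
Qed.

Lemma bloch_seminorm_nonneg (f : C -> C) : Rbar_le 0 (bloch_seminorm f).
Proof.
  apply sup_disk_nonneg. intros z hz. apply Rmult_le_pos; [|apply Cmod_ge_0].
  left. apply Cmod_lt_1_sqr, hz.
Qed.

(** Pointwise bounds pass to a supremum as weak inequalities; halving [eps] restores the strict
    one. *)
Lemma Rbar_abs_lt_of_le (x : Rbar) (eps : posreal) :
  Rbar_le 0 x -> Rbar_le x (eps / 2) -> Rbar_lt (Rbar_abs x) eps.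
Proof.
  destruct x as [x| |]; simpl; try tauto.
  intros h0 h1. pose proof (cond_pos eps). rewrite Rabs_pos_eq by exact h0. lra.
Qed.

Lemma Rbar_le_of_abs_lt (x : Rbar) (eps : posreal) :
  Rbar_lt (Rbar_abs x) eps -> Rbar_le x eps.
Proof.
  destruct x as [x| |]; simpl; try tauto.
  intros h. pose proof (Rle_abs x). lra.
Qed.

(** * The Bloch distance as a pointwise inequality *)

Lemma analytic_minus (f g : C -> C) : analytic_disk f -> analytic_disk g ->
  analytic_disk (fun z => f z - g z)%C.
Proof. intros hf hg z hz. apply ex_cderive_minus; auto. Qed.

Lemma hder_minus (f g : C -> C) (z : C) : ex_cderive f z -> ex_cderive g z ->
  hder (fun w => f w - g w)%C z = (hder f z - hder g z)%C.
Proof.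
  intros hf hg.
  pose proof (is_cderive_minus f g z _ _ (C_derive_spec f z hf) (C_derive_spec g z hg)) as H.
  etransitivity; [exact (hder_eq _ _ _ H)|]. unfold hder. ring.
Qed.

(** For analytic functions: Bloch distance at most [c], stated without extended reals, so that
    triangle inequalities become linear arithmetic. *)
Definition near (f g : C -> C) (c : R) : Prop :=
  forall z, disk z -> Cmod (f (RtoC 0) - g (RtoC 0)) + Cmod (hder f z - hder g z) <= c.

Lemma near_sym (f g : C -> C) (c : R) : near f g c -> near g f c.
Proof.
  intros H z hz. rewrite (Cmod_sub_sym (g _)), (Cmod_sub_sym (hder g z)). apply H, hz.
Qed.

Lemma near_trans (f g h : C -> C) (c d : R) : near f g c -> near g h d -> near f h (c + d).
Proof.
  intros H1 H2 z hz. specialize (H1 z hz). specialize (H2 z hz).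
  pose proof (Cmod_triangle (f (RtoC 0) - g (RtoC 0)) (g (RtoC 0) - h (RtoC 0))) as t1.
  pose proof (Cmod_triangle (hder f z - hder g z) (hder g z - hder h z)) as t2.
  replace (f (RtoC 0) - g (RtoC 0) + (g (RtoC 0) - h (RtoC 0)))%C with
    (f (RtoC 0) - h (RtoC 0))%C in t1 by ring.
  replace (hder f z - hder g z + (hder g z - hder h z))%C with
    (hder f z - hder h z)%C in t2 by ring. lra.
Qed.

Lemma near_refl (f : C -> C) (c : R) : 0 <= c -> near f f c.
Proof.
  intros hc z hz. replace (f (RtoC 0) - f (RtoC 0))%C with (RtoC 0) by ring.
  replace (hder f z - hder f z)%C with (RtoC 0) by ring. rewrite Cmod_0. lra.
Qed.

Lemma near_weaken (f g : C -> C) (c d : R) : near f g c -> c <= d -> near f g d.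
Proof. intros H h z hz. specialize (H z hz). lra. Qed.

(** The intermediate [c] keeps the inequality strict after the supremum is taken. *)
Lemma bloch_norm_lt (f : C -> C) (r : R) :
  Rbar_lt (bloch_norm f) r <->
  exists c, c < r /\ forall z, disk z -> Cmod (f (RtoC 0)) + Cmod (hder f z) <= c.
Proof.
  unfold bloch_norm. pose proof (bloch_seminorm_nonneg f) as h0.
  pose proof (bloch_seminorm_le f) as hle.
  destruct (bloch_seminorm f) as [x| |]; simpl in h0.
  - split.
    + intros H. exists (Cmod (f (RtoC 0)) + x). split; [exact H|].
      intros z hz. apply Rplus_le_compat_l. apply (proj1 (hle x)); [apply Rle_refl | exact hz].
    + intros (c & hc & H). simpl.
      assert (K : x <= c - Cmod (f (RtoC 0))).
      { apply (proj2 (hle _)). intros z hz. specialize (H z hz). lra. }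
      lra.
  - split; [simpl; tauto|]. intros (c & hc & H). exfalso.
    apply (proj2 (hle (c - Cmod (f (RtoC 0))))). intros z hz. specialize (H z hz). lra.
  - tauto.
Qed.

Lemma bloch_dist_lt (f g : C -> C) (r : R) : analytic_disk f -> analytic_disk g ->
  (Rbar_lt (bloch_dist f g) r <-> exists c, c < r /\ near f g c).
Proof.
  intros hf hg. unfold bloch_dist. rewrite bloch_norm_lt.
  split; intros (c & hc & H); exists c; (split; [exact hc|]); intros z hz;
    specialize (H z hz); rewrite hder_minus in * by auto; exact H.
Qed.

Lemma bloch_intro (f : C -> C) (c : R) : analytic_disk f ->
  (forall z, disk z -> Cmod (hder f z) <= c) -> bloch f.
Proof.
  intros hf H. split; [exact hf|].
  apply (Rbar_le_lt_trans _ (Finite c)); [apply bloch_seminorm_le, H | exact I].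
Qed.

Lemma bloch_bound (f : C -> C) : bloch f ->
  exists c, forall z, disk z -> Cmod (hder f z) <= c.
Proof.
  intros [_ H]. pose proof (bloch_seminorm_le f) as hle. pose proof (bloch_seminorm_nonneg f) as h0.
  destruct (bloch_seminorm f) as [x| |]; simpl in H, h0; try tauto.
  exists x. apply hle. apply Rle_refl.
Qed.

Lemma unit_fun_Hinf (f : C -> C) : unit_fun f -> Hinf f /\ Rbar_le (Hinf_norm f) 1.
Proof.
  intros [hf h1].
  assert (H : Rbar_le (Hinf_norm f) 1) by (apply sup_disk_le; intros z hz; apply h1, hz).
  split; [split; [exact hf|] | exact H].
  apply (Rbar_le_lt_trans _ 1); [exact H | exact I].
Qed.

Lemma Hinf_unit_fun (f : C -> C) : Hinf f -> Rbar_le (Hinf_norm f) 1 -> unit_fun f.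
Proof.
  intros [hf _] H. split; [exact hf|]. intros z hz.
  apply (Rbar_le_trans (Finite _) _ (Finite 1)
    (sup_disk_ge (fun z => Finite (Cmod (f z))) z hz) H).
Qed.

Lemma bounded_operator_unit (T : (C -> C) -> C -> C) : bounded_Hinf_bloch T ->
  exists M, 0 <= M /\ forall f z, unit_fun f -> disk z -> Cmod (hder (T f) z) <= M.
Proof.
  intros [_ [M HM]]. exists (Rmax M 0). split; [apply Rmax_r|].
  intros f z hf hz. destruct (unit_fun_Hinf f hf) as [hH h1].
  specialize (HM f hH).
  assert (h0 : Rbar_le 0 (Hinf_norm f))
    by (apply sup_disk_nonneg; intros; apply Cmod_ge_0).
  destruct (Hinf_norm f) as [x| |]; simpl in h0, h1; try tauto.
  change (Rbar_le (bloch_norm (T f)) (Finite (M * x))) in HM.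
  assert (hm : M * x <= Rmax M 0).
  { pose proof (Rmax_l M 0). pose proof (Rmax_r M 0).
    apply Rle_trans with (Rmax M 0 * x); [apply Rmult_le_compat_r|]; nra. }
  apply le_epsilon. intros e he.
  assert (L : Rbar_lt (bloch_norm (T f)) (Rmax M 0 + e)).
  { apply (Rbar_le_lt_trans _ (Finite (M * x))); [exact HM|]. simpl. lra. }
  apply bloch_norm_lt in L. destruct L as (c & hc & H). specialize (H z hz).
  pose proof (Cmod_ge_0 (T f (RtoC 0))). lra.
Qed.

(** Otherwise each n admits a point with r < 1/(n + 1) and G > e, and a sequence of such points
    contradicts the sequential limit. *)
Lemma tends_to_0_as_rho_eps (r G : C -> R) : (forall z, 0 <= r z) ->
  tends_to_0_as_rho_to_0 r G -> forall e, 0 < e -> exists d, 0 < d /\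
  forall z, disk z -> r z < d -> G z <= e.
Proof.
  intros r0 H e he. apply NNPP. intros N.
  assert (K : forall n : nat, exists z, disk z /\ r z < / (INR n + 1) /\ e < G z).
  { intros n. apply NNPP. intros N'. apply N. exists (/ (INR n + 1)).
    pose proof (pos_INR n). split; [apply Rinv_0_lt_compat; lra|].
    intros z hz hr. destruct (Rle_or_lt (G z) e) as [h|h]; [exact h|].
    exfalso. apply N'. exists z. auto. }
  set (s n := proj1_sig (constructive_indefinite_description _ (K n))).
  assert (hs : forall n, disk (s n) /\ r (s n) < / (INR n + 1) /\ e < G (s n)).
  { intros n. unfold s. apply proj2_sig. }
  assert (L : is_lim_seq (fun n => r (s n)) 0).
  { apply (is_lim_seq_le_le (fun _ => 0) _ (fun n => / (INR n + 1))).
    - intros n. split; [apply r0 | left; apply hs].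
    - apply is_lim_seq_const.
    - apply is_lim_seq_ext with (fun n => / INR (S n)); [intros; rewrite S_INR; reflexivity|].
      apply -> (is_lim_seq_incr_1 (fun n => / INR n) 0).
      replace (Finite 0) with (Rbar_inv p_infty) by reflexivity.
      apply is_lim_seq_inv; [apply is_lim_seq_INR | discriminate]. }
  specialize (H s (fun n => proj1 (hs n)) L).
  assert (e <= 0).
  { exact (is_lim_seq_le (fun _ => e) _ e 0 (fun n => Rlt_le _ _ (proj2 (proj2 (hs n))))
      (is_lim_seq_const e) H). }
  lra.
Qed.

Lemma sup_disk_finite_bound (g : C -> R) : (forall z, disk z -> 0 <= g z) ->
  Rbar_lt (sup_disk (fun z => Finite (g z))) p_infty ->
  exists M, forall z, disk z -> g z <= M.
Proof.
  intros g0 H. pose proof (sup_disk_nonneg g g0) as h0.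
  pose proof (sup_disk_ge (fun z => Finite (g z))) as hge.
  destruct (sup_disk (fun z => Finite (g z))) as [x| |]; simpl in *; try tauto.
  exists x. exact hge.
Qed.

(** * Compactness in the Bloch space *)

Lemma C_cauchy_limit (x : nat -> C) (c : R) :
  (forall n m, (n <= m)%nat -> Cmod (x n - x m) <= c * (/ 2) ^ n) ->
  exists l, forall n, Cmod (x n - l) <= c * (/ 2) ^ n.
Proof.
  intros H.
  assert (half0 : is_lim_seq (fun n => c * (/ 2) ^ n) 0).
  { replace (Finite 0) with (Rbar_mult c 0) by (simpl; f_equal; ring).
    apply is_lim_seq_scal_l, is_lim_seq_geom. rewrite Rabs_pos_eq; lra. }
  assert (G : forall g : C -> R, (forall z w, Rabs (g z - g w) <= Cmod (z - w)) ->
    exists l : R, is_lim_seq (fun n => g (x n)) l).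
  { intros g hg.
    assert (ex : ex_finite_lim_seq (fun n => g (x n))).
    { apply ex_lim_seq_cauchy_corr. intros eps.
      destruct (proj2 (is_lim_seq_spec _ _) half0 eps) as [N hN].
      exists N. intros n m hn hm.
      assert (K : forall n m, (N <= n)%nat -> (n <= m)%nat -> Rabs (g (x n) - g (x m)) < eps).
      { intros i j hi hij. eapply Rle_lt_trans; [apply hg|].
        eapply Rle_lt_trans; [apply H, hij|].
        specialize (hN i hi). rewrite Rminus_0_r in hN. pose proof (Rle_abs (c * (/ 2) ^ i)). lra. }
      destruct (Nat.le_ge_cases n m) as [h|h]; [apply K; assumption|].
      rewrite Rabs_minus_sym. apply K; assumption. }
    destruct ex as [l hl]. exists l. exact hl. }
  destruct (G Re) as [lr hr].
  { intros z w. apply (re_le_Cmod (z - w)%C). }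
  destruct (G Im) as [li hi].
  { intros z w. eapply Rle_trans; [apply Rmax_r | apply (Rmax_Cmod (z - w)%C)]. }
  exists (lr, li). intros n. apply le_epsilon. intros e he.
  assert (he2 : 0 < e / 2) by lra.
  destruct (proj2 (is_lim_seq_spec _ _) hr (mkposreal _ he2)) as [N1 h1].
  destruct (proj2 (is_lim_seq_spec _ _) hi (mkposreal _ he2)) as [N2 h2].
  set (m := (n + N1 + N2)%nat).
  specialize (h1 m ltac:(unfold m; lia)). specialize (h2 m ltac:(unfold m; lia)). cbn [pos] in h1, h2.
  replace (x n - (lr, li))%C with ((x n - x m) + (x m - (lr, li)))%C by ring.
  eapply Rle_trans; [apply Cmod_triangle|].
  apply Rplus_le_compat; [apply H; unfold m; lia|].
  eapply Rle_trans; [apply Cmod_le_sqrt2_Rmax|].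
  change (fst (x m - (lr, li))%C) with (Re (x m) - lr).
  change (snd (x m - (lr, li))%C) with (Im (x m) - li).
  assert (Rmax (Rabs (Re (x m) - lr)) (Rabs (Im (x m) - li)) < e / 2)
    by (apply Rmax_lub_lt; assumption). lra.
Qed.

Lemma near_C_derive (f g : C -> C) (c : R) (z : C) : near f g c -> disk z ->
  Cmod (C_derive f z - C_derive g z) <= c / (1 - Cmod z ^ 2).
Proof.
  intros H hz. specialize (H z hz). pose proof (Cmod_lt_1_sqr z hz) as hp.
  unfold hder in H.
  replace (RtoC (1 - Cmod z ^ 2) * C_derive f z - RtoC (1 - Cmod z ^ 2) * C_derive g z)%C
    with (RtoC (1 - Cmod z ^ 2) * (C_derive f z - C_derive g z))%C in H by ring.
  rewrite Cmod_mult, Cmod_R, Rabs_pos_eq in H by lra.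
  pose proof (Cmod_ge_0 (f (RtoC 0) - g (RtoC 0))).
  apply (Rmult_le_reg_l (1 - Cmod z ^ 2)); [exact hp|].
  replace ((1 - Cmod z ^ 2) * (c / (1 - Cmod z ^ 2))) with c by (field; lra). lra.
Qed.

Lemma near_increment (f g : C -> C) (c s : R) (z w : C) :
  analytic_disk f -> analytic_disk g -> near f g c ->
  0 <= s < 1 -> Cmod z <= s -> Cmod w <= s ->
  Cmod ((f w - g w) - (f z - g z)) <= c / (1 - s ^ 2) * Cmod (w - z).
Proof.
  intros hf hg H hs hz hw.
  apply (Cmod_mean_value (fun w => f w - g w)%C z w). intros t ht.
  set (p := (z + RtoC t * (w - z))%C).
  assert (hp : Cmod p <= s).
  { replace p with (p - RtoC 0)%C by ring. unfold p.
    apply segment_in_ball; rewrite ?Cmod_sub_0; assumption. }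
  assert (dp : disk p) by (unfold disk; lra).
  eexists. split.
  - apply is_cderive_minus; apply C_derive_spec; [apply hf | apply hg]; exact dp.
  - eapply Rle_trans; [apply (near_C_derive f g c p H dp)|].
    assert (c0 : 0 <= c).
    { specialize (H p dp). pose proof (Cmod_ge_0 (f (RtoC 0) - g (RtoC 0))).
      pose proof (Cmod_ge_0 (hder f p - hder g p)). lra. }
    pose proof (Cmod_ge_0 p). apply Rmult_le_compat_l; [exact c0|].
    apply Rinv_le_contravar; nra.
Qed.

(** Values and derivatives converge pointwise, to f and g. That g is the derivative of f follows by
    an eps/3 argument, as the increments of x n - f are controlled uniformly on smaller disks. *)
Lemma bloch_complete (x : nat -> C -> C) :
  (forall n, analytic_disk (x n)) ->
  (forall n m, (n <= m)%nat -> near (x n) (x m) ((/ 2) ^ n)) ->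
  exists f, analytic_disk f /\ forall n, near (x n) f ((/ 2) ^ n).
Proof.
  intros ha H.
  assert (pos2 : forall n, 0 <= (/ 2) ^ n) by (intros; apply pow_le; lra).
  (* The 1 accounts for the values at 0, the quotient for the increment along the radius from 0 to
     z. *)
  set (cst z := 1 + 1 / (1 - Cmod z ^ 2)).
  assert (V : forall z, exists l, disk z -> forall n, Cmod (x n z - l) <= cst z * (/ 2) ^ n).
  { intros z. destruct (classic (disk z)) as [hz|hz]; [|exists (RtoC 0); tauto].
    destruct (C_cauchy_limit (fun n => x n z) (cst z)) as [l hl]; [|exists l; auto].
    intros n m hnm.
    pose proof (near_increment _ _ _ (Cmod z) (RtoC 0) z (ha n) (ha m) (H n m hnm)
      ltac:(unfold disk in hz; pose proof (Cmod_ge_0 z); lra)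
      ltac:(rewrite Cmod_0; apply Cmod_ge_0) (Rle_refl _)) as K.
    rewrite Cmod_sub_0 in K.
    pose proof (H n m hnm z hz) as N. pose proof (Cmod_ge_0 (hder (x n) z - hder (x m) z)).
    replace (x n z - x m z)%C with ((x n z - x m z - (x n (RtoC 0) - x m (RtoC 0))) +
      (x n (RtoC 0) - x m (RtoC 0)))%C by ring.
    eapply Rle_trans; [apply Cmod_triangle|].
    pose proof (Cmod_lt_1_sqr z hz) as hp. unfold disk in hz. pose proof (Cmod_ge_0 z).
    assert ((/ 2) ^ n / (1 - Cmod z ^ 2) * Cmod z <= (/ 2) ^ n / (1 - Cmod z ^ 2) * 1).
    { apply Rmult_le_compat_l; [|lra]. apply Rdiv_le_0_compat; [apply pos2 | exact hp]. }
    unfold cst.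
    replace ((1 + 1 / (1 - Cmod z ^ 2)) * (/ 2) ^ n) with
      ((/ 2) ^ n / (1 - Cmod z ^ 2) * 1 + (/ 2) ^ n) by (field; lra).
    lra. }
  assert (W : forall z, exists l, disk z -> forall n,
    Cmod (C_derive (x n) z - l) <= 1 / (1 - Cmod z ^ 2) * (/ 2) ^ n).
  { intros z. destruct (classic (disk z)) as [hz|hz]; [|exists (RtoC 0); tauto].
    destruct (C_cauchy_limit (fun n => C_derive (x n) z) (1 / (1 - Cmod z ^ 2))) as [l hl];
      [|exists l; auto].
    intros n m hnm. eapply Rle_trans; [apply (near_C_derive _ _ _ z (H n m hnm) hz)|].
    right. unfold Rdiv. ring. }
  set (f z := proj1_sig (constructive_indefinite_description _ (V z))).
  set (g z := proj1_sig (constructive_indefinite_description _ (W z))).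
  assert (hf : forall z, disk z -> forall n, Cmod (x n z - f z) <= cst z * (/ 2) ^ n).
  { intros z. unfold f. apply proj2_sig. }
  assert (hg : forall z, disk z -> forall n,
    Cmod (C_derive (x n) z - g z) <= 1 / (1 - Cmod z ^ 2) * (/ 2) ^ n).
  { intros z. unfold g. apply proj2_sig. }
  assert (small : forall c e, 0 <= c -> 0 < e -> exists N, forall n, (N <= n)%nat -> c * (/ 2) ^ n < e).
  { intros c e hc he.
    destruct (pow_lt_1_zero (/ 2) ltac:(rewrite Rabs_pos_eq; lra) (e / (c + 1))) as [N hN].
    { apply Rdiv_lt_0_compat; lra. }
    exists N. intros n hn. specialize (hN n hn). rewrite Rabs_pos_eq in hN by apply pos2.
    apply (Rmult_lt_compat_l (c + 1)) in hN; [|lra].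
    replace ((c + 1) * (e / (c + 1))) with e in hN by (field; lra).
    pose proof (pos2 n). lra. }
  assert (cst0 : forall z, disk z -> 0 <= cst z).
  { intros z hz. pose proof (Cmod_lt_1_sqr z hz). unfold cst.
    assert (0 <= 1 / (1 - Cmod z ^ 2)) by (apply Rdiv_le_0_compat; lra). lra. }
  assert (hd : forall z, disk z -> is_cderive f z (g z)).
  { intros z hz. apply is_cderive_iff. intros eps.
    set (s := (1 + Cmod z) / 2).
    assert (hs : 0 <= s < 1 /\ Cmod z < s)
      by (unfold s, disk in *; pose proof (Cmod_ge_0 z); lra).
    destruct hs as [hs hzs].
    set (c := 1 / (1 - s ^ 2)).
    assert (s2 : 0 < 1 - s ^ 2) by nra.
    assert (c0 : 0 <= c) by (unfold c; apply Rdiv_le_0_compat; lra).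
    assert (e3 : 0 < eps / 3) by (pose proof (cond_pos eps); lra).
    destruct (small c (eps / 3) c0 e3) as [N hN]. specialize (hN N (le_n N)).
    pose proof (C_derive_spec (x N) z (ha N z hz)) as dN.
    rewrite is_cderive_iff in dN. destruct (dN (mkposreal _ e3)) as [d hd]. cbn [pos] in hd.
    assert (hdel : 0 < Rmin d (s - Cmod z)) by (apply Rmin_glb_lt; [apply d | lra]).
    exists (mkposreal _ hdel). cbn [pos]. intros w hw.
    assert (hw1 : Cmod (w - z) < d) by (eapply Rlt_le_trans; [exact hw | apply Rmin_l]).
    assert (hw2 : Cmod (w - z) < s - Cmod z) by (eapply Rlt_le_trans; [exact hw | apply Rmin_r]).
    assert (hws : Cmod w <= s).
    { replace w with (w - z + z)%C by ring. eapply Rle_trans; [apply Cmod_triangle|]. lra. }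
    assert (dw : disk w) by (unfold disk; lra).
    (* [near_increment] for the pair x N, x k, with k sent to infinity. *)
    assert (I1 : Cmod ((x N w - f w) - (x N z - f z)) <= c * (/ 2) ^ N * Cmod (w - z)).
    { apply le_epsilon. intros e he.
      destruct (small (cst w + cst z) e) as [m hm].
      { pose proof (cst0 w dw). pose proof (cst0 z hz). lra. } { exact he. }
      set (k := (N + m)%nat). specialize (hm k ltac:(unfold k; lia)).
      pose proof (near_increment (x N) (x k) _ s z w (ha N) (ha k) (H N k ltac:(unfold k; lia))
        hs ltac:(lra) hws) as K.
      pose proof (hf w dw k). pose proof (hf z hz k).
      replace (x N w - f w - (x N z - f z))%C with
        ((x N w - x k w - (x N z - x k z)) + ((x k w - f w) - (x k z - f z)))%C by ring.
      eapply Rle_trans; [apply Cmod_triangle|].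
      pose proof (Cmod_triangle_sub (x k w - f w) (x k z - f z)).
      replace (c * (/ 2) ^ N) with ((/ 2) ^ N / (1 - s ^ 2)) by (unfold c; field; lra).
      lra. }
    pose proof (hd w hw1) as I2. pose proof (hg z hz N) as I3.
    replace (f w - f z - (w - z) * g z)%C with
      ((x N w - x N z - (w - z) * C_derive (x N) z) + (w - z) * (C_derive (x N) z - g z) +
       - ((x N w - f w) - (x N z - f z)))%C by ring.
    eapply Rle_trans; [apply Cmod_triangle|].
    eapply Rle_trans; [apply Rplus_le_compat_r, Cmod_triangle|].
    rewrite Cmod_opp, Cmod_mult.
    assert (I3' : Cmod (C_derive (x N) z - g z) <= eps / 3).
    { eapply Rle_trans; [exact I3|]. apply Rle_trans with (c * (/ 2) ^ N); [|lra].
      apply Rmult_le_compat_r; [apply pos2|]. unfold c, Rdiv.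
      apply Rmult_le_compat_l; [lra|]. pose proof (Cmod_ge_0 z).
      apply Rinv_le_contravar; nra. }
    pose proof (Cmod_ge_0 (w - z)) as w0.
    assert (Cmod (w - z) * Cmod (C_derive (x N) z - g z) <= Cmod (w - z) * (eps / 3))
      by (apply Rmult_le_compat_l; assumption).
    assert (c * (/ 2) ^ N * Cmod (w - z) <= eps / 3 * Cmod (w - z))
      by (apply Rmult_le_compat_r; lra).
    lra. }
  exists f. split; [intros z hz; exists (g z); apply hd, hz|].
  intros n z hz. apply le_epsilon. intros e he.
  destruct (small (cst (RtoC 0) + 1) e) as [m hm].
  { pose proof (cst0 _ disk_0). lra. } { exact he. }
  set (k := (n + m)%nat). specialize (hm k ltac:(unfold k; lia)).
  pose proof (H n k ltac:(unfold k; lia) z hz) as N1.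
  pose proof (hf _ disk_0 k) as N2. pose proof (hg z hz k) as N3.
  pose proof (Cmod_lt_1_sqr z hz) as hp.
  assert (N3' : Cmod (hder (x k) z - hder f z) <= (/ 2) ^ k).
  { rewrite (hder_eq f z _ (hd z hz)). unfold hder.
    replace (RtoC (1 - Cmod z ^ 2) * C_derive (x k) z - RtoC (1 - Cmod z ^ 2) * g z)%C with
      (RtoC (1 - Cmod z ^ 2) * (C_derive (x k) z - g z))%C by ring.
    rewrite Cmod_mult, Cmod_R, Rabs_pos_eq by lra.
    apply (Rmult_le_compat_l (1 - Cmod z ^ 2)) in N3; [|lra].
    replace ((1 - Cmod z ^ 2) * (1 / (1 - Cmod z ^ 2) * (/ 2) ^ k)) with ((/ 2) ^ k) in N3
      by (field; lra). exact N3. }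
  replace (x n (RtoC 0) - f (RtoC 0))%C with
    ((x n (RtoC 0) - x k (RtoC 0)) + (x k (RtoC 0) - f (RtoC 0)))%C by ring.
  replace (hder (x n) z - hder f z)%C with
    ((hder (x n) z - hder (x k) z) + (hder (x k) z - hder f z))%C by ring.
  pose proof (Cmod_triangle (x n (RtoC 0) - x k (RtoC 0)) (x k (RtoC 0) - f (RtoC 0))).
  pose proof (Cmod_triangle (hder (x n) z - hder (x k) z) (hder (x k) z - hder f z)).
  lra.
Qed.

(** * Total boundedness *)

(* [d x y e] stands for "[x] and [y] are at distance at most [e]". Classes rather
   than centres are used, so that no point of [S] has to be chosen. *)
Definition finely_covered {X : Type} (S : X -> Prop) (d : X -> X -> R -> Prop) (e : R) : Prop :=
  exists l : list (X -> Prop), (forall x, S x -> exists Q, In Q l /\ Q x) /\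
    forall Q x y, In Q l -> S x -> S y -> Q x -> Q y -> d x y e.

(** If no finite subfamily covers K, some class of each fine cover is again not finitely covered.
    This gives nested bad sets of size 2^-n shrinking to a point f of K, and one open set containing
    f swallows a whole bad set. *)
Lemma complete_totally_bounded_compact (K : (C -> C) -> Prop) :
  (forall f, K f -> bloch f) ->
  (forall x : nat -> C -> C, (forall n, K (x n)) ->
     (forall n m, (n <= m)%nat -> near (x n) (x m) ((/ 2) ^ n)) ->
     exists f, K f /\ forall n, near (x n) f ((/ 2) ^ n)) ->
  (forall e, 0 < e -> finely_covered K near e) ->
  bloch_compact K.
Proof.
  intros hK hcomp htb I U hopen hcov.
  set (bad (S : (C -> C) -> Prop) := forall l : list I, exists f, S f /\ forall i, In i l -> ~ U i f).
  assert (step : forall (S : (C -> C) -> Prop) e, (forall f, S f -> K f) -> 0 < e -> bad S ->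
    exists Q : (C -> C) -> Prop, bad (fun f => S f /\ Q f) /\
      forall f g, S f -> S g -> Q f -> Q g -> near f g e).
  { intros S e hS he hbad. destruct (htb e he) as (l & hl & hd).
    assert (exQ : exists Q, In Q l /\ bad (fun f => S f /\ Q f)).
    { apply NNPP. intros N.
      assert (fin : forall l', (forall Q, In Q l' -> In Q l) -> exists li : list I,
        forall f Q, In Q l' -> S f -> Q f -> exists i, In i li /\ U i f).
      { induction l' as [|Q l' IH]; intros hin.
        - exists nil. intros f Q [].
        - destruct (IH (fun Q' h => hin Q' (or_intror h))) as [li hli].
          assert (nb : ~ bad (fun f => S f /\ Q f)).
          { intros hb. apply N. exists Q. split; [apply hin; left; reflexivity | exact hb]. }
          apply not_all_ex_not in nb. destruct nb as [lq hlq].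
          exists (lq ++ li). intros f Q' [<-|h'] hSf hQf.
          + apply NNPP. intros N'. apply hlq. exists f. split; [auto|].
            intros i hi hU. apply N'. exists i. split; [apply in_or_app; auto | exact hU].
          + destruct (hli f Q' h' hSf hQf) as (i & hi & hU).
            exists i. split; [apply in_or_app; auto | exact hU]. }
      destruct (fin l (fun _ h => h)) as [li hli].
      destruct (hbad li) as (f & hSf & hf).
      destruct (hl f (hS f hSf)) as (Q & hQ & hQf).
      destruct (hli f Q hQ hSf hQf) as (i & hi & hU). exact (hf i hi hU). }
    destruct exQ as (Q & hQ & hbQ). exists Q. split; [exact hbQ|].
    intros f g hf hg. apply (hd Q); auto. }
  apply NNPP. intros N.
  assert (bad0 : bad K).
  { intros l. apply NNPP. intros N'. apply N. exists l. intros f hf. apply NNPP. intros N2.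
    apply N'. exists f. split; [exact hf|]. intros i hi hU. apply N2. exists i. auto. }
  (* Totalised over all pairs of a stage and a set, so that choice yields a function to iterate. *)
  assert (step' : forall p : nat * ((C -> C) -> Prop), exists Q : (C -> C) -> Prop,
    (forall f, snd p f -> K f) -> bad (snd p) ->
    bad (fun f => snd p f /\ Q f) /\
      forall f g, snd p f -> snd p g -> Q f -> Q g -> near f g ((/ 2) ^ (fst p))).
  { intros [n S]. destruct (classic ((forall f, S f -> K f) /\ bad S)) as [[h1 h2]|h].
    - destruct (step S ((/ 2) ^ n) h1 ltac:(apply pow_lt; lra) h2) as [Q hQ]. exists Q. auto.
    - exists (fun _ => True). intros h1 h2. exfalso. apply h. auto. }
  set (next p := proj1_sig (constructive_indefinite_description _ (step' p))).
  assert (hnext : forall p, (forall f, snd p f -> K f) -> bad (snd p) ->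
    bad (fun f => snd p f /\ next p f) /\
      forall f g, snd p f -> snd p g -> next p f -> next p g -> near f g ((/ 2) ^ (fst p))).
  { intros p. unfold next. apply proj2_sig. }
  set (S := fix S n := match n with O => K | Datatypes.S n => fun f => S n f /\ next (n, S n) f end).
  assert (hS : forall n, (forall f, S n f -> K f) /\ bad (S n)).
  { induction n as [|n [h1 h2]]; [simpl; auto|]. split.
    - intros f [hf _]. auto.
    - apply (hnext (n, S n) h1 h2). }
  assert (hdiam : forall n f g, S (Datatypes.S n) f -> S (Datatypes.S n) g -> near f g ((/ 2) ^ n)).
  { intros n f g [f1 f2] [g1 g2]. destruct (hS n) as [h1 h2].
    apply (hnext (n, S n) h1 h2); assumption. }
  assert (hmono : forall n m f, (n <= m)%nat -> S m f -> S n f).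
  { intros n m f hnm. induction hnm as [|m hnm IH]; [auto|]. intros [h _]. auto. }
  assert (hne : forall n, exists f, S (Datatypes.S n) f).
  { intros n. destruct (proj2 (hS (Datatypes.S n)) nil) as (f & hf & _). exists f; exact hf. }
  set (x n := proj1_sig (constructive_indefinite_description _ (hne n))).
  assert (hx : forall n, S (Datatypes.S n) (x n)) by (intros n; unfold x; apply proj2_sig).
  destruct (hcomp x) as (f & hf & hlim).
  { intros n. apply (proj1 (hS _) _ (hx n)). }
  { intros n m hnm. apply hdiam; [apply hx|]. apply (hmono _ (Datatypes.S m)); [lia | apply hx]. }
  destruct (hcov f hf) as [i hi].
  destruct (hopen i f (hK f hf) hi) as [r hr].
  destruct (pow_lt_1_zero (/ 2) ltac:(rewrite Rabs_pos_eq; lra) (r / 2)) as [n hn].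
  { pose proof (cond_pos r). lra. }
  specialize (hn n (le_n n)). rewrite Rabs_pos_eq in hn by (apply pow_le; lra).
  destruct (proj2 (hS (Datatypes.S n)) [i]) as (g & hg & hgU).
  apply (hgU i (or_introl eq_refl)).
  assert (Kg : K g) by (apply (proj1 (hS _) _ hg)).
  apply hr; [apply hK, Kg|].
  apply bloch_dist_lt; [apply (hK g Kg) | apply (hK f hf)|].
  exists ((/ 2) ^ n + (/ 2) ^ n). split; [lra|].
  apply near_trans with (x n); [apply hdiam; [exact hg | apply hx] | apply hlim].
Qed.

(** * Fine finite covers of an interval, the disk and the unit ball *)

Lemma finely_covered_interval (e : R) : 0 < e ->
  finely_covered (fun x => -1 <= x <= 1) (fun x y e => Rabs (x - y) <= e) e.
Proof.
  intros he. destruct (nfloor_ex (2 / e)) as [N [hN1 hN2]].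
  { apply Rdiv_le_0_compat; lra. }
  exists (map (fun k x => INR k * e <= x + 1 <= (INR k + 1) * e) (seq 0 (S N))). split.
  - intros x hx. destruct (nfloor_ex ((x + 1) / e)) as [k [h1 h2]].
    { apply Rdiv_le_0_compat; lra. }
    assert (E : (x + 1) / e * e = x + 1) by (field; lra).
    assert (E2 : 2 / e * e = 2) by (field; lra).
    exists (fun x => INR k * e <= x + 1 <= (INR k + 1) * e). split.
    + apply in_map_iff. exists k. split; [reflexivity|]. apply in_seq. split; [lia|].
      assert (INR k < INR (S N)).
      { rewrite S_INR. eapply Rle_lt_trans; [exact h1|]. eapply Rle_lt_trans; [|exact hN2].
        apply Rmult_le_compat_r; [left; apply Rinv_0_lt_compat; exact he | lra]. }
      apply INR_lt in H. lia.
    + split; nra.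
  - intros Q x y hQ _ _ hx hy. apply in_map_iff in hQ. destruct hQ as (k & <- & _).
    apply Rabs_le_between. lra.
Qed.

Lemma finely_covered_disk (e : R) : 0 < e ->
  finely_covered (fun z => Cmod z <= 1) (fun z w e => Cmod (z - w) <= e) e.
Proof.
  intros he. destruct (finely_covered_interval (e / 2) ltac:(lra)) as (l & h1 & h2).
  assert (hre : forall z, Cmod z <= 1 -> -1 <= Re z <= 1).
  { intros z hz. apply Rabs_le_between. eapply Rle_trans; [apply re_le_Cmod | exact hz]. }
  assert (him : forall z, Cmod z <= 1 -> -1 <= Im z <= 1).
  { intros z hz. apply Rabs_le_between.
    eapply Rle_trans; [apply Rmax_r | eapply Rle_trans; [apply Rmax_Cmod | exact hz]]. }
  exists (map (fun p (z : C) => fst p (Re z) /\ snd p (Im z)) (list_prod l l)). split.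
  - intros z hz. destruct (h1 _ (hre z hz)) as (Q1 & i1 & q1).
    destruct (h1 _ (him z hz)) as (Q2 & i2 & q2).
    exists (fun z => Q1 (Re z) /\ Q2 (Im z)). split; [|auto].
    apply in_map_iff. exists (Q1, Q2). split; [reflexivity|]. apply in_prod; assumption.
  - intros Q z w hQ hz hw qz qw. apply in_map_iff in hQ. destruct hQ as ([Q1 Q2] & <- & hin).
    apply in_prod_iff in hin. simpl in qz, qw.
    pose proof (h2 Q1 _ _ (proj1 hin) (hre z hz) (hre w hw) (proj1 qz) (proj1 qw)) as k1.
    pose proof (h2 Q2 _ _ (proj2 hin) (him z hz) (him w hw) (proj2 qz) (proj2 qw)) as k2.
    eapply Rle_trans; [apply Cmod_le_sqrt2_Rmax|].
    change (fst (z - w)%C) with (Re z - Re w). change (snd (z - w)%C) with (Im z - Im w).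
    assert (Rmax (Rabs (Re z - Re w)) (Rabs (Im z - Im w)) <= e / 2)
      by (apply Rmax_lub; assumption). lra.
Qed.

(** Functions have to be sampled at actual points of the disk of radius r, so every class that meets
    this disk is given a representative in it. *)
Lemma finite_net (r e : R) : r <= 1 -> 0 < e ->
  exists P : list C, (forall p, In p P -> Cmod p <= r) /\
    forall z, Cmod z <= r -> exists p, In p P /\ Cmod (z - p) <= e.
Proof.
  intros hr he. destruct (finely_covered_disk e he) as (l & h1 & h2).
  assert (N : forall l', (forall Q, In Q l' -> In Q l) ->
    exists P : list C, (forall p, In p P -> Cmod p <= r) /\
    forall z Q, Cmod z <= r -> In Q l' -> Q z -> exists p, In p P /\ Cmod (z - p) <= e).
  { induction l' as [|Q l' IH]; intros hin.
    - exists nil. split; [intros p [] | intros z Q _ []].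
    - destruct (IH (fun Q' h => hin Q' (or_intror h))) as (P & p1 & p2).
      destruct (classic (exists p, Cmod p <= r /\ Q p)) as [(p & hp & hQp)|hn].
      + exists (p :: P). split; [intros q [<-|hq]; auto|].
        intros z Q' hz [<-|hQ'] hQz.
        * exists p. split; [left; reflexivity|].
          apply (h2 Q); try assumption; [apply hin; left; reflexivity | lra | lra].
        * destruct (p2 z Q' hz hQ' hQz) as (q & hq & hzq). exists q. split; [right|]; assumption.
      + exists P. split; [exact p1|]. intros z Q' hz [<-|hQ'] hQz; [|apply (p2 z Q'); assumption].
        exfalso. apply hn. exists z. auto. }
  destruct (N l (fun _ h => h)) as (P & p1 & p2).
  exists P. split; [exact p1|]. intros z hz.
  destruct (h1 z ltac:(lra)) as (Q & hQ & hQz). apply (p2 z Q); assumption.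
Qed.

Lemma finely_covered_values (P : list C) (e : R) : 0 < e -> (forall p, In p P -> disk p) ->
  finely_covered unit_fun (fun f g e => forall p, In p P -> Cmod (f p - g p) <= e) e.
Proof.
  intros he. destruct (finely_covered_disk e he) as (l & h1 & h2).
  induction P as [|p P IH]; intros hP.
  - exists [fun _ => True]. split.
    + intros f _. exists (fun _ => True). simpl; auto.
    + intros Q f g _ _ _ _ _ p [].
  - destruct (IH (fun q h => hP q (or_intror h))) as (L & g1 & g2).
    assert (dp : disk p) by (apply hP; left; reflexivity).
    exists (map (fun q (f : C -> C) => fst q f /\ snd q (f p)) (list_prod L l)). split.
    + intros f hf. destruct (g1 f hf) as (Q1 & i1 & q1).
      destruct (h1 (f p) (proj2 hf p dp)) as (Q2 & i2 & q2).
      exists (fun f => Q1 f /\ Q2 (f p)). split; [|auto].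
      apply in_map_iff. exists (Q1, Q2). split; [reflexivity | apply in_prod; assumption].
    + intros Q f g hQ hf hg qf qg q hq. apply in_map_iff in hQ.
      destruct hQ as ([Q1 Q2] & <- & hin). apply in_prod_iff in hin. simpl in qf, qg.
      destruct hq as [<-|hq].
      * apply (h2 Q2); try tauto; [apply hf, dp | apply hg, dp].
      * apply (g2 Q1); tauto.
Qed.

(* Montel's theorem, in quantitative form. *)
Lemma finely_covered_unit_fun (r e : R) : 0 <= r < 1 -> 0 < e ->
  finely_covered unit_fun (fun f g e => forall w, Cmod w <= r -> Cmod (f w - g w) <= e) e.
Proof.
  intros hr he.
  set (L := 2 * 1 / (1 - r)). assert (hL : 0 < L) by (unfold L; apply Rdiv_lt_0_compat; lra).
  (* Two Lipschitz errors [L * d], from moving to a net point, and one error [d] between the sampled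
     values. *)
  set (d := e / (2 * L + 1)). assert (hd : 0 < d) by (apply Rdiv_lt_0_compat; lra).
  assert (Ed : d * (2 * L + 1) = e) by (unfold d; field; lra).
  destruct (finite_net r d ltac:(lra) hd) as (P & p1 & p2).
  destruct (finely_covered_values P d hd) as (l & h1 & h2).
  { intros p hp. unfold disk. specialize (p1 p hp). lra. }
  assert (lip : forall f w p, unit_fun f -> Cmod w <= r -> Cmod p <= r ->
    Cmod (f w - f p) <= L * Cmod (w - p)).
  { intros f w p [hf hf1] hw hp.
    apply (ball_lipschitz f (RtoC 0) 1 1); rewrite ?Cmod_sub_0; try lra;
      intros z hz; rewrite Cmod_sub_0 in hz; [apply hf | apply hf1]; exact hz. }
  exists l. split; [exact h1|]. intros Q f g hQ hf hg qf qg w hw.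
  destruct (p2 w hw) as (p & hp & hwp).
  pose proof (h2 Q f g hQ hf hg qf qg p hp) as k1.
  pose proof (lip f w p hf hw (p1 p hp)) as k2. pose proof (lip g w p hg hw (p1 p hp)) as k3.
  replace (f w - g w)%C with ((f w - f p) + (f p - g p) + - (g w - g p))%C by ring.
  eapply Rle_trans; [apply Cmod_le_plus2; reflexivity|]. rewrite Cmod_opp.
  assert (L * Cmod (w - p) <= L * d) by (apply Rmult_le_compat_l; lra).
  lra.
Qed.

(** * The equivalences *)

(** The reason for the difference in the test functions: sigma_a - a = -(1 - |a|^2) w/(1 - conj a w)
    tends to 0 locally uniformly as |a| -> 1. *)
Lemma test_fun_small (n m : nat) (a b w : C) (r : R) : disk a -> disk b ->
  Cmod w <= r -> r < 1 -> Cmod (test_fun n m a b w) <= 2 * (1 - Cmod a) / (1 - r).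
Proof.
  intros ha hb hw hr. assert (dw : disk w) by (unfold disk; lra).
  rewrite test_fun_mono. unfold mono.
  replace (Cpow (sigma a w) (n + 1)) with (Cpow (sigma a w) n * sigma a w)%C
    by (rewrite Cpow_add_r, Cpow_1_r; reflexivity).
  replace (Cpow (sigma a w) n * sigma a w * Cpow (sigma b w) m -
     a * (Cpow (sigma a w) n * Cpow (sigma b w) m))%C with
    ((sigma a w - a) * mono n m a b w)%C by (unfold mono; ring).
  replace (sigma a w - a)%C with (- (RtoC (1 - Cmod a ^ 2) * (w / (1 - Cconj a * w))))%C.
  2: { unfold sigma. rewrite RtoC_minus, Cmod_sqr_expand. field. apply mobius_denom_neq; assumption. }
  pose proof (proj2 (unit_fun_mono n m a b ha hb) w dw) as h1.
  pose proof (Cmod_ge_0 (mono n m a b w)).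
  rewrite Cmod_mult, Cmod_opp, Cmod_mult, Cmod_R.
  pose proof (Cmod_lt_1_sqr a ha). rewrite Rabs_pos_eq by lra.
  rewrite Cmod_div by (apply mobius_denom_neq; assumption).
  pose proof (mobius_denom_ge a w). pose proof (mobius_denom_pos a w ha dw).
  pose proof (Cmod_ge_0 w) as w0. pose proof (Cmod_ge_0 a). unfold disk in ha, dw.
  assert (K1 : Cmod w / Cmod (1 - Cconj a * w) <= 1 / (1 - r)).
  { unfold Rdiv. apply Rmult_le_compat; [exact w0 | left; apply Rinv_0_lt_compat; lra | lra |].
    apply Rinv_le_contravar; nra. }
  assert (K0 : 0 <= Cmod w / Cmod (1 - Cconj a * w)) by (apply Rdiv_le_0_compat; lra).
  assert (K2 : 1 - Cmod a ^ 2 <= 2 * (1 - Cmod a)).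
  { pose proof (pow2_ge_0 (1 - Cmod a)). lra. }
  apply Rle_trans with (2 * (1 - Cmod a) * (1 / (1 - r)) * 1).
  - apply Rmult_le_compat; [apply Rmult_le_pos; lra | lra | | lra].
    apply Rmult_le_compat; lra.
  - right. unfold Rdiv. ring.
Qed.

Lemma unit_fun_half (f : C -> C) : analytic_disk f -> (forall z, disk z -> Cmod (f z) <= 2) ->
  unit_fun (fun z => RtoC (/ 2) * f z)%C.
Proof.
  intros hf h. split; [apply (analytic_mult (fun _ => RtoC (/ 2)) f (analytic_const _) hf)|].
  intros z hz. rewrite Cmod_mult, Cmod_R, Rabs_pos_eq by lra. specialize (h z hz). lra.
Qed.

Lemma analytic_test_fun (n m : nat) (a b : C) : disk a -> disk b ->
  analytic_disk (test_fun n m a b).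
Proof.
  intros ha hb. rewrite test_fun_mono. apply analytic_minus.
  - apply unit_fun_mono; assumption.
  - apply (analytic_mult (fun _ => a)); [apply analytic_const | apply unit_fun_mono; assumption].
Qed.

Lemma test_fun_le_2 (n m : nat) (a b z : C) : disk a -> disk b -> disk z ->
  Cmod (test_fun n m a b z) <= 2.
Proof.
  intros ha hb hz. rewrite test_fun_mono.
  eapply Rle_trans; [apply Cmod_triangle_sub|]. rewrite Cmod_mult.
  pose proof (proj2 (unit_fun_mono (n + 1) m a b ha hb) z hz).
  pose proof (proj2 (unit_fun_mono n m a b ha hb) z hz).
  pose proof (Cmod_ge_0 (mono n m a b z)). unfold disk in ha. pose proof (Cmod_ge_0 a). nra.
Qed.

Lemma unit_fun_pow (k : nat) : unit_fun (fun w => Cpow w k).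
Proof.
  split; [apply analytic_pow|]. intros z hz. rewrite Cmod_pow.
  apply pow_le_1. unfold disk in hz. pose proof (Cmod_ge_0 z). lra.
Qed.

Section Equivalences.

Variables u v phi psi : C -> C.
Hypothesis hu : analytic_disk u.
Hypothesis hv : analytic_disk v.
Hypothesis hphi : self_map_disk phi.
Hypothesis hpsi : self_map_disk psi.

Let T := wcomp_diff u phi v psi.
Let jt := op_jet u phi v psi.

Let T_analytic (f : C -> C) : analytic_disk f -> analytic_disk (T f).
Proof. intros hf. apply analytic_wcomp_diff; assumption. Qed.

Let T_jet (f : C -> C) (z : C) : analytic_disk f -> disk z -> hder (T f) z = jt z f.
Proof. intros hf hz. apply hder_wcomp_diff; assumption. Qed.

Let jt_scal (c : C) (f : C -> C) (z : C) : analytic_disk f -> disk z ->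
  jt z (fun w => c * f w)%C = (c * jt z f)%C.
Proof. intros hf hz. apply jet_scal; [apply hphi, hz | apply hpsi, hz | exact hf]. Qed.

(* The epsilon form of: [T f_n -> 0] in the Bloch seminorm whenever [f_n] is in
   the unit ball and tends to [0] locally uniformly. *)
Definition vanishing_at_boundary : Prop :=
  forall e, 0 < e -> exists r k, 0 < r < 1 /\ 0 < k /\
  forall f, unit_fun f -> (forall w, Cmod w <= r -> Cmod (f w) <= k) ->
  forall z, disk z -> Cmod (op_jet u phi v psi z f) <= e.

Lemma vanishing_tests : vanishing_at_boundary -> forall n m e, 0 < e ->
  exists d, 0 < d /\ forall a b z, disk a -> disk b -> disk z ->
  1 - d < Cmod a -> Cmod (op_jet u phi v psi z (test_fun n m a b)) <= e.
Proof.
  intros K n m e he. destruct (K (e / 2) ltac:(lra)) as (r & k & hr & hk & H).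
  (* With 1 - |a| below this, [test_fun_small] gives at most 2 k, and the halved test function is at
     most k. *)
  exists (k * (1 - r)). split; [apply Rmult_lt_0_compat; lra|].
  intros a b z ha hb hz had.
  specialize (H _ (unit_fun_half _ (analytic_test_fun n m a b ha hb)
    (fun z hz => test_fun_le_2 n m a b z ha hb hz))).
  assert (S : Cmod (jt z (fun w => RtoC (/ 2) * test_fun n m a b w)%C) <= e / 2).
  { apply H; [|exact hz]. intros w hw.
    rewrite Cmod_mult, Cmod_R, Rabs_pos_eq by lra.
    pose proof (test_fun_small n m a b w r ha hb hw ltac:(lra)) as B.
    assert (2 * (1 - Cmod a) / (1 - r) <= 2 * k).
    { apply (Rmult_le_reg_r (1 - r)); [lra|]. unfold Rdiv.
      rewrite Rmult_assoc, Rinv_l by lra. lra. }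
    lra. }
  rewrite jt_scal in S by (exact hz || apply analytic_test_fun; assumption).
  rewrite Cmod_mult, Cmod_R, Rabs_pos_eq in S by lra. fold (jt z). lra.
Qed.

Lemma vanishing_powers : vanishing_at_boundary -> forall e, 0 < e ->
  exists N, forall k z, (N <= k)%nat -> disk z -> Cmod (op_jet u phi v psi z (fun w => Cpow w k)) <= e.
Proof.
  intros K e he. destruct (K e he) as (r & k & hr & hk & H).
  destruct (pow_lt_1_zero r ltac:(rewrite Rabs_pos_eq; lra) k hk) as [N hN].
  exists N. intros n z hn hz. apply H; [apply unit_fun_pow | | exact hz].
  intros w hw. rewrite Cmod_pow. specialize (hN n hn).
  rewrite Rabs_pos_eq in hN by (apply pow_le; lra).
  eapply Rle_trans; [|left; exact hN].
  apply pow_incr. split; [apply Cmod_ge_0 | exact hw].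
Qed.

(** For a single z the functional is continuous for locally uniform convergence. Here r and k depend
    on z; compactness is what makes them uniform. *)
Lemma op_jet_local (z : C) (e : R) : disk z -> 0 < e -> exists r k, 0 < r < 1 /\ 0 < k /\
  forall f, analytic_disk f -> (forall w, Cmod w <= r -> Cmod (f w) <= k) ->
  Cmod (op_jet u phi v psi z f) <= e.
Proof.
  intros hz he.
  pose proof (proj2 hphi z hz) as da. pose proof (proj2 hpsi z hz) as db. unfold disk in da, db.
  set (r := Rmax (/ 2) (Rmax (Cmod (phi z)) (Cmod (psi z)))).
  assert (hr : / 2 <= r < 1 /\ Cmod (phi z) <= r /\ Cmod (psi z) <= r).
  { unfold r. pose proof (Rmax_l (/ 2) (Rmax (Cmod (phi z)) (Cmod (psi z)))).
    pose proof (Rmax_r (/ 2) (Rmax (Cmod (phi z)) (Cmod (psi z)))).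
    pose proof (Rmax_l (Cmod (phi z)) (Cmod (psi z))).
    pose proof (Rmax_r (Cmod (phi z)) (Cmod (psi z))).
    repeat split; try lra. repeat apply Rmax_lub_lt; lra. }
  set (s := (1 + r) / 2). set (K := 40 / (s - r) ^ 2).
  assert (hs : r < s < 1) by (unfold s; lra).
  assert (K0 : 0 < K) by (apply Rdiv_lt_0_compat; [lra | apply pow_lt; lra]).
  set (S := Cmod (hder u z) + Cmod (lift_coef u phi z) +
    (Cmod (hder v z) + Cmod (lift_coef v psi z))).
  assert (S0 : 0 <= S).
  { unfold S. pose proof (Cmod_ge_0 (hder u z)). pose proof (Cmod_ge_0 (hder v z)).
    pose proof (Cmod_ge_0 (lift_coef u phi z)). pose proof (Cmod_ge_0 (lift_coef v psi z)). lra. }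
  exists s, (e / (S + 1) / K). split; [lra|].
  assert (hk : 0 < e / (S + 1) / K)
    by (apply Rdiv_lt_0_compat; [apply Rdiv_lt_0_compat; lra | exact K0]).
  split; [exact hk|]. intros f hf hfk.
  destruct (small_disk_estimates f r s _ (phi z) (psi z) hf ltac:(lra) ltac:(lra) hfk
    ltac:(lra) ltac:(lra)) as (a1 & a2 & _).
  destruct (small_disk_estimates f r s _ (psi z) (psi z) hf ltac:(lra) ltac:(lra) hfk
    ltac:(lra) ltac:(lra)) as (b1 & b2 & _).
  fold K in a1, a2, b1, b2.
  replace (K * (e / (S + 1) / K)) with (e / (S + 1)) in a1, a2, b1, b2 by (field; lra).
  eapply Rle_trans; [apply (jet_bound_crude _ _ _ _ _ _ f _ _ a1 a2 b1 b2)|].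
  rewrite <- Rmult_plus_distr_l. fold S.
  apply (Rmult_le_reg_r (S + 1)); [lra|].
  replace (e / (S + 1) * S * (S + 1)) with (e * S) by (field; lra). nra.
Qed.

Let image_unit_ball (g : C -> C) : Prop :=
  exists f, Hinf f /\ Rbar_le (Hinf_norm f) 1 /\ g = T f.

Variable M : R.
Hypothesis hM : forall f z, unit_fun f -> disk z -> Cmod (hder (T f) z) <= M.

Let image_in_closure (f : C -> C) : unit_fun f -> bloch_closure image_unit_ball (T f).
Proof.
  intros hf. split; [apply (bloch_intro _ M); [apply T_analytic, hf | intros; apply hM; assumption]|].
  intros r. exists (T f). split.
  - exists f. destruct (unit_fun_Hinf f hf). auto.
  - apply bloch_dist_lt; [apply T_analytic, hf | apply T_analytic, hf|].
    exists 0. split; [apply r | apply near_refl; lra].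
Qed.

Let open_ball (g : C -> C) (c : R) (h : C -> C) : Prop := exists c', c' < c /\ near h g c'.

Let open_ball_open (g : C -> C) (c : R) : bloch_open (open_ball g c).
Proof.
  intros f hf (c' & hc' & H). assert (hr : 0 < c - c') by lra.
  exists (mkposreal _ hr). intros h hh hd. cbn [pos] in hd.
  apply bloch_dist_lt in hd; [|apply hh | apply hf]. destruct hd as (d & hd & Hd).
  exists (d + c'). split; [lra|]. apply near_trans with f; assumption.
Qed.

(** A set is good if one pair (r, k) works for all f with T f in it. Good open sets cover the
    closure of the image, and finitely many pairs are merged by the largest r and the smallest k. *)
Lemma compact_vanishing :
  compact_Hinf_bloch (wcomp_diff u phi v psi) -> vanishing_at_boundary.
Proof.
  intros hc e he.
  set (good (U : (C -> C) -> Prop) := exists r k, 0 < r < 1 /\ 0 < k /\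
    forall f, unit_fun f -> (forall w, Cmod w <= r -> Cmod (f w) <= k) -> U (T f) ->
    forall z, disk z -> Cmod (jt z f) <= e).
  destruct (hc {U | bloch_open U /\ good U} (fun i => proj1_sig i)) as [l hl].
  - intros [U [h1 h2]]. exact h1.
  - intros g [hg _].
    (* If g has nonzero derivative m at z0, functions f small near phi z0 and psi z0 have T f
       outside the ball of radius m/2 about g, so this ball is good vacuously. If the derivative of
       g vanishes on the disk, closeness to g itself bounds the derivative of T f. *)
    destruct (classic (exists z, disk z /\ hder g z <> RtoC 0)) as [(z0 & hz0 & hne)|hz].
    + apply Cmod_gt_0 in hne. set (m := Cmod (hder g z0)) in *.
      assert (hgood : good (open_ball g (m / 2))).
      { destruct (op_jet_local z0 (m / 2) hz0 ltac:(lra)) as (r & k & hr & hk & H).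
        exists r, k. split; [exact hr|]. split; [exact hk|].
        intros f hf hfk (c & hc' & hn). exfalso.
        specialize (H f (proj1 hf) hfk). specialize (hn z0 hz0).
        rewrite T_jet in hn by (apply hf || exact hz0).
        pose proof (Cmod_ge_0 (T f (RtoC 0) - g (RtoC 0))).
        pose proof (Cmod_triangle_rev (hder g z0) (jt z0 f)) as t.
        rewrite Cmod_sub_sym in t. fold m in t. unfold jt in *. lra. }
      exists (exist _ (open_ball g (m / 2)) (conj (open_ball_open g (m / 2)) hgood)).
      exists 0. split; [lra | apply near_refl; lra].
    + assert (hgood : good (open_ball g e)).
      { exists (/ 2), 1. split; [lra|]. split; [lra|].
        intros f hf _ (c & hc' & hn) z hdz. specialize (hn z hdz).
        rewrite T_jet in hn by (apply hf || exact hdz).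
        assert (h0 : hder g z = RtoC 0).
        { apply NNPP. intros h. apply hz. exists z. auto. }
        rewrite h0 in hn. replace (jt z f - RtoC 0)%C with (jt z f) in hn by ring.
        pose proof (Cmod_ge_0 (T f (RtoC 0) - g (RtoC 0))). lra. }
      exists (exist _ (open_ball g e) (conj (open_ball_open g e) hgood)).
      exists 0. split; [lra | apply near_refl; lra].
  - assert (F : forall l' : list {U | bloch_open U /\ good U}, exists r k, 0 < r < 1 /\ 0 < k /\
      forall f i, In i l' -> unit_fun f -> (forall w, Cmod w <= r -> Cmod (f w) <= k) ->
      proj1_sig i (T f) -> forall z, disk z -> Cmod (jt z f) <= e).
    { induction l' as [|[U [hU hgU]] l' IH].
      - exists (/ 2), 1. split; [lra|]. split; [lra|]. intros f i [].
      - destruct IH as (r1 & k1 & hr1 & hk1 & H1). destruct hgU as (r2 & k2 & hr2 & hk2 & H2).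
        exists (Rmax r1 r2), (Rmin k1 k2).
        pose proof (Rmax_l r1 r2). pose proof (Rmax_r r1 r2).
        pose proof (Rmin_l k1 k2). pose proof (Rmin_r k1 k2).
        split; [split; [lra | apply Rmax_lub_lt; lra]|].
        split; [apply Rmin_glb_lt; assumption|].
        intros f i [<-|hi] hf hfk hUi.
        + apply H2; try assumption. intros w hw.
          eapply Rle_trans; [apply hfk; lra | assumption].
        + apply (H1 f i); try assumption. intros w hw.
          eapply Rle_trans; [apply hfk; lra | assumption]. }
    destruct (F l) as (r & k & hr & hk & H).
    exists r, k. split; [exact hr|]. split; [exact hk|]. intros f hf hfk.
    destruct (hl (T f) (image_in_closure f hf)) as (i & hi & hUi).
    apply (H f i); assumption.
Qed.

(** The functional sees only derivatives, so the value at 0 is treated apart, by enlarging r to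
    include phi 0 and psi 0. As f - g is bounded by 2, it is halved first, which explains e/4. *)
Let vanishing_near (e : R) : vanishing_at_boundary -> 0 < e ->
  exists r k, 0 < r < 1 /\ 0 < k /\ forall f g, unit_fun f -> unit_fun g ->
  (forall w, Cmod w <= r -> Cmod (f w - g w) <= k) -> near (T f) (T g) e.
Proof.
  intros K he. destruct (K (e / 4) ltac:(lra)) as (r1 & k1 & hr1 & hk1 & H).
  pose proof (proj2 hphi _ disk_0) as d1. pose proof (proj2 hpsi _ disk_0) as d2.
  unfold disk in d1, d2.
  set (r := Rmax r1 (Rmax (Cmod (phi (RtoC 0))) (Cmod (psi (RtoC 0))))).
  assert (hr : r1 <= r < 1 /\ Cmod (phi (RtoC 0)) <= r /\ Cmod (psi (RtoC 0)) <= r).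
  { unfold r. pose proof (Rmax_l r1 (Rmax (Cmod (phi (RtoC 0))) (Cmod (psi (RtoC 0))))).
    pose proof (Rmax_r r1 (Rmax (Cmod (phi (RtoC 0))) (Cmod (psi (RtoC 0))))).
    pose proof (Rmax_l (Cmod (phi (RtoC 0))) (Cmod (psi (RtoC 0)))).
    pose proof (Rmax_r (Cmod (phi (RtoC 0))) (Cmod (psi (RtoC 0)))).
    repeat split; try lra. repeat apply Rmax_lub_lt; lra. }
  set (S := Cmod (u (RtoC 0)) + Cmod (v (RtoC 0))).
  assert (S0 : 0 <= S).
  { unfold S. pose proof (Cmod_ge_0 (u (RtoC 0))). pose proof (Cmod_ge_0 (v (RtoC 0))). lra. }
  set (k := Rmin k1 (e / 2 / (S + 1))).
  assert (hk : 0 < k) by (apply Rmin_glb_lt; [exact hk1 | repeat apply Rdiv_lt_0_compat; lra]).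
  assert (hkk : k <= k1) by apply Rmin_l.
  assert (hkS : k * S <= e / 2).
  { assert (k <= e / 2 / (S + 1)) by apply Rmin_r.
    apply (Rmult_le_compat_r (S + 1)) in H0; [|lra].
    replace (e / 2 / (S + 1) * (S + 1)) with (e / 2) in H0 by (field; lra). nra. }
  exists r, k. split; [lra|]. split; [exact hk|].
  intros f g hf hg hfg z hz.
  assert (V0 : Cmod (T f (RtoC 0) - T g (RtoC 0)) <= e / 2).
  { unfold T, wcomp_diff, wcomp. set (o := RtoC 0) in *.
    replace (u o * f (phi o) - v o * f (psi o) - (u o * g (phi o) - v o * g (psi o)))%C with
      (u o * (f (phi o) - g (phi o)) - v o * (f (psi o) - g (psi o)))%C by ring.
    eapply Rle_trans; [apply Cmod_triangle_sub|]. rewrite !Cmod_mult.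
    pose proof (hfg (phi o) ltac:(lra)). pose proof (hfg (psi o) ltac:(lra)).
    pose proof (Cmod_ge_0 (u o)). pose proof (Cmod_ge_0 (v o)).
    assert (Cmod (u o) * Cmod (f (phi o) - g (phi o)) <= Cmod (u o) * k)
      by (apply Rmult_le_compat_l; assumption).
    assert (Cmod (v o) * Cmod (f (psi o) - g (psi o)) <= Cmod (v o) * k)
      by (apply Rmult_le_compat_l; assumption).
    unfold S in hkS. lra. }
  assert (ad : analytic_disk (fun w => f w - g w)%C) by (apply analytic_minus; [apply hf | apply hg]).
  assert (V1 : Cmod (jt z (fun w => RtoC (/ 2) * (f w - g w))%C) <= e / 4).
  { apply H; [|intros w hw|exact hz].
    - apply (unit_fun_half (fun w => f w - g w)%C); [exact ad|].
      intros w hw. eapply Rle_trans; [apply Cmod_triangle_sub|].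
      pose proof (proj2 hf w hw). pose proof (proj2 hg w hw). lra.
    - rewrite Cmod_mult, Cmod_R, Rabs_pos_eq by lra.
      pose proof (hfg w ltac:(lra)). pose proof (Cmod_ge_0 (f w - g w)). lra. }
  rewrite (jt_scal _ (fun w => f w - g w)%C z ad hz) in V1.
  rewrite Cmod_mult, Cmod_R, Rabs_pos_eq in V1 by lra.
  rewrite !T_jet by (exact hz || apply hf || apply hg).
  assert (E : jt z (fun w => f w - g w)%C = (jt z f - jt z g)%C).
  { transitivity (RtoC 1 * jt z f - RtoC 1 * jt z g)%C; [|ring].
    apply jet_combine; [apply hphi, hz | apply hpsi, hz | apply hf | apply hg |].
    intros; ring. }
  rewrite E in V1. lra.
Qed.

Lemma vanishing_compact :
  vanishing_at_boundary -> compact_Hinf_bloch (wcomp_diff u phi v psi).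
Proof.
  intros K. apply complete_totally_bounded_compact.
  - intros f [h _]. exact h.
  - intros x hx hn.
    destruct (bloch_complete x (fun n => proj1 (proj1 (hx n))) hn) as (f & hf & hlim).
    exists f. split; [|exact hlim]. split.
    + destruct (bloch_bound (x O) (proj1 (hx O))) as [c hc].
      apply (bloch_intro f (c + 1)); [exact hf|]. intros z hz.
      specialize (hlim O z hz). specialize (hc z hz). simpl in hlim.
      pose proof (Cmod_triangle_rev (hder f z) (hder (x O) z)) as t.
      rewrite Cmod_sub_sym in t.
      pose proof (Cmod_ge_0 (x O (RtoC 0) - f (RtoC 0))). lra.
    + intros r.
      destruct (pow_lt_1_zero (/ 2) ltac:(rewrite Rabs_pos_eq; lra) (r / 2)) as [n hn'].
      { pose proof (cond_pos r). lra. }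
      specialize (hn' n (le_n n)). rewrite Rabs_pos_eq in hn' by (apply pow_le; lra).
      assert (hr2 : 0 < r / 2) by (pose proof (cond_pos r); lra).
      destruct (proj2 (hx n) (mkposreal _ hr2)) as (g & hg & hgd). cbn [pos] in hgd.
      exists g. split; [exact hg|].
      destruct hg as (g' & hg1 & hg2 & ->).
      assert (ag : analytic_disk (T g')) by (apply T_analytic, hg1).
      apply bloch_dist_lt in hgd; [|exact ag | apply (hx n)]. destruct hgd as (c & hc & hcn).
      apply bloch_dist_lt; [exact ag | exact hf|].
      exists (c + (/ 2) ^ n). split; [lra|]. apply near_trans with (x n); [exact hcn | apply hlim].
  - intros e he.
    destruct (vanishing_near (e / 3) K ltac:(lra)) as (r & k & hr & hk & H).
    destruct (finely_covered_unit_fun r k ltac:(lra) hk) as (l & l1 & l2).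
    (* Points of the closure need not be images, so a class collects all functions within e/3 of
       some T f with f in the Montel class Q. *)
    exists (map (fun Q (h : C -> C) => exists f, unit_fun f /\ Q f /\ near h (T f) (e / 3)) l).
    split.
    + intros h [hb hcl]. assert (he3 : 0 < e / 3) by lra.
      destruct (hcl (mkposreal _ he3)) as (g & (f & hf1 & hf2 & ->) & hd). cbn [pos] in hd.
      pose proof (Hinf_unit_fun f hf1 hf2) as hf.
      destruct (l1 f hf) as (Q & hQ & hQf).
      eexists. split; [apply in_map, hQ|]. exists f. split; [exact hf|]. split; [exact hQf|].
      apply bloch_dist_lt in hd; [|apply T_analytic, hf1 | apply hb].
      destruct hd as (c & hc & hcn). apply near_weaken with c; [apply near_sym, hcn | lra].
    + intros Q x y hQ _ _ hx hy. apply in_map_iff in hQ. destruct hQ as (Q0 & <- & hQ0).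
      destruct hx as (f & hf & qf & nf). destruct hy as (g & hg & qg & ng).
      apply near_weaken with (e / 3 + e / 3 + e / 3); [|lra].
      apply near_trans with (T g); [|apply near_sym, ng].
      apply near_trans with (T f); [exact nf|].
      apply H; try assumption. apply (l2 Q0); assumption.
Qed.

Lemma powers_tests : (forall e, 0 < e ->
    exists N, forall k z, (N <= k)%nat -> disk z ->
      Cmod (op_jet u phi v psi z (fun w => Cpow w k)) <= e) ->
  forall n m e, 0 < e -> exists d, 0 < d /\ forall a b z, disk a -> disk b -> disk z ->
  1 - d < Cmod a -> Cmod (op_jet u phi v psi z (test_fun n m a b)) <= e.
Proof.
  intros P n m e he.
  assert (M0 : 0 <= M).
  { eapply Rle_trans; [|apply (hM _ _ (unit_fun_pow 0) disk_0)]. apply Cmod_ge_0. }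
  set (t := 3 ^ n * 3 ^ m). assert (ht : 0 < t) by (apply Rmult_lt_0_compat; apply pow_lt; lra).
  assert (he' : 0 < e / (4 * t)) by (apply Rdiv_lt_0_compat; lra).
  destruct (P _ he') as [N hN].
  pose proof (pos_INR N) as N0.
  set (q := INR N * (t * M)). assert (q0 : 0 <= q) by (unfold q; apply Rmult_le_pos; nra).
  (* Makes the low-order contribution 2 (1 - |a|) q at most e/2; the choice e/(4 t) of the tail
     bound accounts for the other half. *)
  exists (e / (4 * (q + 1))). split; [apply Rdiv_lt_0_compat; lra|].
  intros a b z ha hb hz had.
  pose proof (jet_test_from_powers (phi z) (psi z) (hder u z) (hder v z)
    (lift_coef u phi z) (lift_coef v psi z) (proj2 hphi z hz) (proj2 hpsi z hz) M) as J.
  assert (hJ : forall g, unit_fun g -> Cmod (jt z g) <= M).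
  { intros g hg. rewrite <- T_jet by (exact hz || apply hg). apply hM; assumption. }
  specialize (J hJ n m a b N (e / (4 * t)) ha hb (fun k hk => hN k z hk hz)).
  eapply Rle_trans; [exact J|].
  replace (INR N * (3 ^ n * (3 ^ m * M))) with q by (unfold q, t; ring).
  replace (3 ^ n * (3 ^ m * (e / (4 * t)))) with (t * (e / (4 * t))) by (unfold t; ring).
  replace (2 * (t * (e / (4 * t)))) with (e / 2) by (field; lra).
  assert ((1 - Cmod a) * q <= e / (4 * (q + 1)) * q) by (apply Rmult_le_compat_r; lra).
  assert (e / (4 * (q + 1)) * q <= e / 4).
  { apply (Rmult_le_reg_r (4 * (q + 1))); [lra|].
    replace (e / (4 * (q + 1)) * q * (4 * (q + 1))) with (e * q) by (field; lra). nra. }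
  lra.
Qed.

Lemma tests_sup_iff (n m : nat) :
  tends_to_0 to_circle (fun a => sup_disk (fun b =>
    bloch_seminorm (wcomp_diff u phi v psi (test_fun n m a b)))) <->
  (forall e, 0 < e -> exists d, 0 < d /\ forall a b z, disk a -> disk b -> disk z ->
    1 - d < Cmod a -> Cmod (op_jet u phi v psi z (test_fun n m a b)) <= e).
Proof.
  split.
  - intros H e he. destruct (H (mkposreal e he)) as [d hd].
    exists d. split; [apply d|]. intros a b z ha hb hz had.
    specialize (hd a ha had). apply Rbar_le_of_abs_lt in hd. cbn [pos] in hd.
    pose proof (sup_disk_ge (fun b => bloch_seminorm (T (test_fun n m a b))) b hb) as hs.
    pose proof (proj1 (bloch_seminorm_le _ _) (Rbar_le_trans _ _ _ hs hd) z hz) as K.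
    rewrite T_jet in K; [exact K | apply analytic_test_fun; assumption | exact hz].
  - intros H eps. assert (he : 0 < eps / 2) by (pose proof (cond_pos eps); lra).
    destruct (H _ he) as (d & hd & K). exists (mkposreal d hd). cbn [pos].
    intros a ha had. apply Rbar_abs_lt_of_le.
    + eapply Rbar_le_trans; [apply bloch_seminorm_nonneg|].
      apply (sup_disk_ge (fun b => bloch_seminorm (T (test_fun n m a b))) (RtoC 0) disk_0).
    + apply sup_disk_le. intros b hb. apply bloch_seminorm_le. intros z hz.
      fold T. rewrite T_jet; [apply K; assumption | apply analytic_test_fun; assumption | exact hz].
Qed.

Lemma powers_sup_iff :
  tends_to_0 eventually (fun k =>
    bloch_seminorm (fun z => (u z * Cpow (phi z) k - v z * Cpow (psi z) k)%C)) <->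
  (forall e, 0 < e -> exists N, forall k z, (N <= k)%nat -> disk z ->
    Cmod (op_jet u phi v psi z (fun w => Cpow w k)) <= e).
Proof.
  split.
  - intros H e he. destruct (H (mkposreal e he)) as [N hN].
    exists N. intros k z hk hz. specialize (hN k hk).
    apply Rbar_le_of_abs_lt in hN. cbn [pos] in hN.
    pose proof (proj1 (bloch_seminorm_le _ _) hN z hz) as K.
    rewrite <- (T_jet (fun w => Cpow w k)); [exact K | apply analytic_pow | exact hz].
  - intros H eps. assert (he : 0 < eps / 2) by (pose proof (cond_pos eps); lra).
    destruct (H _ he) as [N hN]. exists N. intros k hk.
    apply Rbar_abs_lt_of_le; [apply bloch_seminorm_nonneg|].
    apply bloch_seminorm_le. intros z hz.
    change (Cmod (hder (T (fun w => Cpow w k)) z) <= eps / 2).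
    rewrite T_jet; [apply hN; assumption | apply analytic_pow | exact hz].
Qed.

End Equivalences.

Theorem theorem3p2 (u v phi psi : C -> C)
  (hu : analytic_disk u) (hv : analytic_disk v)
  (hphi : self_map_disk phi) (hpsi : self_map_disk psi)
  (hu_sup : Rbar_lt
     (sup_disk (fun z => Finite
        ((1 - Cmod z ^ 2) * Cmod (C_derive u z) * rho (phi z) (psi z))))
     p_infty)
  (hv_sup : Rbar_lt
     (sup_disk (fun z => Finite
        ((1 - Cmod z ^ 2) * Cmod (C_derive v z) * rho (phi z) (psi z))))
     p_infty)
  (hu_lim : tends_to_0_as_rho_to_0 (fun z => rho (phi z) (psi z))
     (fun z => (1 - Cmod z ^ 2) * Cmod (C_derive u z) * rho (phi z) (psi z)))
  (hv_lim : tends_to_0_as_rho_to_0 (fun z => rho (phi z) (psi z))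
     (fun z => (1 - Cmod z ^ 2) * Cmod (C_derive v z) * rho (phi z) (psi z)))
  (hbdd : bounded_Hinf_bloch (wcomp_diff u phi v psi)) :
  let i := compact_Hinf_bloch (wcomp_diff u phi v psi) in
  let ii := forall n m : nat,
    In (n, m) [(0, 0); (0, 1); (0, 2); (1, 2)]%nat ->
    tends_to_0 to_circle (fun a =>
      sup_disk (fun b =>
        bloch_seminorm (wcomp_diff u phi v psi (test_fun n m a b)))) in
  let iii := tends_to_0 eventually (fun k =>
    bloch_seminorm (fun z => (u z * Cpow (phi z) k - v z * Cpow (psi z) k)%C)) in
  (i <-> ii) /\ (ii <-> iii).
Proof.
  intros i ii iii.
  set (r z := rho (phi z) (psi z)).
  assert (r0 : forall z, 0 <= r z) by (intros; apply rho_nonneg).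
  assert (E : forall w z, disk z ->
    (1 - Cmod z ^ 2) * Cmod (C_derive w z) * r z = r z * Cmod (hder w z)).
  { intros w z hz. rewrite Cmod_hder by exact hz. ring. }
  assert (bound : forall w, Rbar_lt (sup_disk (fun z => Finite
      ((1 - Cmod z ^ 2) * Cmod (C_derive w z) * r z))) p_infty ->
    exists M, forall z, disk z -> r z * Cmod (hder w z) <= M).
  { intros w H.
    destruct (sup_disk_finite_bound (fun z => (1 - Cmod z ^ 2) * Cmod (C_derive w z) * r z))
      as [M hM].
    - intros z hz. rewrite E by exact hz.
      apply Rmult_le_pos; [apply r0 | apply Cmod_ge_0].
    - exact H.
    - exists M. intros z hz. rewrite <- E by exact hz. apply hM, hz. }
  assert (small : forall w, tends_to_0_as_rho_to_0 r
      (fun z => (1 - Cmod z ^ 2) * Cmod (C_derive w z) * r z) ->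
    forall e, 0 < e -> exists d, 0 < d /\ forall z, disk z -> r z < d ->
      r z * Cmod (hder w z) <= e).
  { intros w H e he. destruct (tends_to_0_as_rho_eps _ _ r0 H e he) as (d & hd & K).
    exists d. split; [exact hd|]. intros z hz hr. rewrite <- E by exact hz. apply K; assumption. }
  destruct (bound u hu_sup) as [Mu hMu]. destruct (bound v hv_sup) as [Mv hMv].
  destruct (bounded_operator_unit _ hbdd) as (M0 & hM0 & hT).
  set (M := Rmax M0 (Rmax Mu Mv)).
  assert (hM : M0 <= M /\ Mu <= M /\ Mv <= M).
  { unfold M. pose proof (Rmax_l M0 (Rmax Mu Mv)). pose proof (Rmax_r M0 (Rmax Mu Mv)).
    pose proof (Rmax_l Mu Mv). pose proof (Rmax_r Mu Mv). lra. }
  assert (ii_vanishing : ii -> vanishing_at_boundary u v phi psi).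
  { intros H e he. apply (tests_imply_vanishing u v phi psi hphi hpsi M); try exact he.
    - intros f z hf hz. rewrite <- hder_wcomp_diff by (assumption || apply hf).
      pose proof (hT f z hf hz). lra.
    - intros z hz. pose proof (hMu z hz). fold (r z). lra.
    - intros z hz. pose proof (hMv z hz). fold (r z). lra.
    - exact (small u hu_lim).
    - exact (small v hv_lim).
    - intros n m hnm. apply (tests_sup_iff u v phi psi hu hv hphi hpsi), H, hnm. }
  assert (vanishing_ii : vanishing_at_boundary u v phi psi -> ii).
  { intros K n m _. apply (tests_sup_iff u v phi psi hu hv hphi hpsi).
    apply (vanishing_tests u v phi psi hphi hpsi K). }
  split; split; intros H.
  - apply vanishing_ii. apply (compact_vanishing u v phi psi hu hv hphi hpsi M0 hT H).
  - apply (vanishing_compact u v phi psi hu hv hphi hpsi), ii_vanishing, H.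
  - apply (powers_sup_iff u v phi psi hu hv hphi hpsi).
    apply (vanishing_powers u v phi psi), ii_vanishing, H.
  - intros n m _. apply (tests_sup_iff u v phi psi hu hv hphi hpsi).
    apply (powers_tests u v phi psi hu hv hphi hpsi M0 hT).
    apply (powers_sup_iff u v phi psi hu hv hphi hpsi), H.
Qed.
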